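(* Let $\ell\in C([0,+\infty))$ be positive with $|\ell'(t)|<1$ for all $t\ge 0$, and put $L=\ell(0)$. Let $\varphi\in C^1([-L,+\infty))$ be real-valued with $\varphi'>0$ on $[-L,+\infty)$ and $\varphi(t+\ell(t))-\varphi(t-\ell(t))=2$ for all $t\ge 0$. Let $u^0\in H^1(0,L)$ with $u^0(0)=0$ and $u^1\in L^2(0,L)$, and let $u$ be the solution of the undamped ($\eta=0$) problem $$\begin{cases} u_{tt}-u_{xx}=0, & 0<x<\ell(t),\ t>0,\\ u_x(\ell(t),t)+\ell'(t)\,u_t(\ell(t),t)=0, & t>0,\\ u(0,t)=0, & t>0,\\ u(x,0)=u^0(x),\quad u_t(x,0)=u^1(x), & 0<x<L.\end{cases}$$ Then $$\frac{m(t)}{M(t_0)}E_\ell(t_0)\le E_\ell(t)\le\frac{M(t)}{m(t_0)}E_\ell(t_0),\qquad 0\le t_0<t.$$ Moreover, if $\varphi'$ is monotone for $t\in[t_0,t_1]$, where $0\le t_0<t_1$, then: (i) If $-1<\ell'(t)\le0$ on $[t_0,t_1]$, then $\varphi'$ and $E_\ell(t)$ are nondecreasing and satisfy $$\frac{\varphi'(t-\ell(t))}{\varphi'(t_0+\ell(t_0))}E_\ell(t_0)\le E_\ell(t)\le\frac{\varphi'(t+\ell(t))}{\varphi'(t_0-\ell(t_0))}E_\ell(t_0),\qquad t\in[t_0,t_1].$$ (ii) If $0\le\ell'(t)<1$ on $[t_0,t_1]$, then $\varphi'$ and $E_\ell(t)$ are nonincreasing and $$\frac{\varphi'(t+\ell(t))}{\varphi'(t_0-\ell(t_0))}E_\ell(t_0)\le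 E_\ell(t)\le\frac{\varphi'(t-\ell(t))}{\varphi'(t_0+\ell(t_0))}E_\ell(t_0),\qquad t\in[t_0,t_1].$$
   Context: Energy: $E_\ell(t):=\frac12\int_0^{\ell(t)}u_t^2(x,t)+u_x^2(x,t)\,dx$ for $t\ge 0$. $m(t):=\min_{x\in[0,\ell(t)]}\{\varphi'(t-x),\varphi'(t+x)\}$ and $M(t):=\max_{x\in[0,\ell(t)]}\{\varphi'(t-x),\varphi'(t+x)\}$ (minimum and maximum over all $x\in[0,\ell(t)]$ and both listed quantities). The solution $u$ is the unique one with $u\in C([0,T];V_0(0,\ell(t)))\cap C^1([0,T];L^2(0,\ell(t)))$ for every $T>0$, where $V_0(0,\ell(t)):=\{w\in H^1(0,\ell(t)):w(0)=0\}$.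
   Formalization: For (i) and (ii), φ' is assumed monotone on the whole interval [t0−ℓ(t0), t1+ℓ(t1)] of arguments t±x, not only on [t0,t1], and is concluded monotone there; with [t0,t1] alone the claim fails (ℓ=1, φ' 2-periodic). *)

(* Defs.v *)
From HB Require Import structures.
From mathcomp Require Export all_boot all_order all_algebra.
From mathcomp Require Export all_classical all_reals all_analysis.

Set Implicit Arguments.
Unset Strict Implicit.
Unset Printing Implicit Defensive.

Import Order.TTheory GRing.Theory Num.Theory.
Import numFieldNormedType.Exports.
Local Open Scope classical_set_scope.
Local Open Scope ring_scope.

(* Derivative of f at x relative to D: one-sided at an endpoint of the
   interval D, the usual derivative at an interior point. *)
Definition has_deriv_within (R : realType) (D : set R) (f : R -> R) (x l : R) :=
  (f y - f x) / (y - x) @[y --> within D x^'] --> l.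

Definition zero_ext (R : realType) (a : R) (f : R -> R) : R -> R :=
  f \_ `]0, a[.

Definition L2norm (R : realType) (f : R -> R) : \bar R :=
  Lnorm (@lebesgue_measure R) 2%:E (EFin \o f).

(* L^2(0, a), seen inside L^2 of the line. *)
Definition L2 (R : realType) (a : R) (f : R -> R) : Prop :=
  zero_ext a f \in Lfun (@lebesgue_measure R) 2%:E.

Definition C1 (R : realType) (psi : R -> R) : Prop :=
  (forall x : R, derivable psi x 1) /\ continuous (derive1 psi).

(* g is the weak derivative of w on ]0, a[, tested against C^1_c(0, a) as in
   Brezis, Functional Analysis, Sobolev Spaces and PDE, Section 8.2. *)
Definition weak_deriv (R : realType) (a : R) (w g : R -> R) : Prop :=
  forall psi : R -> R, C1 psi ->
    (exists c d : R, [/\ 0 < c, d < a &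
       forall x : R, x \notin `[c, d] -> psi x = 0]) ->
    \int[@lebesgue_measure R]_(x in `]0, a[) (w x * derive1 psi x) =
    - \int[@lebesgue_measure R]_(x in `]0, a[) (g x * psi x).

(* w in H^1(0, a), with w' = g. An element of H^1(0, a) is represented by its
   continuous representative on [0, a], which gives a meaning to w 0. *)
Definition H1_deriv (R : realType) (a : R) (w g : R -> R) : Prop :=
  [/\ {within `[0, a], continuous w}, L2 a w, L2 a g & weak_deriv a w g].

(* w in V_0(0, a), with w' = g. *)
Definition V0_deriv (R : realType) (a : R) (w g : R -> R) : Prop :=
  H1_deriv a w g /\ w 0 = 0.

Definition V0 (R : realType) (a : R) (w : R -> R) : Prop :=
  exists g, V0_deriv a w g.

Section MovingDomain.
Variables (R : realType) (ell : R -> R).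
Implicit Types f ft u ux ut psi : R -> R -> R.

(* f in C([0, T]; L^2(0, ell t)) for every T > 0. The spaces at different times
   are compared through extension by zero, inside L^2 of the line. *)
Definition continuous_L2 f : Prop :=
  (forall t : R, 0 <= t -> L2 (ell t) (f^~ t)) /\
  (forall t : R, 0 <= t ->
    L2norm (zero_ext (ell s) (f^~ s) \- zero_ext (ell t) (f^~ t))
      @[s --> within `[0, +oo[ (nbhs t)] --> 0%E).

(* ft is the time derivative of f in L^2(0, ell t): the difference quotient
   between the times t and s is only defined for x < min (ell t) (ell s). *)
Definition time_deriv_L2 f ft : Prop :=
  forall t : R, 0 <= t ->
    L2norm (zero_ext (Num.min (ell t) (ell s))
              (fun x => (f x s - f x t) / (s - t) - ft x t))
      @[s --> within `[0, +oo[ t^'] --> 0%E.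

(* u in C([0, T]; V_0(0, ell t)) for every T > 0, with space derivative ux; the
   H^1 norm is the sum of the L^2 norms of u and ux. *)
Definition continuous_V0 u ux : Prop :=
  [/\ forall t : R, 0 <= t -> V0_deriv (ell t) (u^~ t) (ux^~ t),
      continuous_L2 u & continuous_L2 ux].

(* u in C^1([0, T]; L^2(0, ell t)) for every T > 0, with time derivative ut. *)
Definition C1_L2 u ut : Prop :=
  [/\ continuous_L2 u, time_deriv_L2 u ut & continuous_L2 ut].

(* Test functions: C^1 in (x, t), zero on x = 0, with support in a slab
   0 < a <= t <= b; they are free on the moving boundary x = ell t. *)
Definition test_function psi : Prop :=
  [/\ forall x t : R, derivable (psi^~ t) x 1 /\ derivable (psi x) t 1,
      continuous (fun p : R * R => derive1 (psi^~ p.2) p.1),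
      continuous (fun p : R * R => derive1 (psi p.1) p.2),
      forall t : R, psi 0 t = 0
    & exists a b : R, 0 < a /\
        forall x t : R, t \notin `[a, b] -> psi x t = 0].

(* Weak form of u_tt - u_xx = 0 on 0 < x < ell t, t > 0, together with
   u_x + ell' u_t = 0 on x = ell t. Multiplying the equation by psi and
   integrating by parts over the space-time domain, whose outer normal on
   x = ell t is proportional to (1, - ell') in the coordinates (x, t), leaves the
   boundary term - (u_x + ell' u_t) psi: the moving boundary condition is the
   natural one. *)
Definition weak_wave ux ut : Prop :=
  forall psi, test_function psi ->
    \int[@lebesgue_measure R]_(t in `]0, +oo[)
      (\int[@lebesgue_measure R]_(x in `]0, ell t[)
         (ut x t * derive1 (psi x) t - ux x t * derive1 (psi^~ t) x)) = 0.

(* u, with derivatives ux and ut, is the solution with initial data u0, u1;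
   u 0 t = 0 is part of continuous_V0. *)
Definition is_solution (u0 u1 : R -> R) u ux ut : Prop :=
  [/\ continuous_V0 u ux,
      C1_L2 u ut,
      weak_wave ux ut,
      forall x : R, 0 < x < ell 0 -> u x 0 = u0 x
    & {ae @lebesgue_measure R, forall x : R, 0 < x < ell 0 -> ut x 0 = u1 x}].

Definition energy ux ut (t : R) : R :=
  2^-1 * \int[@lebesgue_measure R]_(x in `]0, ell t[)
           (ut x t ^+ 2 + ux x t ^+ 2).

Definition char_values (dphi : R -> R) (t : R) : set R :=
  [set y | exists2 x : R, 0 <= x <= ell t & y = dphi (t - x) \/ y = dphi (t + x)].

(* For dphi continuous, char_values is compact, so that inf and sup are attained
   and are the minimum and the maximum. *)
Definition min_char dphi t : R := inf (char_values dphi t).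
Definition max_char dphi t : R := sup (char_values dphi t).

End MovingDomain.

Definition nondecreasing_on (R : realType) (a b : R) (f : R -> R) : Prop :=
  {in `[a, b] &, {homo f : x y / x <= y}}.

Definition nonincreasing_on (R : realType) (a b : R) (f : R -> R) : Prop :=
  {in `[a, b] &, {homo f : x y /~ x <= y}}.

Definition monotone_on (R : realType) (a b : R) (f : R -> R) : Prop :=
  nondecreasing_on a b f \/ nonincreasing_on a b f.

(* Main.v *)
(* Write u = f (t + x) - f (t - x). The conjugate function v, with v_x = u_t and
   v_t = u_x, is normalized by v = 0 on x = ell t: this is exactly the boundary
   condition, and it reads f (t + ell t) = - f (t - ell t). The energy at time t
   is the integral of f' ^ 2 over [t - ell t, t + ell t], that is, by a theorem of
   F. Riesz, the supremum of the sums of (f b - f a) ^ 2 / (b - a) over the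
   subdivisions of this interval. The same supremum I t with phi b - phi a in
   place of b - a does not depend on t: since phi (t + ell t) = phi (t - ell t) + 2,
   the map t - ell t |-> t + ell t turns a subdivision of [s - ell s, s' - ell s']
   into one of [s + ell s, s' + ell s'] with the same sum. As phi b - phi a lies
   between m t * (b - a) and M t * (b - a), so does E t between m t * I and
   M t * I. The monotonicity of E comes from the same matching of subdivisions,
   which shrinks or expands the lengths b - a according to the sign of ell'.

   No second derivative of the weak solution is available. Testing the weak form
   with theta t * X x, where X x tends to min x y, gives the time derivative of
   the integral of v over [0, y]; this and the integral of u yield functions of
   class C^1 which are constant along characteristics. *)
Require Import Defs.
From mathcomp Require Import measurable_realfun.
From mathcomp Require Import ring lra.
Set Implicit Arguments.
Unset Strict Implicit.
Unset Printing Implicit Defensive.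
Import Order.TTheory GRing.Theory Num.Theory.
Import numFieldNormedType.Exports.
Local Open Scope classical_set_scope.
Local Open Scope ring_scope.

(** The obstacle is regularity: [u_x] and [u_t] are only curves in L^2, so neither the equation nor
    the boundary condition holds pointwise, and [v + u] and [v - u] are merely continuous. One more
    integration in [x] is just enough: [v + sg * u] is the space derivative of a function [F] with
    [F_t = sg * F_y]. Differentiating [F] along a characteristic only takes these two partial
    derivatives and the joint continuity of [F_y]; differentiating the resulting identity in [y]
    returns to [v + sg * u]. The kernel [min x y] is the Green function of [- d^2/dx^2] that
    vanishes at 0 and is flat at the far end. It vanishes where test functions must vanish, and its
    free value at [x = ell t] carries the moving boundary condition into the proof. Riesz sums are
    used because [f] has no pointwise derivative to substitute in an integral: a change of variable
    becomes a correspondence between finite lists of points, for which two increasing continuous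
    maps suffice. *)

(** * Square-integrable functions *)

Section integrable_real.
Variable R : realType.
Local Notation mu := (@lebesgue_measure R).
Implicit Types (D : set R) (f g : R -> R).

Definition Rintegrable D f := mu.-integrable D (EFin \o f).

Lemma RintegrableD D f g : measurable D -> Rintegrable D f -> Rintegrable D g ->
  Rintegrable D (fun x => f x + g x).
Proof. by move=> mD hf hg; exact: (@integrableD _ _ _ mu _ mD _ _ hf hg). Qed.

Lemma RintegrableB D f g : measurable D -> Rintegrable D f -> Rintegrable D g ->
  Rintegrable D (fun x => f x - g x).
Proof. by move=> mD hf hg; exact: (@integrableB _ _ _ mu _ mD _ _ hf hg). Qed.

Lemma RintegrableZ D (k : R) f : measurable D -> Rintegrable D f ->
  Rintegrable D (fun x => k * f x).
Proof. by move=> mD hf; exact: (@integrableZl _ _ _ mu _ mD k _ hf). Qed.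

Lemma Rintegrable_le D f g : measurable D -> measurable_fun D f ->
  (forall x, D x -> `|f x| <= g x) -> Rintegrable D g -> Rintegrable D f.
Proof.
move=> mD mf fg; apply: le_integrable => //; first exact/measurable_EFinP.
by move=> x Dx; rewrite /= lee_fin (le_trans (fg _ Dx)) ?ler_norm.
Qed.

Lemma Rintegrable_measurable D f : Rintegrable D f -> measurable_fun D f.
Proof. by move=> /integrableP[/measurable_EFinP]. Qed.

Lemma RintegrableS D D' f : measurable D -> measurable D' -> D `<=` D' -> Rintegrable D' f ->
  Rintegrable D f.
Proof. by move=> mD mD' DD; apply: integrableS. Qed.

Lemma Rintegrable_norm D f : Rintegrable D f -> Rintegrable D (fun x => `|f x|).
Proof. by move=> hf; exact: (integrable_abse hf). Qed.

Lemma Rintegrable_indic_itv (c d : R) : Rintegrable setT (\1_`[c, d] : R -> R).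
Proof. exact: integrable_indic_itv. Qed.

Lemma Rint_indic_itv (c d : R) : c <= d ->
  \int[mu]_x (\1_`[c, d] x : R) = d - c.
Proof.
move=> cd; rewrite /Rintegral integral_indic// setIT.
rewrite [X in fine X]lebesgue_measure_itv/= lte_fin.
case: ltP => // dc; rewrite (@le_anti _ _ c d) ?cd ?dc//= subrr//.
Qed.

Lemma RintD D f g : measurable D -> Rintegrable D f -> Rintegrable D g ->
  \int[mu]_(x in D) (f x + g x) = \int[mu]_(x in D) f x + \int[mu]_(x in D) g x.
Proof. by move=> mD hf hg; exact: (@RintegralD _ _ _ mu D f g mD hf hg). Qed.

Lemma RintB D f g : measurable D -> Rintegrable D f -> Rintegrable D g ->
  \int[mu]_(x in D) (f x - g x) = \int[mu]_(x in D) f x - \int[mu]_(x in D) g x.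
Proof. by move=> mD hf hg; exact: (@RintegralB _ _ _ mu D f g mD hf hg). Qed.

Lemma RintZ D (k : R) f : measurable D -> Rintegrable D f ->
  \int[mu]_(x in D) (k * f x) = k * \int[mu]_(x in D) f x.
Proof. by move=> mD hf; exact: (@RintegralZl _ _ _ mu D f k mD hf). Qed.

Lemma Rint_eq D f g : (forall x, D x -> f x = g x) ->
  \int[mu]_(x in D) f x = \int[mu]_(x in D) g x.
Proof. by move=> fg; apply: eq_Rintegral => x; rewrite inE => /fg. Qed.

Lemma Rint_norm_le D f g : measurable D -> measurable_fun D f -> Rintegrable D g ->
  (forall x, D x -> `|f x| <= g x) ->
  `|\int[mu]_(x in D) f x| <= \int[mu]_(x in D) g x.
Proof.
move=> mD mf ig fg; have If := Rintegrable_le mD mf fg ig.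
apply: (@le_trans _ _ (\int[mu]_(x in D) `|f x|)); first exact: le_normr_Rintegral.
by apply: le_Rintegral => //; exact: Rintegrable_norm.
Qed.

End integrable_real.

Section square_integrable.
Variable R : realType.
Local Notation mu := (@lebesgue_measure R).
Implicit Types (D : set R) (f g chi : R -> R).

Definition sqintegrable g := measurable_fun setT g /\ Rintegrable setT (fun x => g x ^+ 2).
Definition sqnorm g : R := \int[mu]_x (g x ^+ 2).

Lemma Lfun2_sqintegrable g : g \in Lfun mu 2%:E -> sqintegrable g.
Proof.
move=> h; split; last exact: Lfun2_integrable_sqr.
by move: h; rewrite inE => /andP[]; rewrite inE.
Qed.

Lemma sqnorm_ge0 g : 0 <= sqnorm g.
Proof. by apply: Rintegral_ge0 => x _; exact: sqr_ge0. Qed.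

Lemma L2norm_sqnorm g : sqintegrable g -> L2norm g = (Num.sqrt (sqnorm g))%:E.
Proof.
move=> [mg ig]; rewrite /L2norm unlock /=.
have E : (\int[mu]_x (`|(g x)%:E| `^ 2) = (sqnorm g)%:E)%E.
  rewrite /sqnorm /Rintegral fineK; last exact: integrable_fin_num ig.
  apply: eq_integral => x _ /=.
  by rewrite powR_mulrn ?normr_ge0// -normrX ger0_norm ?sqr_ge0.
by rewrite E poweR12_sqrt ?lee_fin ?sqnorm_ge0//= .
Qed.

Lemma sqintegrable_comb (a b : R) f g : sqintegrable f -> sqintegrable g ->
  sqintegrable (fun x => a * f x + b * g x).
Proof.
move=> [mf If] [mg Ig].
have m : measurable_fun setT (fun x => a * f x + b * g x).
  by apply: measurable_funD; apply: measurable_funM.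
split => //.
apply: (@Rintegrable_le _ _ _ (fun x => (2 * a ^+ 2) * f x ^+ 2 + (2 * b ^+ 2) * g x ^+ 2)) =>
  //.
- exact: measurable_funX.
- move=> x _; rewrite ger0_norm ?sqr_ge0//.
  have := sqr_ge0 (a * f x - b * g x); lra.
- by apply: RintegrableD => //; apply: RintegrableZ.
Qed.

Lemma eq_sqintegrable f g : f =1 g -> sqintegrable f -> sqintegrable g.
Proof. by move=> /funext ->. Qed.

Lemma sqintegrableB f g : sqintegrable f -> sqintegrable g -> sqintegrable (fun x => f x - g x).
Proof.
move=> sf sg; apply: (eq_sqintegrable _ (sqintegrable_comb 1 (-1) sf sg)) => x; lra.
Qed.

Lemma sqintegrable_restrict D g : measurable D -> sqintegrable g -> sqintegrable (g \_ D).
Proof.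
move=> mD [mg Ig].
have m : measurable_fun setT (g \_ D).
  by apply/(measurable_restrictT _ mD); exact: measurable_funTS.
split => //; apply: (@Rintegrable_le _ _ _ (fun x => g x ^+ 2)) => //.
  exact: measurable_funX.
move=> x _; rewrite ger0_norm ?sqr_ge0// /patch.
by case: ifP => _; rewrite ?lexx// expr0n sqr_ge0.
Qed.

Lemma discriminant_le0 (a b c : R) : (forall s : R, 0 <= a - 2 * s * b + s ^+ 2 * c) ->
  0 <= c -> b ^+ 2 <= a * c.
Proof.
move=> h; rewrite le_eqVlt => /orP[/eqP c0|c0].
  rewrite -c0 mulr0; have [->|b0] := eqVneq b 0; first by rewrite expr0n.
  (* With [c = 0] the polynomial is affine in [s]; this value of [s] would make it equal to -1. In
     the other case [s = b / c] is its minimizer. *)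
  have := h ((a + 1) / (2 * b)); rewrite -c0 mulr0 addr0.
  have -> : 2 * ((a + 1) / (2 * b)) * b = a + 1 by field.
  lra.
have := h (b / c).
have -> : a - 2 * (b / c) * b + (b / c) ^+ 2 * c = (a * c - b ^+ 2) / c.
  by field; rewrite gt_eqF.
by rewrite pmulr_lge0 ?invr_gt0// subr_ge0.
Qed.

(** The boolean stands for the value of an indicator: this dominates [g * chi] by the integrable
    function [g ^+ 2] plus [K ^+ 2] times the indicator of an interval outside which [chi]
    vanishes. *)
Lemma young_indic (a b K : R) (v : bool) : 0 <= a -> 0 <= b -> b <= K * v%:R ->
  a * b <= a ^+ 2 + K ^+ 2 * v%:R.
Proof.
case: v => /= a0 b0 h.
  have : b ^+ 2 <= K ^+ 2 by rewrite lerXn2r ?nnegrE//; lra.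
  have := sqr_ge0 (a - b); nra.
have -> : b = 0 by lra.
by rewrite mulr0 mulr0 addr0 sqr_ge0.
Qed.

Lemma Rintegrable_sqM g chi (K c d : R) : sqintegrable g -> measurable_fun setT chi ->
  (forall x, `|chi x| <= K * \1_`[c, d] x) -> Rintegrable setT (fun x => g x * chi x).
Proof.
move=> [mg Ig] mchi hchi.
apply: (@Rintegrable_le _ _ _ (fun x => g x ^+ 2 + K ^+ 2 * \1_`[c, d] x)) => //.
- exact: measurable_funM.
- move=> x _; rewrite normrM; move: (hchi x); rewrite indicE.
  move=> h; rewrite -(real_normK (num_real (g x))).
  exact: young_indic h.
- by apply: RintegrableD => //; apply: RintegrableZ => //; exact: Rintegrable_indic_itv.
Qed.

(** Discriminant of the nonnegative polynomial given by the integral of [(g - s * chi) ^+ 2], with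
    [chi ^+ 2] replaced by its bound on [[c, d]]. The factor [d - c] is what makes two kernels that
    differ only on a short interval close as functionals. *)
Lemma cauchy_schwarz g chi (K c d : R) : sqintegrable g -> measurable_fun setT chi ->
  c <= d -> 0 <= K -> (forall x, `|chi x| <= K * \1_`[c, d] x) ->
  (\int[mu]_x (g x * chi x)) ^+ 2 <= sqnorm g * (K ^+ 2 * (d - c)).
Proof.
move=> sg mchi cd K0 hchi; have I := Rintegrable_sqM sg mchi hchi.
have [mg Ig] := sg.
have sq1 (x : R) : (\1_`[c, d] x : R) ^+ 2 = \1_`[c, d] x.
  by rewrite indicE; case: (_ \in _); rewrite /= ?expr1n ?expr0n.
apply: discriminant_le0; last by rewrite mulr_ge0 ?sqr_ge0 ?subr_ge0.
move=> s; have Ik : Rintegrable setT (fun x : R => K ^+ 2 * \1_`[c, d] x).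
  by apply: RintegrableZ => //; exact: Rintegrable_indic_itv.
have -> : sqnorm g - 2 * s * (\int[mu]_x (g x * chi x)) + s ^+ 2 * (K ^+ 2 * (d - c)) =
   \int[mu]_x (g x ^+ 2 + (- (2 * s)) * (g x * chi x) + s ^+ 2 * (K ^+ 2 * \1_`[c, d] x)).
  rewrite RintD//; last 2 first.
  - by apply: RintegrableD => //; apply: RintegrableZ.
  - by apply: RintegrableZ.
  rewrite RintD//; last by apply: RintegrableZ.
  rewrite (RintZ _ measurableT I) (RintZ _ measurableT Ik).
  rewrite (RintZ _ measurableT (Rintegrable_indic_itv c d)).
  by rewrite Rint_indic_itv// mulNr.
apply: Rintegral_ge0 => x _.
have : chi x ^+ 2 <= K ^+ 2 * \1_`[c, d] x.
  rewrite -[\1__ x]sq1 -exprMn -(real_normK (num_real (chi x))).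
  by rewrite lerXn2r ?nnegrE ?mulr_ge0//.
have := sqr_ge0 (g x - s * chi x); have := sqr_ge0 s; nra.
Qed.

End square_integrable.

(** * Riesz sums *)

Section riesz_energy.
Variable R : realType.
Implicit Types (a b c S : R) (f phi : R -> R) (p q : nat -> R) (n : nat).

(* Points may be repeated: the corresponding terms of rsum are 0 / 0 = 0. *)
Definition subdiv a b p n :=
  [/\ forall i j, (i <= j)%N -> p i <= p j, p 0%N = a & p n = b].

Definition rsum f phi p n : R :=
  \sum_(i < n) (f (p i.+1) - f (p i)) ^+ 2 / (phi (p i.+1) - phi (p i)).

(** A relation rather than a function, as the supremum of the sums may be infinite for an arbitrary
    [f]. For smooth data, [S] is the integral of [f' ^ 2 / phi']. *)
Definition is_energy f phi a b S :=
  (forall p n, subdiv a b p n -> rsum f phi p n <= S) /\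
  (forall e, 0 < e -> exists p n, subdiv a b p n /\ S - e < rsum f phi p n).

Definition incr_on a b phi :=
  forall x y, a <= x -> x < y -> y <= b -> phi x < phi y.

Lemma incr_onW a b phi : incr_on a b phi ->
  forall x y, a <= x -> x <= y -> y <= b -> phi x <= phi y.
Proof.
move=> h x y ax; rewrite le_eqVlt => /predU1P[->//|xy] yb.
by apply/ltW/h.
Qed.

Lemma incr_onS a b a' b' phi : a <= a' -> b' <= b -> incr_on a b phi -> incr_on a' b' phi.
Proof.
move=> aa bb h x y ax xy yb; apply: h => //; [exact: le_trans ax|exact: le_trans bb].
Qed.

Lemma incr_on_id a b : incr_on a b id. Proof. by []. Qed.

Lemma subdiv_in a b p n i : subdiv a b p n -> (i <= n)%N -> a <= p i <= b.
Proof.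
by move=> [hp <- <-] i_n; rewrite !hp.
Qed.

Lemma energy_uniq f phi a b S T : is_energy f phi a b S -> is_energy f phi a b T -> S = T.
Proof.
have h S' T' : is_energy f phi a b S' -> is_energy f phi a b T' -> S' <= T'.
  move=> [_ h1] [h2 _]; apply/ler_addgt0Pr => e e0.
  have [p [n [sp]]] := h1 _ e0; have := h2 _ _ sp; lra.
by move=> hS hT; apply/le_anti; rewrite !h.
Qed.

Lemma subdiv_trivial a b : a <= b -> subdiv a b (fun i => if i is 0%N then a else b) 1.
Proof. by move=> ab; split => // -[|i] [|j]. Qed.

Lemma energy_exists f phi a b B : a <= b ->
  (forall p n, subdiv a b p n -> rsum f phi p n <= B) ->
  exists2 S, is_energy f phi a b S & S <= B.
Proof.
move=> ab hB.
pose A := [set s | exists p n, subdiv a b p n /\ s = rsum f phi p n].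
have A0 : A !=set0.
  by by do 3 eexists; split; first exact: (subdiv_trivial ab).
have ubA : ubound A B by move=> s [p [n [sp ->]]]; exact: hB.
have sA : has_sup A by split => //; exists B.
exists (sup A); last exact: ge_sup.
split=> [p n sp|e e0].
  by apply: (ub_le_sup (proj2 sA)); exists p, n.
have [s [p [n [sp ->]]] h] := sup_adherent e0 sA.
by exists p, n.
Qed.

(** Convexity and homogeneity of [x ^+ 2 / u] in the pair [(x, u)]. As a consequence, inserting a
    point in a subdivision never decreases a Riesz sum. *)
Lemma convex_sqr_div (x y u v : R) : 0 < u -> 0 < v ->
  (x + y) ^+ 2 / (u + v) <= x ^+ 2 / u + y ^+ 2 / v.
Proof.
move=> u0 v0; rewrite -subr_ge0.
have -> : x ^+ 2 / u + y ^+ 2 / v - (x + y) ^+ 2 / (u + v) =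
  (x * v - y * u) ^+ 2 / (u * v * (u + v)).
  by field; rewrite !gt_eqF ?addr_gt0.
by rewrite divr_ge0 ?sqr_ge0// ltW// !mulr_gt0 ?addr_gt0.
Qed.

(** Clipping all points at [b] by [min] and [max] replaces the insertion of [b]. Both halves keep
    [n] steps, the collapsed steps contribute 0, and only the step straddling [b] calls for
    convexity. *)
Lemma rsum_split f phi a b c p n : a <= b -> b <= c -> incr_on a c phi ->
  subdiv a c p n ->
  [/\ subdiv a b (fun i => Num.min (p i) b) n,
      subdiv b c (fun i => Num.max (p i) b) n &
      rsum f phi p n <= rsum f phi (fun i => Num.min (p i) b) n +
                        rsum f phi (fun i => Num.max (p i) b) n].
Proof.
move=> ab bc hphi sp; have [hp p0 pn] := sp; split.
- split => [i j ij| |]; last 2 first.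
  + by rewrite p0; apply/min_idPl.
  + by rewrite pn; apply/min_idPr.
  by rewrite le_min !ge_min (hp _ _ ij) lexx orbT.
- split => [i j ij| |]; last 2 first.
  + by rewrite p0; apply/max_idPr.
  + by rewrite pn; apply/max_idPl.
  by rewrite ge_max !le_max (hp _ _ ij) lexx orbT.
rewrite /rsum -big_split/=; apply: ler_sum => i _.
have pp : p i <= p i.+1 by apply: hp.
have /andP[pia _] := subdiv_in sp (ltnW (ltn_ord i)).
have /andP[_ pic] := subdiv_in sp (ltn_ord i).
have [bp|pb] := leP b (p i).
  rewrite (min_idPr _)// ?(le_trans bp)// (max_idPl _)// ?(le_trans bp)//.
  by rewrite subrr expr0n mul0r add0r.
have [pb'|bp] := leP (p i.+1) b.
  by rewrite !subrr expr0n mul0r addr0.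
have h1 : 0 < phi b - phi (p i) by rewrite subr_gt0; apply: hphi.
have h2 : 0 < phi (p i.+1) - phi b by rewrite subr_gt0; apply: hphi.
have := convex_sqr_div (f b - f (p i)) (f (p i.+1) - f b) h1 h2.
have E (u v w : R) : u - v + (w - u) = w - v by ring.
by rewrite !E.
Qed.

Lemma rsum_cat f phi a b c p n q m : subdiv a b p n -> subdiv b c q m ->
  exists r k, subdiv a c r k /\ rsum f phi r k = rsum f phi p n + rsum f phi q m.
Proof.
move=> [hp p0 pn] [hq q0 qm].
exists (fun i => if (i <= n)%N then p i else q (i - n)%N), (n + m)%N; split.
  split => //; last first.
    case: ifPn => [|_]; last by rewrite addKn.
    by rewrite -{2}(addn0 n) leq_add2l leqn0 => /eqP m0; rewrite m0 addn0 pn -q0 -qm m0.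
  move=> i j ij; case: ifPn => hi; case: ifPn => hj.
  - exact: hp.
  - by apply: (@le_trans _ _ b); [rewrite -pn hp|rewrite -q0 hq].
  - by rewrite (leq_trans ij hj) in hi.
  - by apply: hq; rewrite leq_sub2r.
rewrite /rsum big_split_ord/=; congr (_ + _); apply: eq_bigr => i _.
  by rewrite (ltn_ord i) (ltnW (ltn_ord i)).
rewrite ltnNge leq_addr/= -addnS !addKn.
suff -> : (if (n + i <= n)%N then p (n + i)%N else q i) = q i by [].
case: ifPn => //; rewrite -{2}(addn0 n) leq_add2l leqn0 => /eqP ->.
by rewrite addn0 pn q0.
Qed.

Lemma energy_cat f phi a b c S T : a <= b -> b <= c -> incr_on a c phi ->
  is_energy f phi a b S -> is_energy f phi b c T -> is_energy f phi a c (S + T).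
Proof.
move=> ab bc hphi [hS1 hS2] [hT1 hT2]; split => [p n sp|e e0].
  have [s1 s2 /le_trans->//] := rsum_split f ab bc hphi sp.
  by rewrite lerD// ?hS1 ?hT1.
have e20 : 0 < e / 2 by rewrite divr_gt0.
have [p [n [sp h1]]] := hS2 _ e20.
have [q [m [sq h2]]] := hT2 _ e20.
have [r [k [sr E]]] := rsum_cat f phi sp sq.
by exists r, k; split => //; rewrite E; lra.
Qed.

Lemma rsum_ge0 f phi a b p n : incr_on a b phi -> subdiv a b p n -> 0 <= rsum f phi p n.
Proof.
move=> hphi sp; apply: sumr_ge0 => i _; rewrite divr_ge0 ?sqr_ge0// subr_ge0.
have /andP[pia _] := subdiv_in sp (ltnW (ltn_ord i)).
have /andP[_ pic] := subdiv_in sp (ltn_ord i).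
by apply: (incr_onW hphi) => //; case: sp => + _ _; apply.
Qed.

(** Each part has a finite supremum because any of its subdivisions is completed by the one-step
    subdivision of the other part, which contributes a nonnegative term. Additivity and uniqueness
    then identify the sum. *)
Lemma energy_split f phi a b c S : a <= b -> b <= c -> incr_on a c phi ->
  is_energy f phi a c S -> exists S1 S2,
  [/\ is_energy f phi a b S1, is_energy f phi b c S2 & S = S1 + S2].
Proof.
move=> ab bc hphi hS.
have [S1 h1 _] : exists2 S1, is_energy f phi a b S1 & S1 <= S.
  apply: energy_exists => // p n sp.
  have [r [k [sr E]]] := rsum_cat f phi sp (subdiv_trivial bc).
  apply: le_trans (proj1 hS _ _ sr); rewrite E lerDl.
  by apply: (@rsum_ge0 _ _ b c); [exact: incr_onS hphi|exact: subdiv_trivial].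
have [S2 h2 _] : exists2 S2, is_energy f phi b c S2 & S2 <= S.
  apply: energy_exists => // p n sp.
  have [r [k [sr E]]] := rsum_cat f phi (subdiv_trivial ab) sp.
  apply: le_trans (proj1 hS _ _ sr); rewrite E lerDr.
  by apply: (@rsum_ge0 _ _ a b); [exact: incr_onS hphi|exact: subdiv_trivial].
exists S1, S2; split => //.
by apply: energy_uniq hS _; apply: (energy_cat ab).
Qed.

(** Translations, reflections and the passage from one side of the boundary to the other all go
    through this matching of subdivisions. *)
Lemma energy_transfer f phi a b f' phi' a' b' S :
  (forall p n, subdiv a b p n -> exists q m, subdiv a' b' q m /\
     rsum f phi p n = rsum f' phi' q m) ->
  (forall q m, subdiv a' b' q m -> exists p n, subdiv a b p n /\
     rsum f phi p n = rsum f' phi' q m) ->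
  is_energy f phi a b S -> is_energy f' phi' a' b' S.
Proof.
move=> h1 h2 [hS1 hS2]; split => [q m /h2[p [n [sp <-]]]|e /hS2[p [n [sp]]]].
  exact: hS1.
by have [q [m [sq ->]]] := h1 _ _ sp; exists q, m.
Qed.

Lemma energy_shift f a b t S : is_energy (fun x => f (t + x)) id a b S ->
  is_energy f id (t + a) (t + b) S.
Proof.
apply: energy_transfer => [p n [hp p0 pn]|q m [hq q0 qm]].
  exists (fun i => t + p i), n; split.
    by split => [i j /hp| |]; rewrite ?lerD2l ?p0 ?pn.
  by apply: eq_bigr => i _; congr (_ / _) => /=; ring.
exists (fun i => q i - t), m; split.
  by split => [i j /hq| |]; rewrite ?lerD2r ?q0 ?qm; [|ring|ring].
apply: eq_bigr => i _; congr (_ / _) => /=; last by ring.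
by rewrite !(addrC t) !subrK.
Qed.

Lemma energy_reflect f a b t S : is_energy (fun x => f (t - x)) id a b S ->
  is_energy f id (t - b) (t - a) S.
Proof.
have rev g p n : rsum (fun x => g (t - x)) id p n = rsum g id (fun i => t - p (n - i)%N) n.
  rewrite /rsum (reindex_inj rev_ord_inj)/=; apply: eq_bigr => i _.
  have -> : (n - i = (n - i.+1).+1)%N by rewrite subnSK.
  rewrite -sqrrN; congr ((_ ^+ 2) / _); ring.
have revs a' b' p n : subdiv a' b' p n -> subdiv (t - b') (t - a') (fun i => t - p (n - i)%N) n.
  move=> [hp p0 pn]; split; rewrite ?subn0 ?subnn ?p0 ?pn// => i j ij.
  by rewrite lerD2l lerN2 hp// leq_sub2l.
apply: energy_transfer => [p n sp|q m sq].
  by exists (fun i => t - p (n - i)%N), n; split; [exact: revs|exact: rev].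
exists (fun i => t - q (m - i)%N), m; split.
  by have := revs _ _ _ _ sq; rewrite !opprB !(addrC t) !subrK.
rewrite rev; apply: eq_bigr => i _.
have -> : (m - (m - i.+1) = i.+1)%N by rewrite subKn.
have -> : (m - (m - i) = i)%N by rewrite subKn// ltnW.
by rewrite !opprB !(addrC t) !subrK.
Qed.

Lemma rsum_phi_le f phi a b (m B : R) p n : 0 < m ->
  (forall x y, a <= x -> x < y -> y <= b -> m * (y - x) <= phi y - phi x) ->
  subdiv a b p n -> rsum f id p n <= B -> rsum f phi p n <= B / m.
Proof.
move=> m0 hphi sp hB; apply: (@le_trans _ _ (rsum f id p n / m)); last first.
  by rewrite ler_pM2r ?invr_gt0.
rewrite /rsum mulr_suml; apply: ler_sum => i _.
have /andP[pia _] := subdiv_in sp (ltnW (ltn_ord i)).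
have /andP[_ pic] := subdiv_in sp (ltn_ord i).
have : p i <= p i.+1 by case: sp => + _ _; apply.
rewrite le_eqVlt => /predU1P[->|pp]; first by rewrite !subrr expr0n !mul0r.
have dm := hphi _ _ pia pp pic.
have d0 : 0 < p i.+1 - p i by rewrite subr_gt0.
rewrite -mulrA -invfM; apply: ler_wpM2l; first exact: sqr_ge0.
rewrite lef_pV2 ?posrE 1?mulrC//; first by apply: lt_le_trans dm; rewrite mulr_gt0.
by rewrite mulr_gt0.
Qed.

Lemma energy_compare f phi a b S T (m M : R) : 0 < m -> 0 < M ->
  (forall x y, a <= x -> x < y -> y <= b ->
     m * (y - x) <= phi y - phi x <= M * (y - x)) ->
  is_energy f id a b S -> is_energy f phi a b T -> m * T <= S <= M * T.
Proof.
move=> m0 M0 hphi hS hT.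
have cmp p n (i : 'I_n) : subdiv a b p n -> p i = p i.+1 \/
    [/\ 0 < p i.+1 - p i, m * (p i.+1 - p i) <= phi (p i.+1) - phi (p i) &
        phi (p i.+1) - phi (p i) <= M * (p i.+1 - p i)].
  move=> sp; have /andP[pia _] := subdiv_in sp (ltnW (ltn_ord i)).
  have /andP[_ pic] := subdiv_in sp (ltn_ord i).
  have : p i <= p i.+1 by case: sp => + _ _; apply.
  rewrite le_eqVlt => /predU1P[|pp]; [by left|right].
  by have /andP[] := hphi _ _ pia pp pic; rewrite subr_gt0.
apply/andP; split.
- rewrite mulrC -ler_pdivlMr//; apply/ler_addgt0Pr => e e0.
  have [p [n [sp h]]] := proj2 hT _ e0.
  have := rsum_phi_le m0 _ sp (proj1 hS _ _ sp).
  suff : forall x y, a <= x -> x < y -> y <= b -> m * (y - x) <= phi y - phi x.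
    by move=> hm /(_ phi hm); lra.
  by move=> x y ax xy yb; have /andP[] := hphi x y ax xy yb.
- apply/ler_addgt0Pr => e e0.
  have [p [n [sp h]]] := proj2 hS _ e0.
  suff : rsum f id p n <= M * T by lra.
  apply: (@le_trans _ _ (M * rsum f phi p n)); last first.
    by rewrite ler_pM2l//; apply: (proj1 hT).
  rewrite /rsum mulr_sumr; apply: ler_sum => i _.
  have [->|[d0 dm dM]] := cmp p n i sp; first by rewrite !subrr expr0n !mul0r mulr0.
  have dp : 0 < phi (p i.+1) - phi (p i) by apply: lt_le_trans dm; rewrite mulr_gt0.
  rewrite mulrCA; apply: ler_wpM2l; first exact: sqr_ge0.
  by rewrite ler_pdivlMr// mulrC ler_pdivrMr.
Qed.

End riesz_energy.

(** * Riesz's theorem for primitives of square-integrable functions *)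

Section primitive.
Variable R : realType.
Local Notation mu := (@lebesgue_measure R).
Implicit Types (f g : R -> R).

(** The indicator under an integral over the line makes this a pairing of [g] with a bounded kernel,
    defined for every [y] and equal to 0 for [y <= 0]. *)
Definition prim g (y : R) : R := \int[mu]_x (g x * \1_`[0, y] x).

Lemma Rintegrable_indicM g (A : set R) : measurable A -> Rintegrable setT g ->
  Rintegrable setT (fun x => g x * \1_A x).
Proof.
move=> mA Ig; apply: Rintegrable_le (Rintegrable_norm Ig) => //.
  by apply: measurable_funM; [exact: Rintegrable_measurable|exact: measurable_indic].
by move=> x _; rewrite normrM indicE; case: (_ \in _); rewrite ?normr1 ?mulr1// normr0 mulr0.
Qed.

Lemma primE g y : prim g y = \int[mu]_(x in `[0, y]) g x.
Proof.
rewrite /prim [RHS]Rintegral_mkcond; apply: Rint_eq => x _.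
by rewrite indicE patchE; case: (_ \in _); rewrite ?mulr1 ?mulr0.
Qed.

Lemma indic_oc (x y z : R) : 0 <= x -> x <= y ->
  \1_`[0, y] z - \1_`[0, x] z = \1_`]x, y] z :> R.
Proof.
move=> x0 xy; rewrite !indicE !mem_setE !in_itv/=.
have [z0|z0] := leP 0 z; last first.
  by rewrite /= subrr; case: (ltP x z) => //= xz; have := lt_trans (le_lt_trans x0 xz) z0;
    rewrite ltxx.
case: (leP z x) => [zx|xz] /=; last by rewrite subr0.
by rewrite (le_trans zx xy) subrr.
Qed.

Lemma primB g x y : Rintegrable setT g -> 0 <= x -> x <= y ->
  prim g y - prim g x = \int[mu]_z (g z * \1_`]x, y] z).
Proof.
move=> Ig x0 xy; rewrite -RintB//; [|exact: Rintegrable_indicM..].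
by apply: Rint_eq => z _; rewrite -mulrBr indic_oc.
Qed.

Lemma prim_cauchy_schwarz g x y : sqintegrable g -> Rintegrable setT g -> 0 <= x -> x <= y ->
  (prim g y - prim g x) ^+ 2 <= (prim (fun z => g z ^+ 2) y - prim (fun z => g z ^+ 2) x) * (y
    - x).
Proof.
move=> sg Ig x0 xy; rewrite !primB//; last by case: sg.
(* Cutting [g] to []x, y]] does not change the pairing, and turns the norm in the Cauchy-Schwarz
   inequality into the local one. *)
pose g' := g \_ `]x, y].
have -> : \int[mu]_z (g z * \1_`]x, y] z) = \int[mu]_z (g' z * \1_`]x, y] z).
  apply: Rint_eq => z _; rewrite /g' patchE indicE.
  by case: (_ \in _); rewrite ?mulr0.
have -> : \int[mu]_z (g z ^+ 2 * \1_`]x, y] z) = sqnorm g'.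
  apply: Rint_eq => z _; rewrite /g' patchE indicE.
  by case: (_ \in _); rewrite ?mulr1// mulr0 expr0n.
apply: le_trans (@cauchy_schwarz _ _ _ 1 x y _ _ xy _ _) _ => //.
- exact: sqintegrable_restrict.
- move=> z; rewrite mul1r !indicE !mem_setE !in_itv/=.
  case: (ltP x z) => //= [xz|_]; last by rewrite normr0.
  by rewrite (ltW xz)/=; case: (z <= y); rewrite ?normr1 ?normr0.
- by rewrite expr1n mul1r.
Qed.

Lemma rsum_prim_le g l p n : sqintegrable g -> Rintegrable setT g -> subdiv 0 l p n ->
  rsum (prim g) id p n <= prim (fun z => g z ^+ 2) l.
Proof.
move=> sg Ig sp; have [hp p0 pn] := sp.
have -> : prim (fun z => g z ^+ 2) l = prim (fun z => g z ^+ 2) (p n) - prim (fun z => g z ^+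
  2) (p 0%N).
  by rewrite pn p0 [prim _ 0]primE set_itv1 Rintegral_set1 subr0.
rewrite -(telescope_sumr (fun i => prim (fun z => g z ^+ 2) (p i)))// big_mkord.
apply: ler_sum => i _.
have /andP[pia _] := subdiv_in sp (ltnW (ltn_ord i)).
have := hp _ _ (leqnSn i); rewrite le_eqVlt => /predU1P[->|pp].
  by rewrite !subrr expr0n mul0r.
by rewrite ler_pdivrMr ?subr_gt0// prim_cauchy_schwarz// ltW.
Qed.

Lemma derivable_estimate (F : R -> R) (x d : R) : derivable F x 1 -> derive1 F x = d ->
  forall e, 0 < e -> exists2 r, 0 < r &
    forall y, `|y - x| < r -> `|F y - F x - d * (y - x)| <= e * `|y - x|.
Proof.
move=> dF dFd e e0.
have : h^-1 *: ((F \o shift x) (h *: 1) - F x) @[h --> 0^'] --> d.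
  by rewrite -dFd derive1E.
move=> /cvgrPdist_le/(_ _ e0)/nbhs_ballP[r /= r0 hr].
exists r => // y yr; have [->|xy] := eqVneq y x;
  first by rewrite !subrr mulr0 subr0 normr0 mulr0.
have yx0 : y - x != 0 by rewrite subr_eq0.
have := hr (y - x); rewrite /ball/= sub0r normrN => /(_ yr yx0).
rewrite /shift/= -[_ *: 1]/(_ * 1) mulr1 subrK => h.
have -> : F y - F x - d * (y - x) = - ((d - (y - x)^-1 *: (F y - F x)) * (y - x)).
  by rewrite /GRing.scale/=; field.
by rewrite normrN normrM ler_wpM2r.
Qed.

(** The mesh cell containing [x] need not have [x] as an end point. The errors at its two ends are
    at most [e * (x - a)] and [e * (b - x)], which add up to [e * (b - a)]. *)
Lemma straddle (F : R -> R) (x d : R) : derivable F x 1 -> derive1 F x = d ->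
  forall e, 0 < e -> exists2 r, 0 < r & forall a b, a < x -> x <= b -> b - a < r ->
    `|(F b - F a) / (b - a) - d| <= e.
Proof.
move=> dF dFd e e0; have [r r0 hr] := derivable_estimate dF dFd e0.
exists r => // a b ax xb bar.
have ba0 : 0 < b - a by lra.
have ha : `|F a - F x - d * (a - x)| <= e * (x - a).
  rewrite (le_trans (hr a _))// ler0_norm; lra.
have hb : `|F b - F x - d * (b - x)| <= e * (b - x).
  rewrite (le_trans (hr b _))// ger0_norm; lra.
have -> : (F b - F a) / (b - a) - d = (F b - F x - d * (b - x) - (F a - F x - d * (a - x))) /
  (b - a).
  by field; rewrite gt_eqF.
rewrite normrM normfV (gtr0_norm ba0) ler_pdivrMr//.
apply: le_trans (ler_normB _ _) _; lra.
Qed.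

Definition mesh (l : R) n (i : nat) : R := l * (i%:R / n.+1%:R).

Lemma mesh_subdiv l n : 0 <= l -> subdiv 0 l (mesh l n) n.+1.
Proof.
move=> l0; split; rewrite /mesh ?mul0r ?mulr0//.
- by move=> i j ij; rewrite ler_wpM2l// ler_pM2r ?invr_gt0 ?ltr0n// ler_nat.
- by rewrite divff ?mulr1// pnatr_eq0.
Qed.

Lemma meshS l n i : mesh l n i.+1 - mesh l n i = l / n.+1%:R.
Proof. by rewrite /mesh -mulrBr -mulrBl -natrB// subSnn mul1r. Qed.

Lemma mesh_index l n x : 0 < x -> x <= l ->
  exists i : 'I_n.+1, mesh l n i < x <= mesh l n i.+1.
Proof.
move=> x0 xl; have l0 : 0 <= l by apply: ltW (lt_le_trans x0 xl).
have [_ m0 mn] := mesh_subdiv n l0.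
have ex : exists k, x <= mesh l n k by exists n.+1; rewrite mn.
case: (ex_minnP ex) => -[|k] hk kmin; first by move: hk; rewrite m0 leNgt x0.
have kn : (k < n.+1)%N by apply: kmin; rewrite mn.
exists (Ordinal kn); rewrite /= hk andbT ltNge; apply/negP => /kmin.
by rewrite ltnn.
Qed.

Lemma sum_mesh_cells l n x (i : 'I_n.+1) (c : nat -> R) : 0 <= l ->
  mesh l n i < x <= mesh l n i.+1 ->
  \sum_(j < n.+1) c j * \1_`]mesh l n j, mesh l n j.+1] x = c i.
Proof.
move=> l0 /andP[ix xi]; have [hm _ _] := mesh_subdiv n l0.
rewrite (bigD1 i)//= big1 ?addr0.
  by rewrite indicE mem_setE in_itv/= ix xi mulr1.
move=> j ji; rewrite indicE mem_setE in_itv/=.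
have [/hm jx|] := ltnP j i.
  by rewrite [x <= _]leNgt (le_lt_trans jx ix) andbF mulr0.
rewrite leq_eqVlt => /predU1P[ij|/hm jx]; first by move: ji; rewrite -val_eqE/= ij eqxx.
by rewrite ltNge (le_trans xi jx) mulr0.
Qed.

Lemma subitv_oc (a b c d : R) : a <= b -> c <= d ->
  [set` `]b, c]] `&` [set` `]a, d]] = [set` `]b, c]].
Proof.
move=> ab cd; apply/setIidPl => z /=; rewrite !in_itv/= => /andP[z1 z2].
by rewrite (le_lt_trans ab z1) (le_trans z2 cd).
Qed.

(** The upper bound is the Cauchy-Schwarz inequality on each step. If all sums stayed below it by
    [e], consider the step functions [h n] made of the squared slopes on uniform meshes: they
    converge to [g ^+ 2] almost everywhere by Lebesgue's differentiation theorem, and Fatou's lemma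
    would bound the integral of [g ^+ 2] by itself minus [e]. *)
Lemma energy_prim g (l : R) : sqintegrable g -> Rintegrable setT g -> 0 < l ->
  is_energy (prim g) id 0 l (prim (fun z => g z ^+ 2) l).
Proof.
move=> sg Ig l0; split => [p n|e e0]; first exact: rsum_prim_le.
apply: contrapT => nex.
have small n : rsum (prim g) id (mesh l n) n.+1 <= prim (fun z => g z ^+ 2) l - e.
  rewrite leNgt; apply/negP => h; apply: nex; exists (mesh l n), n.+1; split => //.
  exact/mesh_subdiv/ltW.
pose c n i := (prim g (mesh l n i.+1) - prim g (mesh l n i)) / (mesh l n i.+1 - mesh l n i).
pose h n (x : R) := \sum_(i < n.+1) c n i ^+ 2 * \1_`]mesh l n i, mesh l n i.+1] x.
have h0 n x : 0 <= h n x.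
  by apply: sumr_ge0 => i _; rewrite mulr_ge0 ?sqr_ge0// indicE ler0n.
have mh n : measurable_fun setT (h n).
  apply: measurable_sum => i; apply: measurable_funM => //; exact: measurable_indic.
have inth n : (\int[mu]_(x in `]0%R, l]) (h n x)%:E = (rsum (prim g) id (mesh l n) n.+1)%:E)%E.
  under eq_integral do rewrite -sumEFin.
  rewrite ge0_integral_sum//; last 2 first.
  - by move=> i; apply/measurable_EFinP/measurable_funTS; apply: measurable_funM.
  - by move=> i x _; rewrite lee_fin mulr_ge0 ?sqr_ge0// indicE ler0n.
  rewrite /rsum -sumEFin; apply: eq_bigr => i _.
  under eq_integral do rewrite EFinM.
  rewrite ge0_integralZl_EFin//; last 2 first.
  - exact/measurable_EFinP/measurable_indic.
  - exact: sqr_ge0.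
  have [hm m0 mn] := mesh_subdiv n (ltW l0).
  have mi0 : 0 <= mesh l n i by rewrite -m0 hm.
  have mil : mesh l n i.+1 <= l by rewrite -[leRHS]mn hm.
  have cell := subitv_oc mi0 mil.
  have d0 : 0 < mesh l n i.+1 - mesh l n i by rewrite meshS divr_gt0.
  rewrite integral_indic//.
  transitivity ((c n i ^+ 2)%:E * mu [set` `]mesh l n i, mesh l n i.+1]])%E.
    by congr (_ * mu _)%E.
  rewrite [X in (_ * X)%E]lebesgue_measure_itv/= lte_fin -subr_gt0 d0.
  rewrite -EFinD -EFinM; congr EFin; rewrite /c.
  by field; rewrite gt_eqF.
have limh : {ae mu, forall x, x \in `]0, l] -> h n x @[n --> \oo] --> g x ^+ 2}.
  have loc : locally_integrable [set: R] g.
    by have := integrable_locally measurableT Ig; rewrite patch_setT.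
  have IgY y : mu.-integrable [set` Interval (BLeft 0) (BRight y)] (EFin \o g).
    exact: (RintegrableS _ _ (@subsetT _ _) Ig).
  have := FTC1 IgY loc; apply: filterS; first exact: (ae_filter_ringOfSetsType mu).
  move=> x hx.
  rewrite in_itv/= => /andP[x0 xl].
  have [] : _ /\ _ := hx x0.
  rewrite (_ : (fun y => _) = prim g); last by apply/funext => y; rewrite primE.
  move=> dF dFx.
  have /choice[k hk] : forall n, exists i : nat,
    (i < n.+1)%N /\ mesh l n i < x <= mesh l n i.+1.
    by move=> n; have [i hi] := mesh_index n x0 xl; exists i.
  have -> : h ^~ x = fun n => c n (k n) ^+ 2.
    apply/funext => n; have [kn kx] := hk n.
    exact: (@sum_mesh_cells l n x (Ordinal kn) (fun i => c n i ^+ 2) (ltW l0)).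
  have ck : c n (k n) @[n --> \oo] --> g x.
    apply/cvgrPdist_le => r r0; have [d d0 hd] := straddle dF dFx r0.
    have dl : 0 < d / l by rewrite divr_gt0.
    near=> n; rewrite distrC; have [kn /andP[k1 k2]] := hk n.
    apply: hd => //; rewrite meshS -ltr_pdivlMl// mulrC.
    by near: n; exact: (near_infty_natSinv_lt (PosNum dl)).
  rewrite expr2; under eq_fun do rewrite expr2.
  exact: cvgM.
have mD : measurable (`]0, l] : set R) by [].
have : (\int[mu]_(x in `]0%R, l]) limn_einf (fun n => (h n x)%:E) <=
            limn_einf (fun n => \int[mu]_(x in `]0%R, l]) (h n x)%:E))%E.
  apply: fatou => //.
  - by move=> n; apply/measurable_EFinP/measurable_funTS; exact: mh.
  - by move=> n x _; rewrite lee_fin.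
apply/negP; rewrite -ltNge.
apply: (@le_lt_trans _ _ (prim (fun z => g z ^+ 2) l - e)%:E).
  rewrite limn_einf_lim; apply: lime_le; first exact: is_cvg_einfs.
  apply: nearW => n; apply: (@le_trans _ _ (\int[mu]_(x in `]0%R, l]) (h n x)%:E)%E).
    by apply: ereal_inf_lbound; exists n => /=.
  by rewrite inth lee_fin.
apply: (@lt_le_trans _ _ (\int[mu]_(x in `]0%R, l]) (g x ^+ 2)%:E)%E).
  have Ig2 : Rintegrable `]0, l] (fun x => g x ^+ 2) by apply: RintegrableS (proj2 sg).
  rewrite primE -Rintegral_itv_obnd_cbnd// -[ltRHS]fineK; last exact: integrable_fin_num Ig2.
  by rewrite lte_fin ltrBlDr ltrDl.
apply: ae_ge0_le_integral => //.
- by move=> x _; rewrite lee_fin sqr_ge0.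
- by apply: measurable_funTS; case: sg => _ /integrableP[].
- move=> x _; rewrite limn_einf_lim; apply: lime_ge; first exact: is_cvg_einfs.
  by apply: nearW => n; apply: le_ereal_inf_tmp => _ [k _ <-]; rewrite lee_fin.
- rewrite /limn_einf; apply: measurableT_comp => //; apply: measurable_fun_limn_esup => n.
  by apply: measurableT_comp => //; apply/measurable_EFinP/measurable_funTS; exact: mh.
- apply: filterS limh; first exact: (ae_filter_ringOfSetsType mu).
  move=> x hx Dx.
  have := hx; rewrite inE => /(_ Dx) cx.
  have cE : (h n x)%:E @[n --> \oo] --> (g x ^+ 2)%:E.
    by apply: cvg_EFin cx; apply: nearW.
  by have [->] := cvg_limn_einf_sup cE.
Unshelve. all: by end_near. Qed.

End primitive.

(** * Difference quotients and smooth steps *)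

Section derivative_estimates.
Variable R : realType.
Implicit Types (F G : R -> R) (x y d e : R).

(** A first-order estimate without quotient: [y = x] is no exception, and errors are added and
    compared by linear arithmetic. *)
Definition deriv_at F x d := forall e, 0 < e -> exists2 r, 0 < r &
  forall y, `|y - x| < r -> `|F y - F x - d * (y - x)| <= e * `|y - x|.

Lemma deriv_at_is_derive F x d : deriv_at F x d -> is_derive x 1 F d.
Proof.
move=> h.
have cF : h^-1 *: ((F \o shift x) (h *: 1) - F x) @[h --> 0^'] --> d.
  apply/cvgrPdist_le => e e0; have [r r0 hr] := h _ e0.
  apply/nbhs_ballP; exists r => // y; rewrite /ball/= sub0r normrN => yr y0.
  have := hr (y + x); rewrite addrK => /(_ yr).
  rewrite -[_ *: 1]/(_ * 1) mulr1 => h1.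
  have -> : d - y^-1 *: (F (y + x) - F x) = - (F (y + x) - F x - d * y) / y.
    by rewrite /GRing.scale/=; field.
  by rewrite normrM normrN normfV ler_pdivrMr ?normr_gt0.
by apply: DeriveDef; [apply/cvg_ex; exists d|exact/cvg_lim].
Qed.

Lemma deriv_at_quadratic F x d C : 0 <= C ->
  (forall y, `|F y - F x - d * (y - x)| <= C * (y - x) ^+ 2) -> deriv_at F x d.
Proof.
move=> C0 h e e0; exists (e / (C + 1)) => [|y hy].
  by rewrite divr_gt0//; lra.
apply: le_trans (h y) _; rewrite -(real_normK (num_real (y - x))) expr2 mulrA.
rewrite ler_wpM2r//; move: hy; rewrite ltr_pdivlMr; last by lra.
have := normr_ge0 (y - x); nra.
Qed.

Lemma deriv_at_comb F G x d d' (a b : R) : deriv_at F x d -> deriv_at G x d' ->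
  deriv_at (fun y => a * F y + b * G y) x (a * d + b * d').
Proof.
move=> hF hG e e0.
pose c := `|a| + `|b| + 1.
have c0 : 0 < c by rewrite /c ltr_wpDl.
have [r r0 hr] := hF _ (divr_gt0 e0 c0); have [s s0 hs] := hG _ (divr_gt0 e0 c0).
exists (Num.min r s) => [|y]; first by rewrite lt_min r0 s0.
rewrite lt_min => /andP[/hr h1 /hs h2].
have -> : a * F y + b * G y - (a * F x + b * G x) - (a * d + b * d') * (y - x) =
  a * (F y - F x - d * (y - x)) + b * (G y - G x - d' * (y - x)) by ring.
apply: le_trans (ler_normD _ _) _; rewrite !normrM.
apply: (@le_trans _ _ ((`|a| + `|b|) * (e / c * `|y - x|))).
  by rewrite mulrDl lerD// ler_wpM2l.
rewrite mulrA ler_wpM2r// mulrCA -[leRHS]mulr1 ler_pM2l// ler_pdivrMr// mul1r.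
by rewrite /c lerDl.
Qed.

Lemma deriv_at_continuous F x d : deriv_at F x d -> {for x, continuous F}.
Proof.
move=> /deriv_at_is_derive[dF _].
by apply/differentiable_continuous/derivable1_diffP.
Qed.

Lemma deriv_at_uniq F x d d' : deriv_at F x d -> deriv_at F x d' -> d = d'.
Proof. by move=> /deriv_at_is_derive[_ <-] /deriv_at_is_derive[_ <-]. Qed.

Lemma deriv_at_near F G x d : (\forall y \near x, F y = G y) -> deriv_at F x d ->
  deriv_at G x d.
Proof.
move=> /[dup] /nbhs_singleton Ex /nbhs_ballP[s /= s0 hs] hF e e0.
have [r r0 hr] := hF _ e0; exists (Num.min r s) => [|y]; first by rewrite lt_min r0 s0.
rewrite lt_min => /andP[h1 h2]; rewrite -Ex -(hs y); first exact: hr.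
by rewrite /ball/= distrC.
Qed.

Lemma deriv_at0_cst F (a b : R) : a <= b -> {within `[a, b], continuous F} ->
  (forall x, a < x -> x < b -> deriv_at F x 0) -> F a = F b.
Proof.
move=> ab cF dF; have [|c _] := @MVT_segment _ F (fun=> 0) a b ab _ cF.
  by move=> x; rewrite in_itv/= => /andP[h1 h2]; apply/deriv_at_is_derive/dF.
by rewrite mul0r => /eqP; rewrite subr_eq0 => /eqP.
Qed.

End derivative_estimates.

Section smoothstep.
Variable R : realType.
Local Notation mu := (@lebesgue_measure R).
Implicit Types (a b c s t eps : R).

Definition pospart s : R := Num.max s 0.
Definition sqpos s : R := pospart s ^+ 2.
Local Notation m := pospart.
Local Notation q := sqpos.

(** The derivative [2 * pospart] is Lipschitz. The steps and ramps below are combinations of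
    translates of this function, and inherit a quadratic error from it. *)
Lemma sqpos_estimate x y : `|q y - q x - 2 * m x * (y - x)| <= (y - x) ^+ 2.
Proof.
rewrite ler_norml /sqpos /pospart.
have := sqr_ge0 (y - x); have := sqr_ge0 x; have := sqr_ge0 y.
case: (leP x 0) => x0; case: (leP y 0) => y0 h1 h2 h3; apply/andP; split; nra.
Qed.

(* A C^1 function rising from 0 at s = 0 to 1 at s = 1, with derivative tent. *)
Definition smoothstep s : R := 2 * q s - 4 * q (s - 2^-1) + 2 * q (s - 1).
Definition tent s : R := 4 * m s - 8 * m (s - 2^-1) + 4 * m (s - 1).

Let smoothstep_estimate x y :
  `|smoothstep y - smoothstep x - tent x * (y - x)| <= 8 * (y - x) ^+ 2.
Proof.
have h1 := sqpos_estimate x y; have h2 := sqpos_estimate (x - 2^-1) (y - 2^-1).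
have h3 := sqpos_estimate (x - 1) (y - 1); move: h1 h2 h3.
have -> (c : R) : y - c - (x - c) = y - x by ring.
have -> (c : R) : y - c - (x - c) = y - x by ring.
rewrite !ler_norml /smoothstep /tent => /andP[a1 b1] /andP[a2 b2] /andP[a3 b3].
by apply/andP; split; nra.
Qed.

Lemma smoothstep_le0 s : s <= 0 -> smoothstep s = 0.
Proof.
move=> s0; rewrite /smoothstep /sqpos /pospart !max_r; [by rewrite expr0n; ring|lra..].
Qed.

Lemma smoothstep_ge1 s : 1 <= s -> smoothstep s = 1.
Proof.
move=> s0; rewrite /smoothstep /sqpos /pospart !max_l; [by field|lra..].
Qed.

Lemma smoothstep_bound s : 0 <= smoothstep s <= 1.
Proof.
rewrite /smoothstep /sqpos /pospart.
case: (leP s 0) => h1; case: (leP (s - 2^-1) 0) => h2; case: (leP (s - 1) 0) => h3; apply/andP;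
  split; nra.
Qed.

Lemma tent_ge0 s : 0 <= tent s.
Proof.
rewrite /tent /pospart.
case: (leP s 0) => h1; case: (leP (s - 2^-1) 0) => h2; case: (leP (s - 1) 0) => h3; lra.
Qed.

Lemma tent_eq0 s : ~~ (0 < s < 1) -> tent s = 0.
Proof.
rewrite negb_and -!leNgt /tent /m => /orP h.
case: (leP s 0) h => h1 h; case: (leP (s - 2^-1) 0) => h2; case: (leP (s - 1) 0) => h3;
 by case: h => h; lra.
Qed.

Lemma pospart_continuous : continuous m.
Proof.
by move=> s; apply: (@continuous_max _ _ id (cst 0)); [exact: cvg_id|exact: cst_continuous].
Qed.

Lemma pospartB_continuous c : continuous (fun s => m (s - c)).
Proof.
move=> s; apply: (@continuous_comp _ _ _ (fun s => s - c) m); last exact: pospart_continuous.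
by apply: cvgB; [exact: cvg_id|exact: cvg_cst].
Qed.

Lemma tent_continuous : continuous tent.
Proof.
have zc (f : R -> R) (k : R) : continuous f -> continuous (fun s => k * f s).
  by move=> cf s; apply: cvgM; [exact: cvg_cst|exact: cf].
move=> s; rewrite /tent; apply: cvgD; last exact: (zc _ 4 (@pospartB_continuous 1) s).
by apply: cvgB; [exact: (zc _ 4 pospart_continuous s)|exact: (zc _ 8 (@pospartB_continuous
  2^-1) s)].
Qed.

Definition step a eps t := smoothstep ((t - a) / eps).
(** A bump of integral 1 supported in [[a, a + eps]]: for small [eps], a one-sided approximation of
    the Dirac mass at [a]. *)
Definition dstep a eps t := tent ((t - a) / eps) / eps.

Lemma step_deriv a eps t : 0 < eps -> deriv_at (step a eps) t (dstep a eps t).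
Proof.
move=> e0; apply: (@deriv_at_quadratic _ _ _ _ (8 / eps ^+ 2)).
  by rewrite divr_ge0// sqr_ge0.
move=> y; have := smoothstep_estimate ((t - a) / eps) ((y - a) / eps).
have -> : (y - a) / eps - (t - a) / eps = (y - t) / eps by rewrite -mulrBl; congr (_ / _); ring.
rewrite /step /dstep expr_div_n mulrA => h.
by rewrite mulrAC [_ / _ * (y - t) ^+ 2]mulrAC -[_ * _ / eps ^+ 2]mulrA.
Qed.

Lemma dstep_continuous a eps : continuous (dstep a eps).
Proof.
move=> t; apply: cvgM; last exact: cvg_cst.
apply: (@continuous_comp _ _ _ (fun t => (t - a) / eps) tent); last exact: tent_continuous.
apply: cvgM; last exact: cvg_cst.
by apply: cvgB; [exact: cvg_id|exact: cvg_cst].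
Qed.

Lemma step_le a eps t : 0 < eps -> t <= a -> step a eps t = 0.
Proof. by move=> e0 ta; rewrite /step smoothstep_le0// pmulr_lle0 ?invr_gt0// subr_le0. Qed.

Lemma step_ge a eps t : 0 < eps -> a + eps <= t -> step a eps t = 1.
Proof. by move=> e0 ta; rewrite /step smoothstep_ge1// ler_pdivlMr// mul1r; lra. Qed.

Lemma step_bound a eps t : 0 <= step a eps t <= 1.
Proof. exact: smoothstep_bound. Qed.

Lemma dstep_ge0 a eps t : 0 < eps -> 0 <= dstep a eps t.
Proof. by move=> e0; rewrite divr_ge0 ?tent_ge0// ltW. Qed.

Lemma dstep_eq0 a eps t : 0 < eps -> ~~ (a < t < a + eps) -> dstep a eps t = 0.
Proof.
move=> e0 h; rewrite /dstep tent_eq0 ?mul0r//.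
rewrite pmulr_lgt0 ?invr_gt0// subr_gt0 ltr_pdivrMr// mul1r.
by rewrite ltrBlDl.
Qed.

Lemma step_continuous a eps : 0 < eps -> continuous (step a eps).
Proof. by move=> e0 t; apply: deriv_at_continuous; exact: step_deriv. Qed.

End smoothstep.

(** * The lemma of du Bois-Reymond *)

Section du_bois_reymond.
Variable R : realType.
Local Notation mu := (@lebesgue_measure R).
Implicit Types (a b c s t eps : R) (f g w : R -> R).

Lemma continuous_at_within f a c : (forall x, a <= x <= c -> {for x, continuous f}) ->
  {within `[a, c], continuous f}.
Proof.
by move=> h; apply: continuous_in_subspaceT => x; rewrite inE/= in_itv/= => /h.
Qed.

Lemma continuous_Rintegrable f a c : (forall x, a <= x <= c -> {for x, continuous f}) ->
  Rintegrable `[a, c] f.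
Proof.
move=> h; apply: continuous_compact_integrable; first exact: segment_compact.
exact: continuous_at_within.
Qed.

Lemma Rint_deriv F f a c : a < c -> (forall x, a <= x <= c -> deriv_at F x (f x)) ->
  (forall x, a <= x <= c -> {for x, continuous f}) ->
  \int[mu]_(x in `[a, c]) f x = F c - F a.
Proof.
move=> ac dF cf; have cF x : a <= x <= c -> {for x, continuous F}.
  by move=> /dF /deriv_at_continuous.
rewrite /Rintegral (@continuous_FTC2 _ f F a c)//; first exact: continuous_at_within.
- split.
  + by move=> x; rewrite in_itv/= => /andP[x1 x2];
      have [] := deriv_at_is_derive (dF x _) => //; rewrite !ltW.
  + by apply/cvg_at_right_filter/cF; rewrite lexx ltW.
  + by apply/cvg_at_left_filter/cF; rewrite lexx ltW.
- move=> x; rewrite in_itv/= => /andP[x1 x2]; rewrite derive1E.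
  by have [] := deriv_at_is_derive (dF x _) => //; rewrite !ltW.
Qed.

Lemma Rint_dstep a c s eps : 0 < eps -> a <= s -> s + eps <= c ->
  \int[mu]_(x in `[a, c]) dstep s eps x = 1.
Proof.
move=> e0 as_ sc; rewrite (@Rint_deriv (step s eps)).
- by rewrite step_ge// step_le// subr0.
- by lra.
- by move=> x _; exact: step_deriv.
- by move=> x _; exact: dstep_continuous.
Qed.

Definition eps_seq (d : R) (n : nat) : R := d / n.+1%:R.

Lemma eps_seq_gt0 d n : 0 < d -> 0 < eps_seq d n.
Proof. by move=> d0; rewrite divr_gt0. Qed.

Lemma eps_seq_le d n : 0 < d -> eps_seq d n <= d.
Proof. by move=> d0; rewrite ler_pdivrMr// ler_peMr ?ler1n// ltW. Qed.

Lemma eps_seq_lt_near d r : 0 < d -> 0 < r -> \forall n \near \oo, eps_seq d n < r.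
Proof.
move=> d0 r0; have rd : 0 < r / d by rewrite divr_gt0.
near=> n; rewrite /eps_seq mulrC -ltr_pdivlMr//.
near: n; exact: (near_infty_natSinv_lt (PosNum rd)).
Unshelve. all: by end_near. Qed.

Lemma mollify a c s d w : 0 < d -> a <= s -> s + d <= c ->
  (forall x, a <= x <= c -> {for x, continuous w}) ->
  \int[mu]_(x in `[a, c]) (w x * dstep s (eps_seq d n) x) @[n --> \oo] --> w s.
Proof.
move=> d0 as_ sc cw; apply/cvgrPdist_le => e e0.
have /cvgrPdist_le/(_ _ e0)/nbhs_ballP[r /= r0 hr] : w x @[x --> s] --> w s.
  by apply: cw; lra.
near=> n; have n0 := eps_seq_gt0 n d0; have nd := eps_seq_le n d0.
have nr : eps_seq d n < r by near: n; exact: eps_seq_lt_near.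
have I1 := @Rint_dstep a c s _ n0 as_ (le_trans (lerD (lexx s) nd) sc).
have cd x : a <= x <= c -> {for x, continuous (fun x => w x * dstep s (eps_seq d n) x)}.
  by move=> h; apply: cvgM; [exact: cw|exact: dstep_continuous].
have itgd : Rintegrable `[a, c] (dstep s (eps_seq d n)).
  by apply: continuous_Rintegrable => x _; exact: dstep_continuous.
have -> : w s = \int[mu]_(x in `[a, c]) (w s * dstep s (eps_seq d n) x).
  by rewrite RintZ// I1 mulr1.
rewrite -RintB//; [|exact: RintegrableZ|exact: continuous_Rintegrable].
rewrite -[leRHS]mulr1 -[X in _ * X]I1 -RintZ//.
apply: Rint_norm_le => //.
- by apply: Rintegrable_measurable; apply: RintegrableB => //;
    [exact: RintegrableZ|exact: continuous_Rintegrable].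
- exact: RintegrableZ.
move=> x; rewrite /= in_itv/= => xac.
rewrite -mulrBl normrM (ger0_norm (dstep_ge0 _ _ n0)).
have [xs|xs] := boolP (s < x < s + eps_seq d n); last by rewrite (dstep_eq0 n0 xs) !mulr0.
rewrite ler_wpM2r ?dstep_ge0//; apply: hr; rewrite /ball/= ltr_norml.
by move: xs nr => /andP[]; lra.
Unshelve. all: by end_near. Qed.

(** The tests tend to the indicator of []a, b]], and their derivatives to the difference of the
    Dirac masses at [a] and [b]. The term in [w] passes to the limit by continuity, the term in [g]
    by dominated convergence. The room between [b] and [c] is there because a step rises to the
    right of its base point. *)
Lemma du_bois_reymond_lemma a b c w g : a < b -> b < c ->
  (forall x, a <= x <= c -> {for x, continuous w}) -> Rintegrable `[a, c] g ->
  (forall eps, 0 < eps -> b + eps <= c ->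
    \int[mu]_(x in `[a, c]) (w x * (dstep a eps x - dstep b eps x) +
                            g x * (step a eps x - step b eps x)) = 0) ->
  w b - w a = \int[mu]_(x in `[a, b]) g x.
Proof.
move=> ab bc cw Ig H.
pose d := c - b; have d0 : 0 < d by rewrite subr_gt0.
have ma := @mollify a c a d w d0 (lexx a) ltac:(rewrite /d; lra) cw.
have mb := @mollify a c b d w d0 (ltW ab) ltac:(rewrite /d; lra) cw.
pose h n x := g x * (step a (eps_seq d n) x - step b (eps_seq d n) x).
have hbound n x : `|h n x| <= `|g x|.
  rewrite normrM ler_piMr// ler_norml.
  have /andP[] := step_bound a (eps_seq d n) x; have /andP[] := step_bound b (eps_seq d n) x;
    lra.
have mh n : measurable_fun `[a, c] (h n).
  apply: measurable_funM; first exact: Rintegrable_measurable.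
  apply: Rintegrable_measurable; apply: continuous_Rintegrable => x _; apply: cvgB;
    apply: step_continuous; exact: eps_seq_gt0.
have Ih n : Rintegrable `[a, c] (h n) by apply: Rintegrable_le (Rintegrable_norm Ig).
have itgwd s n : Rintegrable `[a, c] (fun x => w x * dstep s (eps_seq d n) x).
  by apply: continuous_Rintegrable => x hx; apply: cvgM; [exact: cw|exact: dstep_continuous].
have E n : \int[mu]_(x in `[a, c]) (h n x) =
    \int[mu]_(x in `[a, c]) (w x * dstep b (eps_seq d n) x) -
    \int[mu]_(x in `[a, c]) (w x * dstep a (eps_seq d n) x).
  apply/eqP; rewrite -subr_eq0; apply/eqP; rewrite -[RHS](H (eps_seq d n)); last 2 first.
  - exact: eps_seq_gt0.
  - by have := eps_seq_le n d0; rewrite /d; lra.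
  rewrite -RintB// -RintB//; last exact: RintegrableB.
  by apply: Rint_eq => x _; rewrite /h; ring.
have lim1 : \int[mu]_(x in `[a, c]) (h n x) @[n --> \oo] --> w b - w a.
  by under eq_fun do rewrite E; apply: cvgB.
have lim2 : \int[mu]_(x in `[a, c]) (h n x) @[n --> \oo] --> \int[mu]_(x in `[a,
  c]) (g x * \1_`]a, b] x).
  have mD : measurable (`[a, c] : set R) by [].
  have := @dominated_convergence _ _ _ mu _ mD (fun n x => (h n x)%:E)
    (fun x => (g x * \1_`]a, b] x)%:E) (fun x => `|g x|%:E).
  case.
  - by move=> n; apply/measurable_EFinP; exact: mh.
  - apply/measurable_EFinP; apply: measurable_funM; first exact: Rintegrable_measurable.
    exact: measurable_indic.
  - apply: aeW => x /=; rewrite in_itv/= => /andP[ax xc].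
    (* For fixed [x] the integrand is eventually constant in [n]: a step vanishes up to its base
       point, and equals 1 at [x] as soon as it has finished rising before [x]. *)
    have fin s : \forall n \near \oo, s < x -> s + eps_seq d n < x.
      have [sx|xs] := ltP s x; last exact: nearW.
      near=> n => _; rewrite -ltrBrDl; near: n; apply: eps_seq_lt_near => //.
      by rewrite subr_gt0.
    apply: cvg_near_cst; near=> n; congr EFin; rewrite /h indicE mem_setE in_itv/=.
    have n0 := eps_seq_gt0 n d0.
    have [xa|xa] /= := leP x a; first by rewrite !step_le// ?subrr// (le_trans xa)// ltW.
    have na : a + eps_seq d n < x by move: xa; near: n; exact: fin.
    rewrite (step_ge n0 (ltW na)); have [xb|xb] := leP x b; first by rewrite step_le// subr0.
    have nb : b + eps_seq d n < x by move: xb; near: n; exact: fin.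
    by rewrite (step_ge n0 (ltW nb)) subrr.
  - exact: Rintegrable_norm Ig.
  - by apply: aeW => x n _; rewrite lee_fin.
  move=> If _ F; apply: fine_cvg; rewrite fineK; first exact: F.
  exact: (@integrable_fin_num _ _ _ mu _ mD _ If).
have -> : w b - w a = \int[mu]_(x in `[a, c]) (g x * \1_`]a, b] x).
  exact: cvg_unique lim1 lim2.
rewrite -[RHS]Rintegral_itv_obnd_cbnd; last first.
  apply: RintegrableS Ig => // x /=; rewrite !in_itv/= => /andP[h1 h2].
  by apply/andP; split; lra.
have -> : \int[mu]_(x in `]a, b]) g x = \int[mu]_(x in `[a, c] `&` `]a, b]) g x.
  congr (\int[mu]_(x in _) g x); apply/esym/setIidPr => x /=; rewrite !in_itv/=.
  by move=> /andP[h1 h2]; apply/andP; split; lra.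
rewrite Rintegral_mkcondr; apply: Rint_eq => x _.
by rewrite patchE indicE; case: (_ \in _); rewrite ?mulr1 ?mulr0.
Unshelve. all: by end_near. Qed.

End du_bois_reymond.

(** * Continuous curves in L^2 *)

Section pairing.
Variable R : realType.
Local Notation mu := (@lebesgue_measure R).
Implicit Types (g chi : R -> R) (K c d : R).

Lemma pairing_restrict g chi c d : (forall x, ~~ (c <= x <= d) -> g x * chi x = 0) ->
  (fun x => g x * chi x) = (fun x => g x * (chi x * \1_`[c, d] x)).
Proof.
move=> h; apply/funext => x; rewrite indicE mem_setE in_itv/=.
by have [_|/h ->] := boolP (c <= x <= d); rewrite ?mulr1// mulr0 mulr0.
Qed.

Lemma pairing_indic_bound chi K c d : (forall x, c <= x <= d -> `|chi x| <= K) ->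
  forall x, `|chi x * \1_`[c, d] x| <= K * \1_`[c, d] x.
Proof.
move=> h x; rewrite indicE mem_setE in_itv/=.
by have [/h|_] := boolP (c <= x <= d); rewrite ?mulr1// !mulr0 normr0.
Qed.

Lemma measM_indic chi c d : measurable_fun setT chi ->
  measurable_fun setT (fun x : R => chi x * \1_`[c, d] x).
Proof. by move=> m; apply: measurable_funM => //; exact: measurable_indic. Qed.

Lemma pairing_Rintegrable g chi K c d : sqintegrable g -> measurable_fun setT chi ->
  (forall x, c <= x <= d -> `|chi x| <= K) ->
  (forall x, ~~ (c <= x <= d) -> g x * chi x = 0) -> Rintegrable setT (fun x => g x * chi x).
Proof.
move=> sg mchi h /pairing_restrict ->.
by apply: Rintegrable_sqM sg (measM_indic c d mchi) (pairing_indic_bound h).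
Qed.

Lemma pairing_le g chi K c d : sqintegrable g -> measurable_fun setT chi -> c <= d -> 0 <= K ->
  (forall x, c <= x <= d -> `|chi x| <= K) ->
  (forall x, ~~ (c <= x <= d) -> g x * chi x = 0) ->
  `|\int[mu]_x (g x * chi x)| <= K * Num.sqrt (d - c) * Num.sqrt (sqnorm g).
Proof.
move=> sg mchi cd K0 h /pairing_restrict ->.
have := cauchy_schwarz sg (measM_indic c d mchi) cd K0 (pairing_indic_bound h).
set I := \int[mu]_x _ => hI.
rewrite -(@ler_pXn2r _ 2)// ?nnegrE//; last by rewrite !mulr_ge0 ?sqrtr_ge0.
rewrite real_normK ?num_real// !exprMn !sqr_sqrtr ?subr_ge0 ?sqnorm_ge0//.
by rewrite mulrC.
Qed.

Lemma sqintegrable_Rintegrable g c d : sqintegrable g -> (forall x, ~~ (c <= x <= d) ->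
  g x = 0) -> Rintegrable setT g.
Proof.
move=> sg h; have -> : g = (fun x => g x * (fun=> 1) x) by apply/funext => x; rewrite mulr1.
apply: (@pairing_Rintegrable _ _ 1 c d) => // x; first by rewrite normr1.
by move=> /h ->; rewrite mul0r.
Qed.

Lemma sqnorm_triangle f g : sqintegrable f -> sqintegrable g ->
  sqnorm f <= 2 * sqnorm (fun x => f x - g x) + 2 * sqnorm g.
Proof.
move=> sf sg; have [_ I1] := sqintegrableB sf sg; have [_ I2] := sg.
rewrite /sqnorm -!RintZ// -RintD//; [|exact: RintegrableZ..].
apply: le_Rintegral => //; [exact: (proj2 sf)|by apply: RintegrableD => //;
  exact: RintegrableZ|].
move=> x _; have := sqr_ge0 (f x - 2 * g x); nra.
Qed.

End pairing.

Section L2_curve_continuity.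
Variable R : realType.
Local Notation mu := (@lebesgue_measure R).
Implicit Types (chi : R -> R) (z : R -> R -> R).

(** Curves run over all real times, so that no one-sided limit occurs. The support condition
    reflects a boundary slower than speed 1; a support that is bounded locally in time makes the
    pairing with any locally bounded kernel continuous. *)
Record L2_curve (C : R) z : Prop := L2Curve {
  L2_curve_sqintegrable : forall t, sqintegrable (z t);
  L2_curve_cvg : forall t e, 0 < e -> exists2 r, 0 < r &
    forall s, `|s - t| < r -> Num.sqrt (sqnorm (fun x => z s x - z t x)) <= e;
  L2_curve_supp : forall t x, ~~ (0 < x < C + `|t|) -> z t x = 0;
  L2_curve_ge0 : 0 <= C }.

Variables (C : R) (z : R -> R -> R).
Hypothesis cz : L2_curve C z.

Lemma L2_curve_Rintegrable t : Rintegrable setT (z t).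
Proof.
apply: (sqintegrable_Rintegrable (c := 0) (d := C + `|t|) (L2_curve_sqintegrable cz t)) => x h.
apply: (L2_curve_supp cz); apply: contra h => /andP[h1 h2].
by rewrite !ltW.
Qed.

Lemma L2_curve_support t s x D : `|s - t| < 1 -> C + `|t| + 1 <= D -> ~~ (0 <= x <= D) ->
  z s x = 0.
Proof.
move=> st hD h; apply: (L2_curve_supp cz); apply: contra h => /andP[h1 h2].
rewrite ltW//= ltW// (lt_le_trans h2)// (le_trans _ hD)// -addrA lerD2l.
rewrite -(subrK t s); apply: le_trans (ler_normD _ _) _; lra.
Qed.

Lemma L2_curve_norm_bounded t : exists N r, [/\ 0 < r, 0 <= N &
  forall s, `|s - t| < r -> Num.sqrt (sqnorm (z s)) <= N].
Proof.
have [r r0 hr] := L2_curve_cvg cz t ltr01.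
exists (Num.sqrt (2 + 2 * sqnorm (z t))), r; split => // s /hr h.
apply: ler_wsqrtr; apply: le_trans (sqnorm_triangle (L2_curve_sqintegrable cz s)
  (L2_curve_sqintegrable cz t)) _.
rewrite lerD2r//.
have := h; rewrite -(@ler_pXn2r _ 2) ?nnegrE ?sqrtr_ge0// sqr_sqrtr ?sqnorm_ge0//.
by rewrite expr1n => ?; rewrite ler_piMr.
Qed.

Lemma L2_curve_pairing_cont chi : measurable_fun setT chi ->
  (forall D, exists2 K, 0 <= K & forall x, 0 <= x <= D -> `|chi x| <= K) ->
  continuous (fun t => \int[mu]_x (z t x * chi x)).
Proof.
move=> mchi hchi t; apply/cvgrPdist_le => e e0.
pose D := C + `|t| + 1.
have D0 : 0 <= D by rewrite /D !addr_ge0// (L2_curve_ge0 cz).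
have [K K0 hK] := hchi D.
have c0 : 0 < K * Num.sqrt D + 1 by rewrite ltr_wpDl// mulr_ge0// sqrtr_ge0.
have [r r0 hr] := L2_curve_cvg cz t (divr_gt0 e0 c0).
apply/nbhs_ballP; exists (Num.min r 1); first by rewrite /= lt_min r0 ltr01.
move=> s; rewrite /ball/= distrC lt_min => /andP[sr s1].
have supp (u : R) : `|u - t| < 1 -> forall x, ~~ (0 <= x <= D) -> z u x = 0.
  by move=> ut x; exact: (L2_curve_support (t := t) (D := D)).
have t1 : `|t - t| < 1 by rewrite subrr normr0.
have itgz (u : R) : `|u - t| < 1 -> Rintegrable setT (fun x => z u x * chi x).
  move=> ut; apply: (@pairing_Rintegrable _ _ _ K 0 D) => //;
    first exact: (L2_curve_sqintegrable cz).
  by move=> x /(supp _ ut) ->; rewrite mul0r.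
rewrite distrC -RintB//; [|exact: itgz..].
have -> : \int[mu]_x (z s x * chi x - z t x * chi x) = \int[mu]_x ((z s x - z t x) * chi x).
  by apply: Rint_eq => x _; rewrite mulrBl.
apply: le_trans (@pairing_le _ _ _ K 0 D _ mchi D0 K0 hK _) _.
- by apply: sqintegrableB; exact: (L2_curve_sqintegrable cz).
- by move=> x h; rewrite !supp// subrr mul0r.
rewrite subr0; apply: (@le_trans _ _ (K * Num.sqrt D * (e / (K * Num.sqrt D + 1)))).
  by rewrite ler_wpM2l ?mulr_ge0 ?sqrtr_ge0// hr.
by rewrite mulrA ler_pdivrMr// mulrC ler_pM2l//; lra.
Qed.

Definition jointly_continuous (w : R -> R -> R) y t := forall e, 0 < e -> exists2 r, 0 < r &
  forall y' s, `|y' - y| < r -> `|s - t| < r -> `|w y' s - w y t| <= e.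

Lemma meas_indic_itv c d : measurable_fun setT (\1_`[c, d] : R -> R).
Proof. exact: measurable_indic. Qed.

Lemma prim_time_diff s t y : 0 <= y ->
  `|prim (z s) y - prim (z t) y| <= Num.sqrt y * Num.sqrt (sqnorm (fun x => z s x - z t x)).
Proof.
move=> y0; have Iz u : Rintegrable setT (fun x => z u x * \1_`[0, y] x).
  by apply: Rintegrable_indicM => //; exact: L2_curve_Rintegrable.
rewrite /prim -RintB//.
have -> : \int[mu]_x (z s x * \1_`[0, y] x - z t x * \1_`[0,
  y] x) = \int[mu]_x ((z s x - z t x) * \1_`[0, y] x).
  by apply: Rint_eq => x _; rewrite mulrBl.
apply: le_trans (@pairing_le _ _ _ 1 0 y _ (@meas_indic_itv _ _) y0 ler01 _ _) _.
- by apply: sqintegrableB; exact: (L2_curve_sqintegrable cz).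
- by move=> x _; rewrite indicE normr_nat; case: (_ \in _).
- by move=> x h; rewrite indicE mem_setE in_itv/= (negbTE h) mulr0.
by rewrite mul1r subr0.
Qed.

Lemma prim_le0 (g : R -> R) y : y <= 0 -> prim g y = 0.
Proof.
rewrite primE le_eqVlt => /predU1P[->|y0]; first by rewrite set_itv1 Rintegral_set1.
by rewrite set_itv_ge ?Rintegral_set0// bnd_simp -ltNge.
Qed.

Lemma prim_space_diff t y y' : y <= y' ->
  `|prim (z t) y' - prim (z t) y| <= Num.sqrt (y' - y) * Num.sqrt (sqnorm (z t)).
Proof.
move=> yy'.
have [y0|y0] := leP 0 y.
  rewrite primB//; last exact: L2_curve_Rintegrable.
  apply: le_trans (@pairing_le _ _ _ 1 y y' _ _ yy' ler01 _ _) _.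
  - exact: (L2_curve_sqintegrable cz).
  - exact: measurable_indic.
  - by move=> x _; rewrite indicE normr_nat; case: (_ \in _).
  - move=> x h; rewrite indicE mem_setE in_itv/=.
    have [/andP[h1 h2]|_] := boolP (y < x <= y'); last by rewrite mulr0.
    by rewrite (ltW h1) h2 in h.
  by rewrite mul1r.
rewrite (prim_le0 _ (ltW y0)) subr0.
have [y'0|y'0] := leP 0 y'; last by rewrite (prim_le0 _ (ltW y'0)) normr0 mulr_ge0 ?sqrtr_ge0.
apply: le_trans (@pairing_le _ _ _ 1 0 y' _ (@meas_indic_itv _ _) y'0 ler01 _ _) _.
- exact: (L2_curve_sqintegrable cz).
- by move=> x _; rewrite indicE normr_nat; case: (_ \in _).
- by move=> x h; rewrite indicE mem_setE in_itv/= (negbTE h) mulr0.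
by rewrite mul1r ler_wpM2r ?sqrtr_ge0// ler_wsqrtr//; lra.
Qed.

Lemma prim_jointly_continuous y t : jointly_continuous (fun y t => prim (z t) y) y t.
Proof.
move=> e e0.
pose c := Num.sqrt (`|y| + 1) + 1.
have c0 : 0 < c by rewrite /c ltr_wpDl// sqrtr_ge0.
have e20 : 0 < e / 2 by rewrite divr_gt0.
have [r r0 hr] := L2_curve_cvg cz t (divr_gt0 e20 c0).
pose N := Num.sqrt (sqnorm (z t)).
have N0 : 0 < N + 1 by rewrite ltr_wpDl// sqrtr_ge0.
(* In space [prim (z t)] is Hölder continuous of exponent 1/2 with constant [N]; this [k] makes
   [Num.sqrt k * N] at most [e / 2]. *)
pose k := (e / 2 / (N + 1)) ^+ 2.
have k0 : 0 < k by rewrite exprn_gt0// divr_gt0.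
exists (Num.min r (Num.min 1 k)); first by rewrite !lt_min r0 ltr01 k0.
move=> y' s; rewrite !lt_min => /and3P[_ y1 yk] /and3P[sr _ _].
have -> : prim (z s) y' - prim (z t) y = (prim (z s) y' - prim (z t) y') + (prim (z t) y' -
  prim (z t) y) by ring.
apply: le_trans (ler_normD _ _) _; rewrite (splitr e) lerD//.
  have [y'0|y'0] := leP 0 y'; last by rewrite !(prim_le0 _ (ltW y'0)) subrr normr0 ltW.
  apply: le_trans (prim_time_diff _ _ y'0) _.
  apply: (@le_trans _ _ (c * (e / 2 / c))); last by rewrite mulrCA divff ?mulr1// gt_eqF.
  rewrite ler_pM ?sqrtr_ge0// ?hr// /c.
  apply: (@le_trans _ _ (Num.sqrt (`|y| + 1))); last by rewrite lerDl.
  apply: ler_wsqrtr; apply: le_trans (ler_norm _) _.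
  rewrite -(subrK y y') addrC; apply: le_trans (ler_normD _ _) _; rewrite lerD2l.
  exact: ltW.
have h (a b : R) : a <= b -> b - a <= k -> `|prim (z t) b - prim (z t) a| <= e / 2.
  move=> ab abk; apply: le_trans (prim_space_diff t ab) _.
  apply: (@le_trans _ _ (e / 2 / (N + 1) * N)).
    rewrite ler_wpM2r ?sqrtr_ge0//.
    have -> : e / 2 / (N + 1) = Num.sqrt k by rewrite sqrtr_sqr gtr0_norm// divr_gt0.
    exact: ler_wsqrtr.
  rewrite mulrAC ler_pdivrMr// ler_pM2l//; lra.
have [yy'|yy'] := leP y y'.
  by apply: h => //; move: yk; rewrite ger0_norm ?subr_ge0// => /ltW.
rewrite distrC; apply: h; first exact: ltW.
by move: yk; rewrite ltr0_norm ?subr_lt0// opprB => /ltW.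
Qed.

End L2_curve_continuity.

(** * Pairing with the kernel [min x y] *)

Section moment.
Variable R : realType.
Local Notation mu := (@lebesgue_measure R).
Implicit Types (g : R -> R) (y eps x : R).

Definition mass g : R := \int[mu]_x g x.
(** Its derivative in [y] is the mass of [g] beyond [y]. For [g = u_t] this mass is [- v], so that
    [- moment] is a space primitive of the conjugate function. *)
Definition moment g y : R := \int[mu]_x (g x * Num.min x y).

Lemma continuous_measurable g : continuous g -> measurable_fun setT g.
Proof. exact: continuous_measurable_fun. Qed.

Lemma min_continuous y : continuous (fun x : R => Num.min x y).
Proof. by move=> s; apply: (@continuous_min _ _ id (cst y));
  [exact: cvg_id|exact: cst_continuous]. Qed.

Lemma min_meas y : measurable_fun setT (fun x : R => Num.min x y).
Proof. by apply: continuous_measurable; exact: min_continuous. Qed.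

Lemma min_norm_le (D x y : R) : 0 <= x <= D -> `|Num.min x y| <= D + `|y|.
Proof.
move=> /andP[x0 xD]; have := ler_norm y; have := ler_norm (- y); rewrite normrN ler_norml.
by case: (leP x y) => h h1 h2; apply/andP; split; lra.
Qed.

Variables (C : R) (z : R -> R -> R).
Hypothesis cz : L2_curve C z.

Lemma L2_curve_pairing_Rintegrable (t : R) (chi : R -> R) : measurable_fun setT chi ->
  (forall D, exists2 K, 0 <= K & forall x, 0 <= x <= D -> `|chi x| <= K) ->
  Rintegrable setT (fun x => z t x * chi x).
Proof.
move=> mchi hchi; have [K K0 hK] := hchi (C + `|t| + 1).
apply: (@pairing_Rintegrable _ _ _ K 0 (C + `|t| + 1)) => //;
  first exact: (L2_curve_sqintegrable cz).
move=> x h; rewrite (L2_curve_support cz (t := t) _ (lexx _) h) ?mul0r//.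
by rewrite subrr normr0.
Qed.

Lemma min_locally_bounded y : forall D, exists2 K, 0 <= K &
  forall x, 0 <= x <= D -> `|Num.min x y| <= K.
Proof.
move=> D; exists (`|D| + `|y|); first by rewrite addr_ge0.
move=> x h; apply: le_trans (min_norm_le y h) _; by rewrite lerD2r ler_norm.
Qed.

(** The error is the pairing with [chi], which is bounded by [|y' - y|] and, for positive [x],
    vanishes outside the interval between [y] and [y']. By Cauchy-Schwarz it is of order [|y' - y|]
    to the power 3/2. *)
Lemma moment_deriv t y : deriv_at (moment (z t)) y (mass (z t) - prim (z t) y).
Proof.
have Im y' := L2_curve_pairing_Rintegrable t (min_meas y') (min_locally_bounded y').
have It := L2_curve_Rintegrable cz t.
have Ip : Rintegrable setT (fun x => z t x * \1_`[0, y] x) by exact: Rintegrable_indicM.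
move=> e e0; pose N := Num.sqrt (sqnorm (z t)).
have N0 : 0 < N + 1 by rewrite ltr_wpDl// sqrtr_ge0.
have k0 : 0 < (e / (N + 1)) ^+ 2 by rewrite exprn_gt0// divr_gt0.
exists ((e / (N + 1)) ^+ 2) => // y' hy.
pose h := y' - y.
pose chi x := Num.min x y' - Num.min x y - h * (1 - \1_`[0, y] x).
have -> : moment (z t) y' - moment (z t) y - (mass (z t) - prim (z t) y) * (y' - y) =
    \int[mu]_x (z t x * chi x).
  rewrite -/h mulrC /mass /prim -RintB// -RintB// -RintZ//; last exact: RintegrableB.
  rewrite -RintB//; [|exact: RintegrableB|by apply: RintegrableZ => //; exact: RintegrableB].
  by apply: Rint_eq => x _; rewrite /chi; ring.
have mchi : measurable_fun setT chi.
  apply: measurable_funB; first by apply: measurable_funB; exact: min_meas.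
  apply: measurable_funM => //; apply: measurable_funB => //; exact: measurable_indic.
have cd : Num.min y y' <= Num.max y y' by rewrite ge_min le_max lexx.
have bnd x : Num.min y y' <= x <= Num.max y y' -> `|chi x| <= `|h|.
  rewrite /chi /h indicE mem_setE in_itv/=.
  have [yy'|yy'] := leP y y' => /andP[h1 h2].
    rewrite (min_idPl h2) (min_idPr h1) [X in _ <= X]ger0_norm ?subr_ge0// ler_norml.
    by case: (0 <= x); case: (leP x y) => /= ?; apply/andP; split; lra.
  rewrite (min_idPr h1) (min_idPl h2) [X in _ <= X]ltr0_norm ?subr_lt0// ler_norml.
  by case: (0 <= x); rewrite ?h2/=; apply/andP; split; lra.
apply: le_trans (@pairing_le _ _ _ _ _ _ (L2_curve_sqintegrable cz t) mchi cd (normr_ge0 h) bnd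
  _) _.
  move=> x; rewrite negb_and -!ltNge => hx.
  have [x0|x0] := leP x 0; first by rewrite (L2_curve_supp cz) ?mul0r// ltNge x0.
  rewrite /chi /h indicE mem_setE in_itv/= (ltW x0)/=.
  have -> : Num.min x y' - Num.min x y - (y' - y) * (1 - (x <= y)%R%:R) = 0;
    last by rewrite mulr0.
  move: hx; rewrite lt_min gt_max => /orP[/andP[h1 h2]|/andP[h1 h2]].
    by rewrite (min_idPl (ltW h1)) (min_idPl (ltW h2)) (ltW h1)/=; ring.
  by rewrite (min_idPr (ltW h1)) (min_idPr (ltW h2)) leNgt h1/=; ring.
have -> : Num.max y y' - Num.min y y' = `|h|.
  by rewrite /h; case: (leP y y') => ?; [rewrite ger0_norm|rewrite ltr0_norm]; lra.
rewrite -/N -mulrA mulrC ler_wpM2r//.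
apply: (@le_trans _ _ (e / (N + 1) * N)).
  rewrite ler_wpM2r ?sqrtr_ge0//.
  have -> : e / (N + 1) = Num.sqrt ((e / (N + 1)) ^+ 2).
    by rewrite sqrtr_sqr gtr0_norm// divr_gt0.
  by apply: ler_wsqrtr; exact: ltW.
rewrite mulrAC ler_pdivrMr// ler_pM2l//; lra.
Qed.

End moment.

(** * Regularization of the kernel [min x y] *)

Section ramp.
Variable R : realType.
Implicit Types (y eps x : R).
Local Notation m := (@pospart R).
Local Notation q := (@sqpos R).

(* A C^1 approximation of min(x, y). *)
Definition ramp y eps x : R := x - (q (x - y) - q (x - y - eps)) / (2 * eps).
Definition dramp y eps x : R := 1 - (m (x - y) - m (x - y - eps)) / eps.

Lemma ramp_deriv y eps x : 0 < eps -> deriv_at (ramp y eps) x (dramp y eps x).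
Proof.
move=> e0; apply: (@deriv_at_quadratic _ _ _ _ eps^-1); first by rewrite invr_ge0 ltW.
move=> x'; have h1 := sqpos_estimate (x - y) (x' - y).
have h2 := sqpos_estimate (x - y - eps) (x' - y - eps).
rewrite /ramp /dramp.
set a1 := q (x' - y) in h1 *; set a2 := q (x - y) in h1 *; set a3 := m (x - y) in h1 *.
set b1 := q (x' - y - eps) in h2 *; set b2 := q (x - y - eps) in h2 *;
  set b3 := m (x - y - eps) in h2 *.
have -> : x' - (a1 - b1) / (2 * eps) - (x - (a2 - b2) / (2 * eps)) - (1 - (a3 - b3) / eps) *
  (x' - x)
  = (2 * eps)^-1 * ((b1 - b2 - 2 * b3 * (x' - x)) - (a1 - a2 - 2 * a3 * (x' - x))).
  by field; rewrite gt_eqF.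
rewrite normrM ger0_norm; last by rewrite invr_ge0 mulr_ge0// ltW.
have -> : eps^-1 * (x' - x) ^+ 2 = (2 * eps)^-1 * ((x' - x) ^+ 2 + (x' - x) ^+ 2).
  by field; rewrite gt_eqF.
rewrite ler_wpM2l//; first by rewrite invr_ge0 mulr_ge0// ltW.
apply: le_trans (ler_normB _ _) _; move: h1 h2.
have -> : x' - y - (x - y) = x' - x by ring.
have -> : x' - y - eps - (x - y - eps) = x' - x by ring.
by move=> h1 h2; exact: lerD.
Qed.

(** Up to [y] the ramp is [x], from [y + eps] on it is the constant [y + eps / 2], and a parabola
    joins the two; [hd], [hd1] and [hd2] are these three regimes. *)
Lemma ramp_bound y eps x : 0 < eps -> `|ramp y eps x - Num.min x y| <= eps.
Proof.
move=> e0; rewrite /ramp ler_norml.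
set d := (q (x - y) - q (x - y - eps)) / (2 * eps).
have hd : x - y <= 0 -> d = 0.
  move=> h; rewrite /d /sqpos /pospart !max_r; [by rewrite expr0n subrr mul0r|lra..].
have hd1 : 0 <= x - y -> x - y <= eps -> d = (x - y) ^+ 2 / (2 * eps).
  by move=> h h'; rewrite /d /sqpos /pospart max_l// max_r ?expr0n ?subr0//; lra.
have hd2 : eps <= x - y -> d = x - y - eps / 2.
  move=> h; rewrite /d /sqpos /pospart !max_l; [|lra..].
  by field; rewrite gt_eqF.
case: (leP x y) => h; first by rewrite hd; lra.
have [h'|h'] := leP (x - y) eps; last by rewrite hd2; lra.
rewrite hd1; [|lra..].
have h1 : 0 <= (x - y) ^+ 2 / (2 * eps) by rewrite divr_ge0 ?sqr_ge0// mulr_ge0// ltW.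
have h2 : (x - y) ^+ 2 / (2 * eps) <= eps by rewrite ler_pdivrMr ?mulr_gt0//; nra.
lra.
Qed.

Lemma dramp_bound y eps x : 0 < eps -> 0 <= dramp y eps x <= 1.
Proof.
move=> e0; rewrite /dramp.
have h1 : 0 <= m (x - y) - m (x - y - eps).
  by rewrite /pospart; case: (leP (x - y) 0); case: (leP (x - y - eps) 0); lra.
have h2 : m (x - y) - m (x - y - eps) <= eps.
  by rewrite /pospart; case: (leP (x - y) 0); case: (leP (x - y - eps) 0); lra.
have : 0 <= (m (x - y) - m (x - y - eps)) / eps by rewrite divr_ge0// ltW.
have : (m (x - y) - m (x - y - eps)) / eps <= 1 by rewrite ler_pdivrMr// mul1r.
lra.
Qed.

Lemma dramp_le y eps x : 0 < eps -> x <= y -> dramp y eps x = 1.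
Proof.
move=> e0 xy; rewrite /dramp /pospart !max_r; [by rewrite subrr mul0r subr0|lra..].
Qed.

Lemma dramp_ge y eps x : 0 < eps -> y + eps <= x -> dramp y eps x = 0.
Proof.
move=> e0 xy; rewrite /dramp /pospart !max_l; [|lra..].
by field; rewrite gt_eqF.
Qed.

Lemma ramp0 y eps : 0 < eps -> 0 <= y -> ramp y eps 0 = 0.
Proof.
move=> e0 y0; rewrite /ramp /sqpos /pospart !max_r; [|lra..].
by rewrite expr0n subrr mul0r subr0.
Qed.

Lemma dramp_continuous y eps : continuous (dramp y eps).
Proof.
move=> x; rewrite /dramp; apply: cvgB; first exact: cvg_cst.
apply: cvgM; last exact: cvg_cst.
apply: cvgB; first exact: pospartB_continuous.
rewrite (_ : (fun x => _) = (fun x => m (x - (y + eps)))); last first.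
  by apply/funext => s; congr (m _); ring.
have -> : x - y - eps = x - (y + eps) by ring.
exact: pospartB_continuous.
Qed.

End ramp.

(** * The weak form *)

Section time_slices.
Variable R : realType.
Local Notation mu := (@lebesgue_measure R).
Variable ell : R -> R.
Hypothesis ell_gt0 : forall t : R, 0 <= t -> 0 < ell t.
Hypothesis ell_lip : forall s t : R, 0 <= s -> s < t -> `|ell t - ell s| < t - s.
Implicit Types (f u ux ut : R -> R -> R).

(* Frozen for t <= 0, so that continuous_L2 becomes continuity on the whole line. *)
Definition slice f (t : R) : R -> R := zero_ext (ell (pospart t)) (f^~ (pospart t)).

Lemma pospart_id (t : R) : 0 <= t -> pospart t = t.
Proof. by move=> t0; rewrite /pospart max_l. Qed.

Lemma pospart_ge0 (t : R) : 0 <= pospart t.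
Proof. by rewrite /pospart le_max lexx orbT. Qed.

Lemma pospart_lip (s t : R) : `|pospart s - pospart t| <= `|s - t|.
Proof.
rewrite /pospart; case: (leP s 0) => s0; case: (leP t 0) => t0; rewrite ?subrr ?subr0 ?normr0//.
- rewrite sub0r normrN (gtr0_norm t0) distrC (@ger0_norm _ (t - s)); lra.
- rewrite (gtr0_norm s0) (@ger0_norm _ (s - t)); lra.
Qed.

Lemma sliceE f (t x : R) : 0 <= t -> 0 < x < ell t -> slice f t x = f x t.
Proof. by move=> t0 h; rewrite /slice /zero_ext pospart_id// patchE mem_setE in_itv/= h. Qed.

Lemma slice0 f (t x : R) : 0 <= t -> ~~ (0 < x < ell t) -> slice f t x = 0.
Proof. by move=> t0 h; rewrite /slice /zero_ext pospart_id// patchE mem_setE in_itv/= (negbTE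
  h). Qed.

Lemma ell_le_lip (t : R) : 0 <= t -> ell t <= ell 0 + t.
Proof.
rewrite le_eqVlt => /predU1P[<-|t0]; first by rewrite addr0.
have := ell_lip (lexx 0) t0; rewrite subr0 ltr_norml; lra.
Qed.

Lemma ereal_cvg0_lt (T : Type) (F : set_system T) (FF : Filter F) (h : T -> \bar R) (e : R) :
  h x @[x --> F] --> 0%E -> 0 < e -> \forall x \near F, (h x < e%:E)%E.
Proof.
move=> hF e0; apply: (hF [set y | (y < e%:E)%E]).
apply: open_nbhs_nbhs; split; last by rewrite /= lte_fin.
exact: open_ereal_lt_ereal.
Qed.

(** Freezing time by [pospart], which is 1-Lipschitz, preserves continuity; the support bound comes
    from [ell t <= ell 0 + t]. *)
Lemma slice_L2_curve f : continuous_L2 ell f -> L2_curve (ell 0) (slice f).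
Proof.
move=> [fL2 fc]; have sq t : sqintegrable (slice f t) by apply: Lfun2_sqintegrable;
  exact/fL2/pospart_ge0.
split => // [t e e0|t x h|]; last exact/ltW/ell_gt0.
- have t0 := pospart_ge0 t.
  have := ereal_cvg0_lt _ (fc _ t0) e0.
  move=> /(_ _)/nbhs_ballP[r /= r0 hr]; exists r => // s sr.
  have := hr (pospart s); rewrite /ball/= distrC => /(_ (le_lt_trans (pospart_lip _ _) sr)).
  rewrite in_itv/= pospart_ge0 => /(_ isT).
  have -> : zero_ext (ell (pospart s)) (f^~ (pospart s)) \- zero_ext (ell (pospart t)) (f^~
    (pospart t))
    = fun x => slice f s x - slice f t x by [].
  by rewrite L2norm_sqnorm; [rewrite lte_fin => /ltW|exact: sqintegrableB].
- have [t0|t0] := leP 0 t.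
    apply: slice0 => //; apply: contra h => /andP[-> xl] /=.
    by rewrite (lt_le_trans xl)// ger0_norm//; exact: ell_le_lip.
  rewrite /slice /zero_ext patchE mem_setE in_itv/=; case: ifP => // xl; exfalso; move: h.
  have p0 : pospart t = 0 by rewrite /pospart max_r// ltW.
  move: xl; rewrite p0 => /andP[-> xl]/=; rewrite (lt_le_trans xl)// lerDl//.
Qed.

Lemma C1_comb (F G : R -> R) (dF dG : R -> R) :
  (forall x, deriv_at F x (dF x)) -> (forall x, deriv_at G x (dG x)) ->
  continuous dF -> continuous dG ->
  C1 (fun x => F x - G x) /\ derive1 (fun x => F x - G x) = (fun x => dF x - dG x).
Proof.
move=> hF hG cF cG.
have h x : deriv_at (fun x => F x - G x) x (dF x - dG x).
  have := deriv_at_comb 1 (-1) (hF x) (hG x).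
  rewrite !mul1r !mulN1r; congr (deriv_at _ _ _); apply/funext => y.
  by rewrite mul1r mulN1r.
have E : derive1 (fun x => F x - G x) = (fun x => dF x - dG x).
  by apply/funext => x; rewrite derive1E; have [_] := deriv_at_is_derive (h x).
split => //; split; first by move=> x; have [] := deriv_at_is_derive (h x).
by rewrite E => x; apply: cvgB; [exact: cF|exact: cG].
Qed.

Lemma Rint_support (D D' : set R) (F : R -> R) : D' `<=` D ->
  (forall x, D x -> ~ D' x -> F x = 0) ->
  \int[mu]_(x in D) F x = \int[mu]_(x in D') F x.
Proof.
move=> DD h; rewrite [LHS]Rintegral_mkcond [RHS]Rintegral_mkcond; apply: Rint_eq => x _.
rewrite !patchE; have [/set_mem xD|/negP xD] := boolP (x \in D);
  have [/set_mem xD'|/negP xD'] := boolP (x \in D') => //.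
- by apply: h => // xD'2; apply: xD'; exact: mem_set.
- by exfalso; apply: xD; apply: mem_set; exact: DD.
Qed.

(** Allows the continuity results for primitives along a curve to be applied to a single
    function. *)
Lemma L2_curve_cst (a : R) (g : R -> R) : 0 <= a -> sqintegrable g ->
  (forall x : R, ~~ (0 < x < a) -> g x = 0) -> L2_curve a (fun=> g).
Proof.
move=> a0 sg supp; split => // [t e e0|t x h].
  exists 1 => // s _; rewrite (_ : (fun x => _) = cst 0).
    rewrite /sqnorm (_ : (fun x => _) = cst 0); last by apply/funext => y /=; rewrite expr0n.
    by rewrite Rintegral_cst//= mul0r sqrtr0 ltW.
  by apply/funext => y /=; rewrite subrr.
apply: supp; apply: contra h => /andP[-> xa]/=.
by rewrite (lt_le_trans xa)// lerDl.
Qed.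

Lemma jointly_continuous_space (w : R -> R -> R) y t : jointly_continuous w y t ->
  {for y, continuous (w^~ t)}.
Proof.
move=> h; apply/cvgrPdist_le => e e0; have [r r0 hr] := h _ e0.
apply/nbhs_ballP; exists r => // y' hy; rewrite distrC; apply: hr.
  by move: hy; rewrite /ball/= distrC.
by rewrite subrr normr0.
Qed.

(** Test functions have compact support in []0, a[], so the lemma of du Bois-Reymond starts from
    some [x1 > 0]. The continuity of [w] and [w 0 = 0] then let [x1] tend to 0. *)
Lemma weak_deriv_prim (a : R) (w g : R -> R) : 0 < a -> V0_deriv a w g ->
  forall x : R, 0 < x < a -> w x = prim (zero_ext a g) x.
Proof.
move=> a0 [[cw Lw Lg wd] w0] x /andP[x0 xa].
have [cwo wlim _] := (continuous_within_itvP w a0).1 cw.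
have cwx y : 0 < y < a -> {for y, continuous w}.
  by move=> h; apply: cwo; rewrite in_itv.
have sg := Lfun2_sqintegrable Lg.
have supp y : ~~ (0 <= y <= a) -> zero_ext a g y = 0.
  rewrite /zero_ext patchE mem_setE in_itv/=; case: ifP => // /andP[h1 h2].
  by rewrite !ltW.
have Ig := sqintegrable_Rintegrable sg supp.
have key x1 : 0 < x1 -> x1 < x -> w x - w x1 = prim (zero_ext a g) x - prim (zero_ext a g) x1.
  (* Any point strictly between [x] and [a] would do: it leaves room for the step based at [x] to
     rise inside the interval. *)
  move=> x10 x1x; pose c := (x + a) / 2.
  have xc : x < c by rewrite /c; lra.
  have ca : c < a by rewrite /c; lra.
  have Ic : Rintegrable `[x1, c] (zero_ext a g) by exact: RintegrableS Ig.
  have cwc y : x1 <= y <= c -> {for y, continuous w}.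
    by move=> /andP[h1 h2]; apply: cwx; apply/andP; split; lra.
  rewrite (@du_bois_reymond_lemma _ x1 x c w (zero_ext a g))// => [|eps e0 xe].
    rewrite -Rintegral_itv_obnd_cbnd; last by exact: RintegrableS Ig.
    rewrite primB ?(ltW x10) ?(ltW x1x)// Rintegral_mkcond; apply: Rint_eq => y _.
    by rewrite patchE indicE; case: (_ \in _); rewrite ?mulr1 ?mulr0.
  have [C1psi Dpsi] := C1_comb (fun y => step_deriv x1 y e0) (fun y => step_deriv x y e0)
    (dstep_continuous (eps := eps)) (dstep_continuous (eps := eps)).
  have psi0 y : ~~ (x1 <= y <= c) -> step x1 eps y - step x eps y = 0.
    rewrite negb_and -!ltNge => /orP[h|h]; first by rewrite !step_le ?subrr//; lra.
    by rewrite !step_ge ?subrr//; lra.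
  have dpsi0 y : ~~ (x1 <= y <= c) -> dstep x1 eps y - dstep x eps y = 0.
    move=> h; rewrite !dstep_eq0 ?subrr//; apply: contra h => /andP[h1 h2]; lra.
  have sub : `[x1, c] `<=` (`]0, a[ : set R).
    by move=> y /=; rewrite !in_itv/= => /andP[h1 h2]; apply/andP; split; lra.
  have := wd _ C1psi; rewrite Dpsi => E.
  have : \int[mu]_(y in `]0, a[) (w y * (dstep x1 eps y - dstep x eps y)) =
         - \int[mu]_(y in `]0, a[) (g y * (step x1 eps y - step x eps y)).
    apply: E; exists x1, c; split => // y; rewrite in_itv/=; exact: psi0.
  rewrite (@Rint_support _ `[x1, c])//; last first.
    by move=> y _; rewrite /= in_itv/= => /negP /dpsi0 ->; rewrite mulr0.
  rewrite (@Rint_support _ `[x1, c] (fun y => g y * _))//; last first.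
    by move=> y _; rewrite /= in_itv/= => /negP /psi0 ->; rewrite mulr0.
  rewrite (@Rint_eq _ `[x1, c] (fun y => g y * _) (fun y => zero_ext a g y * (step x1 eps y -
    step x eps y))).
    move=> E2; rewrite RintD ?E2 ?addNr//.
      apply: continuous_Rintegrable => y hy; apply: cvgM; first exact: cwc.
      by apply: cvgB; exact: dstep_continuous.
    apply: Rintegrable_le (Rintegrable_norm Ic) => //.
      apply: measurable_funM; first exact: Rintegrable_measurable.
      by apply: measurable_funTS; apply: continuous_measurable => y; apply: cvgB;
        exact: step_continuous.
    move=> y _; rewrite normrM ler_piMr// ler_norml.
    have /andP[] := step_bound x1 eps y; have /andP[] := step_bound x eps y; lra.
  by move=> y /sub; rewrite /zero_ext patchE => /mem_set ->.
have supp' y : ~~ (0 < y < a) -> zero_ext a g y = 0.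
  by rewrite /zero_ext patchE mem_setE in_itv/= => /negbTE ->.
have cz := L2_curve_cst (ltW a0) sg supp'.
have plim : prim (zero_ext a g) x1 @[x1 --> 0^'+] --> 0.
  have := jointly_continuous_space (@prim_jointly_continuous _ _ _ cz 0 0).
  by move=> /cvg_at_right_filter; rewrite /= prim_le0.
rewrite w0 in wlim.
have l1 : w x - w x1 @[x1 --> 0^'+] --> w x - 0 by apply: cvgB wlim; exact: cvg_cst.
have l2 : prim (zero_ext a g) x - prim (zero_ext a g) x1 @[x1 --> 0^'+] --> prim (zero_ext a g)
  x - 0.
  by apply: cvgB plim; exact: cvg_cst.
rewrite -[LHS]subr0 -[RHS]subr0; apply: (cvg_unique _ l1) => //.
apply: cvg_trans l2; apply: near_eq_cvg; near=> x1.
rewrite key//; near: x1; exact: nbhs_right_lt.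
Unshelve. all: by end_near. Qed.

End time_slices.

(** * Time derivatives drawn from the weak equation and from the L^2 derivative of [u] *)

Section weak_form.
Variable R : realType.
Local Notation mu := (@lebesgue_measure R).
Variable ell : R -> R.
Hypothesis ell_gt0 : forall t : R, 0 <= t -> 0 < ell t.
Hypothesis ell_lip : forall s t : R, 0 <= s -> s < t -> `|ell t - ell s| < t - s.
Variables u ux ut : R -> R -> R.
Hypothesis uV0 : continuous_V0 ell u ux.
Hypothesis uC1 : C1_L2 ell u ut.
Hypothesis uw : weak_wave ell ux ut.
Local Notation zx := (slice ell ux).
Local Notation zt := (slice ell ut).

Lemma zx_L2_curve : L2_curve (ell 0) zx.
Proof. by apply: slice_L2_curve => //; case: uV0. Qed.

Lemma zt_L2_curve : L2_curve (ell 0) zt.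
Proof. by apply: slice_L2_curve => //; case: uC1. Qed.

Lemma deriv_atZ (F : R -> R) (x d k : R) : deriv_at F x d ->
  deriv_at (fun y => k * F y) x (k * d).
Proof.
move=> h; have := deriv_at_comb k 0 h h; rewrite mul0r addr0; congr (deriv_at _ _ _).
by apply/funext => y; rewrite mul0r addr0.
Qed.

Lemma deriv_at_derive1 (F : R -> R) (x d : R) : deriv_at F x d ->
  derivable F x 1 /\ derive1 F x = d.
Proof. by move=> /deriv_at_is_derive[dF Fd]; rewrite derive1E. Qed.

Definition locally_bounded (X : R -> R) := forall D, exists2 K, 0 <= K &
  forall x, 0 <= x <= D -> `|X x| <= K.

Section tensor.
Variables X dX : R -> R.
Hypothesis hX : forall x, deriv_at X x (dX x).
Hypothesis cdX : continuous dX.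
Hypothesis X0 : X 0 = 0.
Hypothesis bX : locally_bounded X.
Hypothesis bdX : locally_bounded dX.

Let cX : continuous X. Proof. by move=> x; exact: deriv_at_continuous. Qed.

Let T t : R := \int[mu]_x (zt t x * X x).
Let B t : R := \int[mu]_x (zx t x * dX x).

Let T_cont : continuous T.
Proof. exact: (L2_curve_pairing_cont zt_L2_curve (continuous_measurable cX) bX). Qed.

Let B_cont : continuous B.
Proof. exact: (L2_curve_pairing_cont zx_L2_curve (continuous_measurable cdX) bdX). Qed.

(** For a test [th t * X x] the weak form says that the integral of [T * th' - B * th] is 0, that is
    [T' = - B] in the sense of distributions, and [T] is continuous. The kernel [X] vanishes at 0
    but is free at [ell t]: this is where the boundary condition enters. *)
Lemma weak_tensor (a b : R) : 0 < a -> a < b -> T b - T a = - \int[mu]_(t in `[a, b]) B t.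
Proof.
move=> a0 ab.
have IB : Rintegrable `[a, b + 1] B by apply: continuous_Rintegrable => t _; exact: B_cont.
have INB : Rintegrable `[a, b + 1] (fun t => - B t).
  by apply: continuous_Rintegrable => t _; apply: cvgN; exact: B_cont.
have bc : b < b + 1 by rewrite ltrDl.
rewrite (@du_bois_reymond_lemma _ a b (b + 1) T (fun t => - B t))//; first 1 last.
- by move=> t _; exact: T_cont.
- move=> eps e0 be.
  (* A plateau rising after [a] and falling after [b]; it vanishes outside [[a, b + 1]] because
     [b + eps <= b + 1]. *)
  pose th t := step a eps t - step b eps t.
  pose dth t := dstep a eps t - dstep b eps t.
  have [[_ cdth] _] := C1_comb (fun y => step_deriv a y e0) (fun y => step_deriv b y e0)
    (dstep_continuous (eps := eps)) (dstep_continuous (eps := eps)).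
  have hth t : deriv_at th t (dth t).
    have := deriv_at_comb 1 (-1) (step_deriv a t e0) (step_deriv b t e0).
    rewrite !mul1r !mulN1r; congr (deriv_at _ _ _); apply/funext => y.
    by rewrite mul1r mulN1r.
  have cth : continuous th by move=> t; exact: deriv_at_continuous.
  have cdth' : continuous dth by move=> t; apply: cvgB; exact: dstep_continuous.
  have th0 t : ~~ (a <= t <= b + 1) -> th t = 0.
    rewrite negb_and -!ltNge /th => /orP[h|h]; first by rewrite !step_le ?subrr//; lra.
    by rewrite !step_ge ?subrr//; lra.
  have dth0 t : ~~ (a <= t <= b + 1) -> dth t = 0.
    move=> h; rewrite /dth !dstep_eq0 ?subrr//; apply: contra h => /andP[h1 h2]; lra.
  pose psi x t := th t * X x.
  have d1 x t : deriv_at (psi^~ t) x (th t * dX x) by exact: deriv_atZ.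
  have d2 x t : deriv_at (psi x) t (dth t * X x).
    rewrite mulrC; have := deriv_atZ (X x) (hth t); congr (deriv_at _ _ _).
    by apply/funext => y; rewrite /psi mulrC.
  have e1 x t : derive1 (psi^~ t) x = th t * dX x by case: (deriv_at_derive1 (d1 x t)).
  have e2 x t : derive1 (psi x) t = dth t * X x by case: (deriv_at_derive1 (d2 x t)).
  have tf : test_function psi.
    split.
    + move=> x t; split; first by case: (deriv_at_derive1 (d1 x t)).
      by case: (deriv_at_derive1 (d2 x t)).
    + rewrite (_ : (fun p => _) = (fun p : R * R => th p.2 * dX p.1)).
        move=> p; apply: cvgM.
          by apply: (@continuous_comp _ _ _ (@snd R R) th); [exact: cvg_snd|exact: cth].
        by apply: (@continuous_comp _ _ _ (@fst R R) dX); [exact: cvg_fst|exact: cdX].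
      by apply/funext => p; rewrite e1.
    + rewrite (_ : (fun p => _) = (fun p : R * R => dth p.2 * X p.1)).
        move=> p; apply: cvgM.
          by apply: (@continuous_comp _ _ _ (@snd R R) dth); [exact: cvg_snd|exact: cdth'].
        by apply: (@continuous_comp _ _ _ (@fst R R) X); [exact: cvg_fst|exact: cX].
      by apply/funext => p; rewrite e2.
    + by move=> t; rewrite /psi X0 mulr0.
    + exists a, (b + 1); split => // x t; rewrite in_itv/= /psi => h.
      by rewrite th0// mul0r.
  have := uw tf.
  have Et t : 0 < t -> \int[mu]_(x in `]0%R,
    ell t[) (ut x t * derive1 (psi x) t - ux x t * derive1 (psi^~ t) x)
     = T t * dth t + - B t * th t.
    move=> t0; rewrite [LHS]Rintegral_mkcond.
    rewrite mulNr mulrC [B t * _]mulrC -RintZ//; last first.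
      exact: (L2_curve_pairing_Rintegrable zt_L2_curve _ (continuous_measurable cX) bX).
    rewrite -RintZ//; last exact: (L2_curve_pairing_Rintegrable zx_L2_curve _
      (continuous_measurable cdX) bdX).
    rewrite -RintB//; last 2 first.
    + by apply: RintegrableZ => //;
        exact: (L2_curve_pairing_Rintegrable zt_L2_curve _ (continuous_measurable cX) bX).
    + by apply: RintegrableZ => //;
        exact: (L2_curve_pairing_Rintegrable zx_L2_curve _ (continuous_measurable cdX) bdX).
    apply: Rint_eq => x _; rewrite patchE mem_setE in_itv/= (e1 x t) (e2 x t).
    have [h|h] := boolP (0 < x < ell t).
      by rewrite !sliceE ?ltW//; ring.
    by rewrite !slice0 ?ltW// !mul0r !mulr0 subrr.
  rewrite (@Rint_eq _ _ _ (fun t => T t * dth t + - B t * th t)); last first.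
    by move=> t; rewrite /= in_itv/= andbT => /Et.
  rewrite (@Rint_support _ _ `[a, b + 1]).
  - by move=> ->.
  - by move=> t /=; rewrite !in_itv/= andbT => /andP[h1 h2]; lra.
  - by move=> t _; rewrite /= in_itv/= => /negP h; rewrite th0// dth0// !mulr0 addr0.
rewrite -[RHS]mulN1r -RintZ//.
  by apply: Rint_eq => t _; rewrite mulN1r.
by apply: continuous_Rintegrable => t _; exact: B_cont.
Qed.

End tensor.

Lemma ramp_locally_bounded (y eps : R) : 0 < eps -> locally_bounded (ramp y eps).
Proof.
move=> e0 D; exists (`|D| + `|y| + eps); first by rewrite !addr_ge0// ltW.
move=> x h; rewrite -(subrK (Num.min x y) (ramp y eps x)) addrC.
apply: le_trans (ler_normD _ _) _; rewrite lerD ?ramp_bound//.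
by apply: le_trans (min_norm_le y h) _; rewrite lerD2r ler_norm.
Qed.

Lemma dramp_locally_bounded (y eps : R) : 0 < eps -> locally_bounded (dramp y eps).
Proof.
move=> e0 D; exists 1 => // x _; rewrite ler_norml.
have := dramp_bound y x e0; lra.
Qed.

Lemma moment_ramp (y eps t : R) : 0 < eps ->
  `|(\int[mu]_x (zt t x * ramp y eps x)) - moment (zt t) y| <=
  eps * Num.sqrt (ell 0 + `|t|) * Num.sqrt (sqnorm (zt t)).
Proof.
move=> e0; have cr : continuous (ramp y eps).
  by move=> x; apply: deriv_at_continuous; exact: ramp_deriv.
rewrite /moment -RintB//; last 2 first.
- exact: (L2_curve_pairing_Rintegrable zt_L2_curve _ (continuous_measurable cr)
    (ramp_locally_bounded y e0)).
- exact: (L2_curve_pairing_Rintegrable zt_L2_curve _ (min_meas y) (min_locally_bounded y)).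
have -> : \int[mu]_x (zt t x * ramp y eps x - zt t x * Num.min x y) =
  \int[mu]_x (zt t x * (ramp y eps x - Num.min x y)).
  by apply: Rint_eq => x _; rewrite -mulrBr.
have D0 : 0 <= ell 0 + `|t| by rewrite addr_ge0// ltW// ell_gt0.
apply: le_trans (@pairing_le _ _ _ eps 0 _ (L2_curve_sqintegrable zt_L2_curve t) _ D0 (ltW e0)
  _ _) _.
- by apply: measurable_funB; [exact: continuous_measurable|exact: min_meas].
- by move=> x _; exact: ramp_bound.
- move=> x h; rewrite (L2_curve_supp zt_L2_curve) ?mul0r//.
  by apply: contra h => /andP[h1 h2]; rewrite !ltW.
by rewrite subr0.
Qed.

Lemma prim_dramp (y eps t : R) : 0 <= y -> 0 < eps ->
  `|(\int[mu]_x (zx t x * dramp y eps x)) - prim (zx t) y| <=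
  Num.sqrt eps * Num.sqrt (sqnorm (zx t)).
Proof.
move=> y0 e0; rewrite /prim -RintB//; last 2 first.
- exact: (L2_curve_pairing_Rintegrable zx_L2_curve _ (continuous_measurable (@dramp_continuous
    _ y eps)) (dramp_locally_bounded y e0)).
- by apply: Rintegrable_indicM => //; exact: L2_curve_Rintegrable zx_L2_curve _.
have -> : \int[mu]_x (zx t x * dramp y eps x - zx t x * \1_`[0, y] x) =
  \int[mu]_x (zx t x * (dramp y eps x - \1_`[0, y] x)).
  by apply: Rint_eq => x _; rewrite -mulrBr.
have yy : y <= y + eps by rewrite lerDl ltW.
apply: le_trans (@pairing_le _ _ _ 1 y (y + eps) (L2_curve_sqintegrable zx_L2_curve t) _ yy
  ler01 _ _) _.
- apply: measurable_funB; [by apply: continuous_measurable;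
    exact: dramp_continuous|exact: measurable_indic].
- move=> x _; have /andP[d0 d1] := dramp_bound y x e0.
  rewrite indicE ler_norml; case: (_ \in _) => /=; apply/andP; split; lra.
- move=> x; rewrite negb_and -!ltNge => hx.
  have [x0|x0] := leP x 0; first by rewrite (L2_curve_supp zx_L2_curve) ?mul0r// ltNge x0.
  rewrite indicE mem_setE in_itv/= (ltW x0)/=.
  case/orP: hx => hx; first by rewrite dramp_le ?(ltW hx)// subrr mulr0.
  by rewrite dramp_ge ?(ltW hx)// leNgt (le_lt_trans yy hx) subrr mulr0.
by rewrite mul1r addrC addKr.
Qed.

(** The tensor identity is available only for the regularized kernels, integrated over [[a, b]]. The
    regularization is chosen after [a] and [b], so that its error is small compared with [b - a]. *)
Lemma moment_time_estimate (y t e : R) : 0 <= y -> 0 < t -> 0 < e ->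
  exists2 r, 0 < r & forall a b, `|a - t| < r -> `|b - t| < r -> a < b ->
    `|moment (zt b) y - moment (zt a) y + prim (zx t) y * (b - a)| <= e * (b - a).
Proof.
move=> y0 t0 e0.
have [N [r1 [r10 N0 hN]]] := L2_curve_norm_bounded zx_L2_curve t.
have [M [r2 [r20 M0 hM]]] := L2_curve_norm_bounded zt_L2_curve t.
have e20 : 0 < e / 2 by rewrite divr_gt0.
have [r3 r30 hP] := @prim_jointly_continuous _ _ _ zx_L2_curve y t _ e20.
exists (Num.min (Num.min r1 r2) (Num.min r3 (Num.min 1 t))).
  by rewrite !lt_min r10 r20 r30 ltr01 t0.
move=> a b; rewrite !lt_min => /and3P[/andP[a1 a2] a3 /andP[a4 a5]] /and3P[/andP[b1 b2] b3
  /andP[b4 b5]] ab.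
have a0 : 0 < a by move: a5; rewrite ltr_norml => /andP[]; lra.
pose D := ell 0 + t + 1.
have D0 : 0 <= D by rewrite /D !addr_ge0// ltW// ell_gt0.
have ba0 : 0 < b - a by rewrite subr_gt0.
(* The first bound keeps the error on [zx] below [e / 4], the second keeps the error on [zt] below
   [e * (b - a) / 8] at each of the two times. With [e / 2] for the continuity of [prim], the total
   is [(1/8 + 1/8 + 1/4 + 1/2) * e * (b - a)]. *)
pose eps := Num.min ((e / 4 / (N + 1)) ^+ 2) (e * (b - a) / 8 / (Num.sqrt D * M + 1)).
have N10 : 0 < N + 1 by lra.
have SM0 : 0 <= Num.sqrt D * M by rewrite mulr_ge0// sqrtr_ge0.
have SM10 : 0 < Num.sqrt D * M + 1 by lra.
have eps0 : 0 < eps.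
  by rewrite lt_min exprn_gt0 ?divr_gt0//= !mulr_gt0// invr_gt0.
have epsN : Num.sqrt eps * N <= e / 4.
  apply: (@le_trans _ _ (e / 4 / (N + 1) * N)).
    rewrite ler_wpM2r//.
    have -> : e / 4 / (N + 1) = Num.sqrt ((e / 4 / (N + 1)) ^+ 2).
      by rewrite sqrtr_sqr gtr0_norm// !divr_gt0.
    by apply: ler_wsqrtr; rewrite ge_min lexx.
  rewrite mulrAC ler_pdivrMr// ler_pM2l ?divr_gt0//; lra.
have epsM : eps * Num.sqrt D * M <= e * (b - a) / 8.
  rewrite -mulrA; apply: (@le_trans _ _ (e * (b - a) / 8 / (Num.sqrt D * M + 1) * (Num.sqrt D *
    M))).
    by rewrite ler_wpM2r// ge_min lexx orbT.
  by rewrite mulrAC ler_pdivrMr// ler_pM2l ?divr_gt0 ?mulr_gt0//; lra.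
have hA s : `|s - t| < r2 -> `|s - t| < 1 ->
    `|(\int[mu]_x (zt s x * ramp y eps x)) - moment (zt s) y| <= e * (b - a) / 8.
  move=> s2 s1; apply: le_trans (moment_ramp _ _ eps0) _; apply: le_trans epsM.
  rewrite -!mulrA ler_pM2l// ler_pM ?sqrtr_ge0 ?hM//.
  apply: ler_wsqrtr; rewrite /D -addrA lerD2l.
  move: s1; rewrite ltr_norml => /andP[h1 h2]; rewrite ler_norml; lra.
pose B s := \int[mu]_x (zx s x * dramp y eps x).
have Bc : continuous B.
  exact: (L2_curve_pairing_cont zx_L2_curve (continuous_measurable (@dramp_continuous _ y eps))
    (dramp_locally_bounded y eps0)).
have hB s : a <= s <= b -> `|B s - prim (zx t) y| <= e / 4 + e / 2.
  move=> /andP[as_ sb].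
  have st r : `|a - t| < r -> `|b - t| < r -> `|s - t| < r.
    rewrite !ltr_norml => /andP[h1 h2] /andP[h3 h4].
    by clear -as_ sb h1 h2 h3 h4; apply/andP; split; lra.
  rewrite -(subrK (prim (zx s) y) (B s)) -addrA; apply: le_trans (ler_normD _ _) _.
  rewrite lerD//.
    apply: le_trans (prim_dramp _ y0 eps0) _; apply: le_trans epsN.
    by rewrite ler_wpM2l ?sqrtr_ge0// hN// st.
  by apply: hP; rewrite ?subrr ?normr0// st.
have := weak_tensor (fun x => ramp_deriv y x eps0) (@dramp_continuous _ y eps) (ramp0 eps0 y0)
  (ramp_locally_bounded y eps0) (dramp_locally_bounded y eps0) a0 ab.
rewrite -/B => E.
have IB : Rintegrable `[a, b] B by apply: continuous_Rintegrable => s _; exact: Bc.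
have Icst k : Rintegrable `[a, b] (fun=> k) by apply: continuous_Rintegrable => s _;
  exact: cvg_cst.
have Rcst k : \int[mu]_(s in `[a, b]) k = k * (b - a).
  by rewrite Rintegral_cst//= lebesgue_measure_itv/= lte_fin ab.
have hI : `|(\int[mu]_(s in `[a,
  b]) B s) - prim (zx t) y * (b - a)| <= (e / 4 + e / 2) * (b - a).
  rewrite -!Rcst -RintB//; apply: Rint_norm_le => //.
  by apply: Rintegrable_measurable; exact: RintegrableB.
have ha := hA a a2 a4; have hb := hA b b2 b4.
move: ha hb hI E; rewrite !ler_norml.
set Ia := \int[mu]_x (zt a x * _); set Ib := \int[mu]_x (zt b x * _).
set J := \int[mu]_(s in `[a, b]) B s; set Ma := moment _ _; set Mb := moment _ _.
set p := prim _ _ * _.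
move=> /andP[h1 h2] /andP[h3 h4] /andP[h5 h6] h7; clearbody Ia Ib J Ma Mb p.
by clear -h1 h2 h3 h4 h5 h6 h7; apply/andP; split; lra.
Qed.

Lemma moment_time (y t : R) : 0 <= y -> 0 < t ->
  deriv_at (fun s => moment (zt s) y) t (- prim (zx t) y).
Proof.
move=> y0 t0 e e0; have [r r0 hr] := moment_time_estimate y0 t0 e0.
exists r => // s st; have tt : `|t - t| < r by rewrite subrr normr0.
rewrite mulNr opprK.
have [ts|st'|<-] := ltgtP t s; last by rewrite !subrr mulr0 addr0 normr0 mulr0.
  have -> : `|s - t| = s - t by rewrite gtr0_norm// subr_gt0.
  exact: hr.
have -> : `|s - t| = t - s by rewrite ltr0_norm ?subr_lt0// opprB.
have := hr _ _ st tt st'; rewrite -normrN; congr (`|_| <= _); ring.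
Qed.

Lemma prim_deriv (g : R -> R) (y : R) : continuous g -> 0 < y -> deriv_at (prim g) y (g y).
Proof.
move=> cg y0; have yy : y < y + 1 by rewrite ltrDl.
have Ig : Rintegrable `[0, y + 1] g by apply: continuous_Rintegrable => x _; exact: cg.
have [dF dFy] := continuous_FTC1_closed yy Ig y0 (cg y).
have -> : prim g = (fun x => \int[mu]_(t in `[0, x]) g t) by apply/funext => x; rewrite primE.
exact: derivable_estimate.
Qed.

(** The continuous representative of [u], extended by 0 on the left of 0 and by its boundary value
    on the right of [ell t]; it is jointly continuous on the whole plane. *)
Definition displacement y t := prim (zx t) y.

Lemma displacement_continuous t : continuous (displacement^~ t).
Proof. by move=> y; apply: jointly_continuous_space;
  exact: prim_jointly_continuous zx_L2_curve _ _. Qed.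

Lemma u_displacement t x : 0 <= t -> 0 < x < ell t -> u x t = displacement x t.
Proof.
move=> t0 hx; case: uV0 => /(_ t t0) h _ _.
rewrite (weak_deriv_prim (ell_gt0 t0) h hx) /displacement /slice.
by rewrite pospart_id.
Qed.

(** Integration over [[0, y]] turns the L^2 derivative of [u] into an ordinary one. The difference
    quotient is controlled only up to [min (ell t) (ell s)], so [|s - t| < ell t - y] is imposed to
    keep [y] below [ell s]. *)
Lemma prim_displacement_time (y t : R) : 0 < t -> 0 < y < ell t ->
  deriv_at (fun s => prim (displacement^~ s) y) t (prim (zt t) y).
Proof.
move=> t0 /andP[y0 yl] e e0.
pose k := e / (Num.sqrt y + 1).
have S0 : 0 < Num.sqrt y + 1 by rewrite ltr_wpDl// sqrtr_ge0.
have k0 : 0 < k by rewrite divr_gt0.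
have [_ td _] := uC1.
have := ereal_cvg0_lt _ (td t (ltW t0)) k0.
move=> /(_ _)/nbhs_ballP[r /= r0 hr].
exists (Num.min r (Num.min t (ell t - y))).
  by rewrite !lt_min r0 t0 subr_gt0.
move=> s; rewrite !lt_min => /and3P[sr st syl].
have [->|sneq] := eqVneq s t; first by rewrite !subrr mulr0 subr0 normr0 mulr0.
have s0 : 0 < s by move: st; rewrite ltr_norml => /andP[]; lra.
have ysl : y < ell s.
  have lip : `|ell s - ell t| < `|s - t|.
    have [h|h|h] := ltgtP s t.
    + by rewrite distrC [X in _ < X]distrC (@gtr0_norm _ (t - s)) ?subr_gt0// ell_lip// ltW.
    + by rewrite (@gtr0_norm _ (s - t)) ?subr_gt0// ell_lip// ltW.
    + by rewrite h eqxx in sneq.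
  by move: lip; rewrite ltr_norml => /andP[]; lra.
have stn0 : s - t != 0 by rewrite subr_eq0.
pose Ds := zero_ext (Num.min (ell t) (ell s)) (fun x => (u x s - u x t) / (s - t) - ut x t).
have cu : L2_curve (ell 0) (slice ell u) by apply: slice_L2_curve => //; case: uV0.
have sD : sqintegrable Ds.
  pose a := Num.min (ell t) (ell s).
  have h1 := sqintegrable_comb (s - t)^-1 (- (s - t)^-1) (L2_curve_sqintegrable cu s)
    (L2_curve_sqintegrable cu t).
  have h2 := sqintegrableB h1 (L2_curve_sqintegrable zt_L2_curve t).
  have := @sqintegrable_restrict _ `]0, a[ _ _ h2; move=> /(_ (measurable_itv _)).
  apply: eq_sqintegrable => x; rewrite /Ds /zero_ext !patchE mem_setE in_itv/= /a lt_min.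
  case: ifP => // /and3P[x0 xt xs].
  by rewrite !sliceE ?x0 ?xt ?xs ?ltW//; ring.
have hD : Num.sqrt (sqnorm Ds) <= k.
  have := hr s; rewrite /ball/= distrC => /(_ sr sneq).
  rewrite in_itv/= (ltW s0) => /(_ isT).
  by rewrite -/Ds L2norm_sqnorm// lte_fin => /ltW.
have Dx x : 0 <= x <= y -> Ds x = (s - t)^-1 * (displacement x s - displacement x t) - zt t x.
  rewrite le_eqVlt => /andP[/predU1P[<-|x0] xy].
    rewrite /Ds /zero_ext patchE mem_setE in_itv/= ltxx/= /displacement !prim_le0//.
    by rewrite subrr mulr0 slice0 ?ltxx ?subrr// ltW.
  have xt := le_lt_trans xy yl; have xs := le_lt_trans xy ysl.
  rewrite /Ds /zero_ext patchE mem_setE in_itv/= x0 lt_min xt xs/=.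
  by rewrite !u_displacement ?x0 ?xt ?xs ?ltW// sliceE ?x0 ?xt ?ltW// mulrC.
have ID : \int[mu]_x (Ds x * \1_`[0, y] x) =
    (s - t)^-1 * (prim (displacement^~ s) y - prim (displacement^~ t) y) - prim (zt t) y.
  have Ip s' : Rintegrable `[0, y] (displacement^~ s').
    by apply: continuous_Rintegrable => x _; exact: displacement_continuous.
  have Iz : Rintegrable `[0, y] (zt t).
    by apply: RintegrableS (L2_curve_Rintegrable zt_L2_curve t).
  rewrite -/(prim Ds y) !primE -RintB// -RintZ//; last exact: RintegrableB.
  rewrite -RintB//; last by apply: RintegrableZ => //; exact: RintegrableB.
  by apply: Rint_eq => x; rewrite /= in_itv/= => /Dx.
have : `|\int[mu]_x (Ds x * \1_`[0, y] x)| <= e.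
  apply: le_trans (@pairing_le _ _ _ 1 0 y sD (@meas_indic_itv _ _ _) (ltW y0) ler01 _ _) _.
  - by move=> x _; rewrite indicE normr_nat; case: (_ \in _).
  - by move=> x h; rewrite indicE mem_setE in_itv/= (negbTE h) mulr0.
  rewrite mul1r subr0; apply: (@le_trans _ _ (Num.sqrt y * k)).
    by rewrite ler_wpM2l// sqrtr_ge0.
  by rewrite /k mulrA ler_pdivrMr// mulrC ler_pM2l// lerDl.
rewrite ID => h.
have -> : prim (displacement^~ s) y - prim (displacement^~ t) y - prim (zt t) y * (s - t) =
  ((s - t)^-1 * (prim (displacement^~ s) y - prim (displacement^~ t) y) - prim (zt t) y) * (s -
    t).
  by rewrite mulrBl mulrAC mulVf// mul1r.
by rewrite normrM ler_wpM2r.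
Qed.

End weak_form.

(** * Transport along characteristics *)

Section transport.
Variable R : realType.
Implicit Types (F w : R -> R -> R).

Lemma mvt_estimate (F d : R -> R) (a b d0 e : R) :
  (forall x, Num.min a b <= x <= Num.max a b -> deriv_at F x (d x) /\ `|d x - d0| <= e) ->
  `|F b - F a - d0 * (b - a)| <= e * `|b - a|.
Proof.
wlog ab : a b / a < b => [H h|h].
  have [ab|ba|->] := ltgtP a b; [exact: H| |by rewrite !subrr mulr0 subr0 normr0 mulr0].
  have -> : F b - F a - d0 * (b - a) = - (F a - F b - d0 * (a - b)) by ring.
  by rewrite normrN (distrC b a); apply: H => //; rewrite minC maxC.
have hx x : x \in `[a, b] -> deriv_at F x (d x) /\ `|d x - d0| <= e.
  by rewrite in_itv/= => /andP[h1 h2]; apply: h;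
    rewrite (min_idPl (ltW ab)) (max_idPr (ltW ab)) h1.
have [c cab ->] := @MVT_segment _ F d a b (ltW ab)
  (fun x (hx' : x \in `]a, b[) => deriv_at_is_derive (proj1 (hx x (subset_itv_oo_cc hx'))))
  (continuous_at_within (fun x hx' => deriv_at_continuous (proj1 (hx x hx')))).
rewrite -mulrBl normrM ler_wpM2r//.
by case: (hx c cab).
Qed.

(** No differentiability in the plane is at hand for a chain rule. The increment is split into a
    space increment at time [t0 + sg * d], estimated by the mean value theorem and the joint
    continuity of [w], and a time increment at [y0]. The linear terms cancel since [sg ^+ 2 = 1]. *)
Lemma transport_deriv F w (sg y0 t0 : R) : sg ^+ 2 = 1 -> `|sg| = 1 ->
  (exists2 r, 0 < r & forall y s, `|y - y0| < r -> `|s - t0| < r ->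
    deriv_at (F^~ s) y (w y s)) ->
  deriv_at (F y0) t0 (sg * w y0 t0) -> jointly_continuous w y0 t0 ->
  deriv_at (fun d => F (y0 - d) (t0 + sg * d)) 0 0.
Proof.
move=> sg2 sg1 [r r0 hy] ht jw e e0; have e20 : 0 < e / 2 by rewrite divr_gt0.
have [r1 r10 h1] := jw _ e20; have [r2 r20 h2] := ht _ e20.
exists (Num.min r (Num.min r1 r2)) => [|d]; first by rewrite !lt_min r0 r10 r20.
rewrite subr0 !lt_min => /and3P[dr dr1 dr2]; rewrite subr0 mulr0 addr0 mul0r subr0.
pose s := t0 + sg * d.
have st : `|s - t0| = `|d| by rewrite /s addrC addKr normrM sg1 mul1r.
have E1 : `|F (y0 - d) s - F y0 s - w y0 t0 * (y0 - d - y0)| <= e / 2 * `|d|.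
  have -> : `|d| = `|y0 - d - y0| by rewrite addrAC subrr sub0r normrN.
  apply: (@mvt_estimate (F^~ s) (w^~ s)) => x hx.
  have xd : `|x - y0| <= `|d|.
    move: hx; have [d0|d0] := leP 0 d.
      rewrite min_r ?max_l; [|lra..] => /andP[? ?]; rewrite (ger0_norm d0) ler_norml.
      by apply/andP; split; lra.
    rewrite min_l ?max_r; [|lra..] => /andP[? ?]; rewrite (ltr0_norm d0) ler_norml.
    by apply/andP; split; lra.
  by split; [apply: hy|apply: h1]; rewrite ?st ?(le_lt_trans xd).
have E2 : `|F y0 s - F y0 t0 - sg * w y0 t0 * (s - t0)| <= e / 2 * `|d|.
  by rewrite -st; apply: h2; rewrite st.
have -> : F (y0 - d) s - F y0 t0 = (F (y0 - d) s - F y0 s - w y0 t0 * (y0 - d - y0)) +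
   (F y0 s - F y0 t0 - sg * w y0 t0 * (s - t0)) + (sg ^+ 2 - 1) * w y0 t0 * d.
  by rewrite /s; ring.
rewrite sg2 subrr !mul0r addr0; apply: le_trans (ler_normD _ _) _.
by rewrite [e in leRHS]splitr mulrDl lerD.
Qed.

Lemma deriv_at_shift (F : R -> R) (x c d : R) : deriv_at F (x + c) d ->
  deriv_at (fun y => F (y + c)) x d.
Proof.
move=> h e /h[r r0 hr]; exists r => // y hy.
have E : y - x = y + c - (x + c) by ring.
by rewrite E; apply: hr; rewrite -E.
Qed.

(* Here w = F_y and F_t = sg * F_y. *)
Lemma transport_const F w (sg y t h : R) : sg ^+ 2 = 1 -> `|sg| = 1 -> 0 <= h ->
  (forall k, 0 <= k -> k <= h -> exists2 r, 0 < r &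
    forall y0 t0, `|y0 - (y - k)| < r -> `|t0 - (t + sg * k)| < r ->
      [/\ deriv_at (F^~ t0) y0 (w y0 t0),
        deriv_at (F y0) t0 (sg * w y0 t0) & jointly_continuous w y0 t0]) ->
  F y t = F (y - h) (t + sg * h).
Proof.
move=> sg2 sg1 h0 H.
have dK k : 0 <= k -> k <= h -> deriv_at (fun k => F (y - k) (t + sg * k)) k 0.
  move=> k0 kh; have [r r0 hr] := H k k0 kh.
  have hk : `|y - k - (y - k)| < r by rewrite subrr normr0.
  have hk' : `|t + sg * k - (t + sg * k)| < r by rewrite subrr normr0.
  have [_ h2 h3] := hr _ _ hk hk'.
  have h1 : exists2 r, 0 < r & forall y0 s, `|y0 - (y - k)| < r -> `|s - (t + sg * k)| < r ->
     deriv_at (F^~ s) y0 (w y0 s).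
    by exists r => // y0 s hy hs; have [] := hr _ _ hy hs.
  have /= D := transport_deriv sg2 sg1 h1 h2 h3.
  have := @deriv_at_shift _ k (- k) 0; rewrite subrr => /(_ _ D).
  congr (deriv_at _ _ _); apply/funext => k'.
  by congr (F _ _); ring.
have := @deriv_at0_cst _ (fun k => F (y - k) (t + sg * k)) 0 h h0.
rewrite subr0 mulr0 addr0; apply.
- by apply: continuous_at_within => k /andP[h1 h2]; apply: deriv_at_continuous; exact: dK.
- by move=> k h1 h2; apply: dK; exact: ltW.
Qed.

End transport.

(** * Riemann invariants and their potentials *)

Section characteristics.
Variable R : realType.
Local Notation mu := (@lebesgue_measure R).
Variable ell : R -> R.
Hypothesis ell_gt0 : forall t : R, 0 <= t -> 0 < ell t.
Hypothesis ell_lip : forall s t : R, 0 <= s -> s < t -> `|ell t - ell s| < t - s.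
Variables u ux ut : R -> R -> R.
Hypothesis uV0 : continuous_V0 ell u ux.
Hypothesis uC1 : C1_L2 ell u ut.
Hypothesis uw : weak_wave ell ux ut.
Local Notation zx := (slice ell ux).
Local Notation zt := (slice ell ut).
Let cx := zx_L2_curve ell_gt0 ell_lip uV0.
Let ct := zt_L2_curve ell_gt0 ell_lip uC1.
Local Notation P := (displacement ell ux).

Definition flux t : R := mass (zt t).
(* The conjugate function: v_x = u_t, v_t = u_x and v = 0 on the moving boundary. *)
Definition conjugate y t : R := prim (zt t) y - flux t.

Lemma flux_continuous : continuous flux.
Proof.
have -> : flux = (fun t => \int[mu]_x (zt t x * (fun=> 1) x)).
  by apply/funext => t; apply: Rint_eq => x _; rewrite mulr1.
apply: (L2_curve_pairing_cont ct); first exact: continuous_measurable (@cst_continuous _ _ _).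
by move=> D; exists 1 => // x _; rewrite normr1.
Qed.

Lemma jointly_continuous_time (k : R -> R) y t : continuous k ->
  jointly_continuous (fun _ t => k t) y t.
Proof.
move=> ck e e0; have /cvgrPdist_le/(_ _ e0)/nbhs_ballP[r /= r0 hr] := ck t.
exists r => // _ s _ st; rewrite distrC; apply: hr.
by rewrite /ball/= distrC.
Qed.

Lemma jointly_continuous_comb (w1 w2 : R -> R -> R) (k y t : R) : jointly_continuous w1 y t ->
  jointly_continuous w2 y t ->
  jointly_continuous (fun y t => w1 y t + k * w2 y t) y t.
Proof.
move=> h1 h2 e e0; have e20 : 0 < e / 2 by rewrite divr_gt0.
have k0 : 0 < `|k| + 1 by rewrite ltr_wpDl.
have [r r0 hr] := h1 _ e20; have [s s0 hs] := h2 _ (divr_gt0 e20 k0).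
exists (Num.min r s) => [|y' t']; first by rewrite lt_min r0.
rewrite !lt_min => /andP[yr ys] /andP[tr ts].
have -> : w1 y' t' + k * w2 y' t' - (w1 y t + k * w2 y t) = (w1 y' t' - w1 y t) + k * (w2 y' t'
  - w2 y t) by ring.
apply: le_trans (ler_normD _ _) _; rewrite [e]splitr lerD ?hr// normrM.
apply: (@le_trans _ _ (`|k| * (e / 2 / (`|k| + 1)))); first by rewrite ler_wpM2l// hs.
rewrite mulrA ler_pdivrMr// mulrC ler_pM2l//; lra.
Qed.

(** In the domain this will be [2 * f (t + y)] for [sg = 1] and [2 * f (t - y)] for [sg = -1]. *)
Definition riemann_invariant (sg y t : R) : R := conjugate y t + sg * P y t.

Lemma riemann_invariant_continuous sg y t : jointly_continuous (riemann_invariant sg) y t.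
Proof.
apply: jointly_continuous_comb; last exact: prim_jointly_continuous cx _ _.
have := @jointly_continuous_comb (fun y t => prim (zt t) y) (fun _ t => flux t) (-1) y t.
move=> /(_ (@prim_jointly_continuous _ _ _ ct _ _) (jointly_continuous_time _ _
  flux_continuous)).
by congr (jointly_continuous _ _ _); apply/funext => y'; apply/funext => t'; rewrite mulN1r.
Qed.

(** A space primitive of [v + sg * u]. The integral of [u] over [[0, y]] has time derivative
    [v + flux]; the time primitive of [- flux] removes the second term. The time derivative is then
    [u + sg * v], which is [sg] times the space derivative. *)
Definition potential (sg y t : R) : R :=
  - moment (zt t) y + sg * (prim (P^~ t) y + prim (fun s => - flux s) t).

Lemma potential_space (sg y t : R) : 0 < y ->
  deriv_at ((potential sg)^~ t) y (riemann_invariant sg y t).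
Proof.
move=> y0; have h1 := moment_deriv ct t y.
have h2 := prim_deriv (displacement_continuous ell_gt0 ell_lip uV0 (t := t)) y0.
have h3 : deriv_at (fun y => prim (P^~ t) y + prim (fun s => - flux s) t) y (P y t).
  move=> e /h2[r r0 hr]; exists r => // y' /hr.
  by congr (`|_| <= _); ring.
have := deriv_at_comb (-1) sg h1 h3.
rewrite /riemann_invariant /conjugate mulN1r opprB; congr (deriv_at _ _ _).
by apply/funext => y'; rewrite mulN1r.
Qed.

Lemma potential_time (sg y t : R) : sg ^+ 2 = 1 -> 0 < t -> 0 < y < ell t ->
  deriv_at (potential sg y) t (sg * riemann_invariant sg y t).
Proof.
move=> sg2 t0 /[dup] hy /andP[y0 _].
have h1 := moment_time ell_gt0 ell_lip uV0 uC1 uw (ltW y0) t0.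
have h2 := prim_displacement_time ell_gt0 ell_lip uV0 uC1 t0 hy.
have cN : continuous (fun s => - flux s).
  by move=> s; apply: cvgN; exact: flux_continuous.
have h3 := deriv_at_comb 1 1 h2 (prim_deriv cN t0).
have := deriv_at_comb (-1) sg h1 h3.
have -> : -1 * - prim (zx t) y + sg * (1 * prim (zt t) y + 1 * - flux t) = sg *
  riemann_invariant sg y t.
  have E (p q f : R) : sg * (q - f + sg * p) = sg * (q - f) + sg ^+ 2 * p by ring.
  by rewrite /riemann_invariant /conjugate /displacement E sg2; ring.
congr (deriv_at _ _ _); apply/funext => s.
by rewrite /potential mulN1r !mul1r.
Qed.

Lemma ell_forward t k : 0 <= t -> 0 <= t + k -> ell t - `|k| <= ell (t + k).
Proof.
move=> t0 tk; have [k0|k0|->] := ltgtP k 0; last by rewrite addr0 normr0 subr0.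
- have := ell_lip tk (_ : t + k < t); rewrite gtrDl => /(_ k0).
  by rewrite ltr_norml (ltr0_norm k0) => /andP[]; lra.
- have := ell_lip t0 (_ : t < t + k); rewrite ltrDl => /(_ k0).
  by rewrite ltr_norml (gtr0_norm k0) => /andP[]; lra.
Qed.

Lemma sign_cases (sg : R) : sg ^+ 2 = 1 -> sg = 1 \/ sg = -1.
Proof. by move=> /eqP; rewrite sqrf_eq1 => /orP[/eqP|/eqP]; [left|right]. Qed.

(** Moving towards [x = 0] at unit speed, forwards or backwards in time, a point stays in the domain
    because the boundary is slower. *)
Lemma potential_const (sg y t h : R) : sg ^+ 2 = 1 -> 0 < t -> 0 < y < ell t ->
  0 <= h -> h < y -> 0 < t + sg * h ->
  potential sg y t = potential sg (y - h) (t + sg * h).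
Proof.
move=> sg2 t0 /andP[y0 yl] h0 hy th.
have sg1 : `|sg| = 1 by case: (sign_cases sg2) => ->; rewrite ?normrN normr1.
apply: (@transport_const _ (potential sg) (riemann_invariant sg)) => // k k0 kh.
have tk : 0 < t + sg * k.
  case: (sign_cases sg2) th => -> th; first by rewrite mul1r; lra.
  by rewrite mulN1r; move: th; rewrite mulN1r; lra.
have yk : 0 < y - k by lra.
have lk : y - k < ell (t + sg * k).
  have := ell_forward (ltW t0) (ltW tk); rewrite normrM sg1 mul1r (ger0_norm k0); lra.
(* Half of the gap to the boundary is left for the displacement of [y'], the other half for the
   variation of [ell]. *)
pose d := Num.min (y - k) (Num.min (t + sg * k) ((ell (t + sg * k) - (y - k)) / 2)).
exists d; first by rewrite !lt_min yk tk divr_gt0// subr_gt0.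
move=> y' t'; rewrite !lt_min !ltr_norml => /and3P[/andP[a1 a2] _ /andP[a3 a4]] /and3P[_
  /andP[b1 b2] /andP[b3 b4]].
have y'0 : 0 < y' by lra.
have t'0 : 0 < t' by lra.
split; [exact: potential_space| |exact: riemann_invariant_continuous].
apply: potential_time => //; rewrite y'0/=.
have := @ell_forward (t + sg * k) (t' - (t + sg * k)) (ltW tk).
rewrite addrC subrK => /(_ (ltW t'0)).
have : `|t' - (t + sg * k)| <= (ell (t + sg * k) - (y - k)) / 2 by rewrite ler_norml;
  apply/andP; split; lra.
lra.
Qed.

(** The potential is constant along all nearby parallel segments with the same [h]; this identity is
    differentiated in [y]. *)
Lemma riemann_invariant_const_open (sg y t h : R) : sg ^+ 2 = 1 -> 0 < t -> 0 < y < ell t ->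
  0 <= h -> h < y -> 0 < t + sg * h ->
  riemann_invariant sg y t = riemann_invariant sg (y - h) (t + sg * h).
Proof.
move=> sg2 t0 /andP[y0 yl] h0 hy th.
have d1 := potential_space sg t y0.
have yh : 0 < y - h by lra.
have d2 := @deriv_at_shift _ _ y (- h) _ (potential_space sg (t + sg * h) yh).
apply: deriv_at_uniq d1 _; apply: deriv_at_near d2.
pose d := Num.min (y - h) (ell t - y).
apply/nbhs_ballP; exists d; first by rewrite /= lt_min yh subr_gt0.
move=> y'; rewrite /ball/= lt_min !ltr_norml => /andP[/andP[h1 h2] /andP[h3 h4]].
by rewrite -potential_const//; [apply/andP; split; lra|lra].
Qed.

Lemma riemann_invariant_const (sg y t h : R) : sg ^+ 2 = 1 -> 0 <= t -> y <= ell t ->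
  0 < h -> h <= y -> 0 <= t + sg * h ->
  riemann_invariant sg y t = riemann_invariant sg (y - h) (t + sg * h).
Proof.
move=> sg2 t0 yl h0 hy th.
apply/eqP; rewrite -subr_eq0 -normr_le0; apply/ler_addgt0Pr => e e0; rewrite add0r.
have e20 : 0 < e / 2 by rewrite divr_gt0.
have [r r0 h1] := @riemann_invariant_continuous sg y t _ e20.
have [s s0 h2] := @riemann_invariant_continuous sg (y - h) (t + sg * h) _ e20.
(* The segment is pushed into the open domain. Its start moves by [- 2 * d] in space and [d] in
   time, which outruns the boundary and makes both end times positive. Its length drops by [3 * d],
   so the other end lies at [y - h + d > 0]. No coordinate moves by more than [4 * d], whence the
   fifths. *)
pose d := Num.min (Num.min (r / 5) (s / 5)) (h / 5).
have d0 : 0 < d by rewrite !lt_min !divr_gt0.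
have dr : d <= r / 5 by rewrite !ge_min lexx.
have ds : d <= s / 5 by rewrite !ge_min lexx orbT.
have dh : d <= h / 5 by rewrite !ge_min lexx !orbT.
have E : riemann_invariant sg (y - 2 * d) (t + d) = riemann_invariant sg (y - 2 * d - (h - 3 *
  d)) (t + d + sg * (h - 3 * d)).
  apply: riemann_invariant_const_open => //; try lra.
  - have := ell_forward t0 (_ : 0 <= t + d); rewrite (gtr0_norm d0) => /(_ _) H.
    have := H ltac:(lra); lra.
  - by case: (sign_cases sg2) th => ->; lra.
have near1 : `|riemann_invariant sg (y - 2 * d) (t + d) - riemann_invariant sg y t| <= e / 2.
  by apply: h1; rewrite ltr_norml; lra.
have near2 : `|riemann_invariant sg (y - 2 * d) (t + d) - riemann_invariant sg (y - h) (t + sg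
  * h)| <= e / 2.
  rewrite E; apply: h2; rewrite ltr_norml; first by lra.
  by case: (sign_cases sg2) => ->; lra.
apply: le_trans (ler_distD (riemann_invariant sg (y - 2 * d) (t + d)) _ _) _.
by rewrite [e]splitr lerD// distrC.
Qed.

End characteristics.

(** * D'Alembert's formula *)

Section energy_congr.
Variable R : realType.

Lemma energy_congr (f f' phi : R -> R) (a b k S : R) :
  (forall x, a <= x <= b -> f' x = f x + k) -> is_energy f phi a b S -> is_energy f' phi a b S.
Proof.
move=> E; have h p n : subdiv a b p n -> rsum f phi p n = rsum f' phi p n.
  move=> sp; apply: eq_bigr => i _.
  rewrite !E ?(subdiv_in sp (ltnW (ltn_ord i)))//; last exact: subdiv_in sp (ltn_ord i).
  by congr (_ ^+ 2 / _); ring.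
by apply: energy_transfer => p n sp; exists p, n; split => //; rewrite h.
Qed.

End energy_congr.

Section dalembert.
Variable R : realType.
Local Notation mu := (@lebesgue_measure R).
Variable ell : R -> R.
Hypothesis ell_gt0 : forall t : R, 0 <= t -> 0 < ell t.
Hypothesis ell_lip : forall s t : R, 0 <= s -> s < t -> `|ell t - ell s| < t - s.
Variables u ux ut : R -> R -> R.
Hypothesis uV0 : continuous_V0 ell u ux.
Hypothesis uC1 : C1_L2 ell u ut.
Hypothesis uw : weak_wave ell ux ut.
Local Notation zx := (slice ell ux).
Local Notation zt := (slice ell ut).
Let cx := zx_L2_curve ell_gt0 ell_lip uV0.
Let ct := zt_L2_curve ell_gt0 ell_lip uC1.
Local Notation P := (displacement ell ux).
Local Notation v := (conjugate ell ut).
Local Notation w := (riemann_invariant ell ux ut).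

(* u = f (t + x) - f (t - x) and v = f (t + x) + f (t - x). *)
Definition profile (s : R) : R := (if 0 <= s then v 0 s else w (-1) (- s) 0) / 2.

Let P0 t : P 0 t = 0. Proof. by rewrite /displacement prim_le0. Qed.

Let sq1 : (1 : R) ^+ 2 = 1. Proof. by rewrite expr1n. Qed.
Let sqN1 : (-1 : R) ^+ 2 = 1. Proof. by rewrite sqrrN expr1n. Qed.

(** The forward characteristic reaches [x = 0] at time [t + y], where [u = 0] leaves only [v]. *)
Lemma profile_forward (y t : R) : 0 <= t -> 0 <= y -> y <= ell t ->
  profile (t + y) = w 1 y t / 2.
Proof.
move=> t0 y0 yl; rewrite /profile addr_ge0//; congr (_ / 2).
have w0 s : w 1 0 s = v 0 s by rewrite /riemann_invariant P0 mulr0 addr0.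
move: y0; rewrite le_eqVlt => /predU1P[<-|y0]; first by rewrite addr0 w0.
rewrite (riemann_invariant_const ell_gt0 ell_lip uV0 uC1 uw sq1 t0 yl y0 (lexx _)).
  by rewrite subrr mul1r w0.
by rewrite mul1r addr_ge0// ltW.
Qed.

(** Backwards in time, the characteristic meets [x = 0] at time [t - y] if this is nonnegative, and
    otherwise the initial line at [x = y - t]: hence the two branches of [profile]. *)
Lemma profile_backward (y t : R) : 0 <= t -> 0 <= y -> y <= ell t ->
  profile (t - y) = w (-1) y t / 2.
Proof.
move=> t0 y0 yl; rewrite /profile subr_ge0; congr (_ / 2).
have w0 s : w (-1) 0 s = v 0 s by rewrite /riemann_invariant P0 mulr0 addr0.
case: leP => [yt|ty].
  move: y0; rewrite le_eqVlt => /predU1P[<-|y0]; first by rewrite subr0 w0.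
  rewrite (riemann_invariant_const ell_gt0 ell_lip uV0 uC1 uw sqN1 t0 yl y0 (lexx _)).
    by rewrite subrr mulN1r w0.
  by rewrite mulN1r subr_ge0.
move: t0 ty; rewrite le_eqVlt => /predU1P[<-|t0] ty; first by rewrite sub0r opprK.
rewrite [RHS](riemann_invariant_const ell_gt0 ell_lip uV0 uC1 uw sqN1 (ltW t0) yl t0 (ltW ty)).
  by rewrite mulN1r subrr opprB.
by rewrite mulN1r subrr.
Qed.

(** True by normalization, all the mass of [u_t] lying in []0, ell t[]. The substance of the
    boundary condition is that [v] so normalized satisfies [v_t = u_x] in integrated form, which the
    test functions free at the boundary have given. *)
Lemma conjugate_boundary (t : R) : 0 <= t -> v (ell t) t = 0.
Proof.
move=> t0; rewrite /conjugate /flux /mass /prim; apply/eqP; rewrite subr_eq0; apply/eqP.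
apply: Rint_eq => x _; rewrite indicE mem_setE in_itv/=.
have [h|h] := boolP (0 < x < ell t); last by rewrite slice0// mul0r.
by move: h => /andP[h1 h2]; rewrite !ltW// mulr1.
Qed.

Lemma profile_boundary (t : R) : 0 <= t -> profile (t + ell t) = - profile (t - ell t).
Proof.
move=> t0; have l0 := ltW (ell_gt0 t0).
by rewrite profile_forward// profile_backward// /riemann_invariant conjugate_boundary//; lra.
Qed.

Lemma energy_char (t k : R) : 0 <= t ->
  is_energy (prim (fun x => 2^-1 * zt t x + k * zx t x)) id 0 (ell t)
    (prim (fun x => (2^-1 * zt t x + k * zx t x) ^+ 2) (ell t)).
Proof.
move=> t0; apply: energy_prim; last exact: ell_gt0.
- exact: sqintegrable_comb (L2_curve_sqintegrable ct t) (L2_curve_sqintegrable cx t).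
- by apply: RintegrableD => //; apply: RintegrableZ => //;
    [exact: L2_curve_Rintegrable ct t|exact: L2_curve_Rintegrable cx t].
Qed.

Lemma prim_char (t k y : R) : prim (fun x => 2^-1 * zt t x + k * zx t x) y =
  2^-1 * prim (zt t) y + k * P y t.
Proof.
rewrite /displacement /prim -!RintZ// -?RintD//.
- by apply: Rint_eq => x _; ring.
- by apply: RintegrableZ => //; apply: Rintegrable_indicM => //;
    exact: L2_curve_Rintegrable ct t.
- by apply: RintegrableZ => //; apply: Rintegrable_indicM => //;
    exact: L2_curve_Rintegrable cx t.
- by apply: Rintegrable_indicM => //; exact: (L2_curve_Rintegrable ct t).
- by apply: Rintegrable_indicM => //; exact: (L2_curve_Rintegrable cx t).
Qed.

Lemma energy_sum (t : R) : 0 <= t ->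
  prim (fun x => (2^-1 * zt t x + - 2^-1 * zx t x) ^+ 2) (ell t) +
  prim (fun x => (2^-1 * zt t x + 2^-1 * zx t x) ^+ 2) (ell t) = energy ell ux ut t.
Proof.
move=> t0; have s1 k := sqintegrable_comb 2^-1 k (L2_curve_sqintegrable ct t)
  (L2_curve_sqintegrable cx t).
have I1 k := Rintegrable_indicM (measurable_itv `[0, ell t]) (proj2 (s1 k)).
rewrite /prim -RintD//.
have -> : energy ell ux ut t = 2^-1 * \int[mu]_x (zt t x ^+ 2 + zx t x ^+ 2).
  rewrite /energy; congr (_ * _); rewrite [LHS]Rintegral_mkcond; apply: Rint_eq => x _.
  rewrite patchE mem_setE in_itv/=.
  have [h|h] := boolP (0 < x < ell t); first by rewrite !sliceE.
  by rewrite !slice0// expr0n addr0.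
rewrite -RintZ//; last by apply: RintegrableD => //;
  [exact: (L2_curve_sqintegrable ct t).2|exact: (L2_curve_sqintegrable cx t).2].
apply: Rint_eq => x _; rewrite indicE mem_setE in_itv/=.
have [h|h] := boolP (0 < x < ell t).
  by move: h => /andP[h1 h2]; rewrite !ltW//= mulr1; field.
by rewrite !slice0// !mulr0 addr0 expr0n/= !mul0r addr0 mulr0.
Qed.

(** Cut at [t]: the left half is a reflection carrying the density [(u_t - u_x) ^ 2 / 4], the right
    half a translation carrying [(u_t + u_x) ^ 2 / 4]. The profile differs from the corresponding
    primitives by the constant [- flux / 2], which disappears in the increments. *)
Lemma profile_energy (t : R) : 0 <= t ->
  is_energy profile id (t - ell t) (t + ell t) (energy ell ux ut t).
Proof.
move=> t0; have l0 := ltW (ell_gt0 t0).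
rewrite -energy_sum//; apply: (@energy_cat _ _ _ _ t).
- by rewrite gerBl.
- by rewrite lerDl.
- by [].
- rewrite -[X in is_energy _ _ _ X](subr0 t); apply: energy_reflect.
  apply: energy_congr (energy_char _ t0) => x /andP[x0 xl].
  rewrite profile_backward// prim_char /riemann_invariant /conjugate.
  instantiate (1 := - flux ell ut t / 2); lra.
- rewrite -[X in is_energy _ _ X](addr0 t); apply: energy_shift.
  apply: energy_congr (energy_char _ t0) => x /andP[x0 xl].
  rewrite profile_forward// prim_char /riemann_invariant /conjugate.
  instantiate (1 := - flux ell ut t / 2); lra.
Qed.

End dalembert.

(** * The moving boundary *)

Section real_analysis.
Variable R : realType.
Implicit Types (f df : R -> R) (a x y : R).

Lemma has_deriv_within_estimate (D : set R) f x l : has_deriv_within D f x l ->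
  forall e, 0 < e -> exists2 r, 0 < r & forall y, D y -> `|y - x| < r ->
    `|f y - f x - l * (y - x)| <= e * `|y - x|.
Proof.
move=> h e e0; have /cvgrPdist_le/(_ _ e0)/nbhs_ballP[r /= r0 hr] := h.
exists r => // y Dy yr; have [->|yx] := eqVneq y x;
  first by rewrite !subrr mulr0 subr0 normr0 mulr0.
have yx0 : y - x != 0 by rewrite subr_eq0.
have := hr y; rewrite /ball/= distrC => /(_ yr yx Dy) h1.
have -> : f y - f x - l * (y - x) = - (l - (f y - f x) / (y - x)) * (y - x) by field.
by rewrite normrM normrN ler_wpM2r.
Qed.

Lemma has_deriv_within_deriv_at a f x l : a < x -> has_deriv_within `[a, +oo[ f x l ->
  deriv_at f x l.
Proof.
move=> ax h e e0; have [r r0 hr] := has_deriv_within_estimate h e0.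
exists (Num.min r (x - a)); first by rewrite lt_min r0 subr_gt0.
move=> y; rewrite lt_min => /andP[yr ya]; apply: hr => //.
by rewrite /= in_itv/= andbT; move: ya; rewrite ltr_norml => /andP[]; lra.
Qed.

Lemma has_deriv_within_continuous a f df :
  (forall x, a <= x -> has_deriv_within `[a, +oo[ f x (df x)) ->
    {within `[a, +oo[, continuous f}.
Proof.
move=> h; apply/subspace_continuousP => x; rewrite /= in_itv/= andbT => ax.
apply/cvgrPdist_le => e e0.
have [r r0 hr] := has_deriv_within_estimate (h x ax) ltr01.
pose k := `|df x| + 1; have k0 : 0 < k by rewrite ltr_wpDl.
apply/nbhs_ballP; exists (Num.min r (e / k)); first by rewrite /= lt_min r0 divr_gt0.
move=> y; rewrite /ball/= distrC lt_min => /andP[yr ye] Dy; rewrite distrC.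
have := hr y Dy yr; rewrite mul1r => h1.
have -> : f y - f x = (f y - f x - df x * (y - x)) + df x * (y - x) by ring.
apply: le_trans (ler_normD _ _) _; rewrite normrM.
apply: (@le_trans _ _ (k * `|y - x|)); first by rewrite /k mulrDl mul1r addrC lerD.
by move: ye; rewrite ltr_pdivlMr// mulrC => /ltW.
Qed.

Lemma within_halfline_segment a f x y : a <= x -> {within `[a, +oo[, continuous f} ->
  {within `[x, y], continuous f}.
Proof.
move=> ax; apply: continuous_subspaceW => z /=; rewrite !in_itv/= andbT => /andP[xz _].
exact: le_trans xz.
Qed.

Lemma mvt_halfline a f df : {within `[a, +oo[, continuous f} ->
  (forall x, a <= x -> has_deriv_within `[a, +oo[ f x (df x)) ->
  forall x y, a <= x -> x < y -> exists2 c, x < c < y & f y - f x = df c * (y - x).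
Proof.
move=> cf h x y ax xy.
have [|c] := @MVT R f df x y xy _ (within_halfline_segment ax cf).
  move=> z; rewrite in_itv/= => /andP[xz _]; apply: deriv_at_is_derive.
  by apply: has_deriv_within_deriv_at (h z _);
    [exact: le_lt_trans xz|exact/ltW/(le_lt_trans ax)].
by rewrite in_itv/= => hc E; exists c.
Qed.

(** Induction on the number of steps of length [c], finite by the Archimedean property. It leads
    from times whose characteristic intervals overlap to arbitrarily distant times. *)
Lemma chain_rel (Q : R -> R -> Prop) (a b c : R) : 0 < c -> a <= b ->
  (forall x y z, Q x y -> Q y z -> Q x z) ->
  (forall x y, a <= x -> x <= y -> y <= b -> y - x <= c -> Q x y) -> Q a b.
Proof.
move=> c0 ab tr loc.
suff H n x : a <= x -> x <= b -> b - x <= n%:R * c -> Q x b.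
  apply: (H (Num.bound ((b - a) / c))) => //.
  rewrite -ler_pdivrMr//; apply: ltW.
  by apply: archi_boundP; rewrite divr_ge0 ?subr_ge0// ltW.
elim: n x => [|n IH] x ax xb h.
  by apply: loc => //; rewrite (le_trans h)// mul0r ltW.
have [bx|bx] := leP (b - x) c; first exact: loc.
apply: (tr _ (x + c)); first by apply: loc; lra.
by apply: IH; [lra|lra|move: h; rewrite -natr1 mulrDl mul1r; lra].
Qed.

(** The points are pulled back by the intermediate value theorem, and the strict monotonicity of [g]
    puts their preimages in order. *)
Lemma reparam (g : R -> R) (s s' : R) p n : s <= s' ->
  {within `[s, s'], continuous g} -> incr_on s s' g -> subdiv (g s) (g s') p n ->
  exists r, [/\ subdiv s s' r n, forall i, s <= r i <= s' & forall i, (i <= n)%N ->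
    g (r i) = p i].
Proof.
move=> ss cg ig sp.
(* The index is clamped at [n], since beyond it [p] may leave the range of [g]. *)
have ex i : exists c, s <= c <= s' /\ g c = p (minn i n).
  have := subdiv_in sp (geq_minr i n) => hp.
  have gss : g s <= g s' by apply: (incr_onW ig).
  have [|c cin gc] := @IVT R g s s' (p (minn i n)) ss cg.
    by rewrite min_l// max_r.
  by exists c; split => //; rewrite in_itv/= in cin.
have [r hr] := choice ex; exists r.
have inj x y : s <= x <= s' -> s <= y <= s' -> g x <= g y -> x <= y.
  move=> /andP[sx xs] /andP[sy ys] gxy; rewrite leNgt; apply/negP => yx.
  by have := ig _ _ sy yx xs; rewrite ltNge gxy.
have rin i : s <= r i <= s' by case: (hr i).
have gr i : (i <= n)%N -> g (r i) = p i by move=> i_n; case: (hr i) => _ ->;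
  rewrite (minn_idPl i_n).
have s_in : s <= s <= s' by rewrite lexx.
have s'_in : s <= s' <= s' by rewrite lexx ss.
have [hp p0 pn] := sp.
split => //; split.
- move=> i j ij; apply: inj => //; case: (hr i) => _ ->; case: (hr j) => _ ->.
  by apply: hp; rewrite leq_min geq_minr andbT (leq_trans (geq_minl _ _)).
- by apply/le_anti/andP; split; apply: inj => //; rewrite gr// p0.
- by apply/le_anti/andP; split; apply: inj => //; rewrite gr// pn.
Qed.

End real_analysis.

(** * Increments and slopes of [ell] and [phi] *)

Section moving_boundary.
Variables (R : realType) (ell dell : R -> R) (L : R) (phi dphi : R -> R).
Hypothesis ell_cont : {within `[0, +oo[, continuous ell}.
Hypothesis ell_gt0 : forall t : R, 0 <= t -> 0 < ell t.
Hypothesis ell_deriv : forall t : R, 0 <= t -> has_deriv_within `[0, +oo[ ell t (dell t).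
Hypothesis dell_lt1 : forall t : R, 0 <= t -> `|dell t| < 1.
Hypothesis LE : L = ell 0.
Hypothesis phi_deriv : forall s : R, - L <= s -> has_deriv_within `[- L, +oo[ phi s (dphi s).
Hypothesis dphi_cont : {within `[- L, +oo[, continuous dphi}.
Hypothesis dphi_gt0 : forall s : R, - L <= s -> 0 < dphi s.
Hypothesis phi_ell : forall t : R, 0 <= t -> phi (t + ell t) - phi (t - ell t) = 2.

Lemma ell_lip (s t : R) : 0 <= s -> s < t -> `|ell t - ell s| < t - s.
Proof.
move=> s0 st; have [c /andP[sc _] ->] := mvt_halfline ell_cont ell_deriv s0 st.
have ts0 : 0 < t - s by rewrite subr_gt0.
rewrite normrM (gtr0_norm ts0) gtr_pMl//; apply: dell_lt1.
exact: le_trans (ltW sc).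
Qed.

Local Notation alpha t := (t + ell t).
Local Notation beta t := (t - ell t).

Lemma alpha_incr (s t : R) : 0 <= s -> s < t -> alpha s < alpha t.
Proof. by move=> s0 st; have := ell_lip s0 st; rewrite ltr_norml => /andP[]; lra. Qed.

Lemma beta_incr (s t : R) : 0 <= s -> s < t -> beta s < beta t.
Proof. by move=> s0 st; have := ell_lip s0 st; rewrite ltr_norml => /andP[]; lra. Qed.

Lemma alpha_le (s t : R) : 0 <= s -> s <= t -> alpha s <= alpha t.
Proof. by move=> s0; rewrite le_eqVlt => /predU1P[->//|st]; apply/ltW/alpha_incr. Qed.

Lemma beta_le (s t : R) : 0 <= s -> s <= t -> beta s <= beta t.
Proof. by move=> s0; rewrite le_eqVlt => /predU1P[->//|st]; apply/ltW/beta_incr. Qed.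

Lemma beta_ge (t : R) : 0 <= t -> - L <= beta t.
Proof. by move=> t0; have := beta_le (lexx 0) t0; rewrite sub0r LE. Qed.

Lemma beta_alpha (t : R) : 0 <= t -> beta t < alpha t.
Proof. by move=> /ell_gt0; lra. Qed.

Lemma phi_mvt (x y : R) : - L <= x -> x < y ->
  exists2 c, x < c < y & phi y - phi x = dphi c * (y - x).
Proof. exact: mvt_halfline (has_deriv_within_continuous phi_deriv) phi_deriv x y. Qed.

Lemma phi_incr (a b : R) : - L <= a -> incr_on a b phi.
Proof.
move=> La x y ax xy _; have Lx := le_trans La ax.
have [c /andP[xc _] E] := phi_mvt Lx xy.
rewrite -subr_gt0 E mulr_gt0 ?subr_gt0// dphi_gt0// (le_trans Lx)// ltW//.
Qed.

Lemma phi_slope (a b m M : R) : - L <= a ->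
  (forall s, a <= s <= b -> m <= dphi s <= M) ->
  forall x y, a <= x -> x < y -> y <= b -> m * (y - x) <= phi y - phi x <= M * (y - x).
Proof.
move=> La h x y ax xy yb; have [c /andP[xc cy] ->] := phi_mvt (le_trans La ax) xy.
have yx0 : 0 < y - x by rewrite subr_gt0.
by rewrite !ler_pM2r//; apply: h; rewrite (le_trans ax (ltW xc)) (le_trans (ltW cy) yb).
Qed.

Lemma dphi_bounds (a b : R) : - L <= a -> a <= b -> exists c d,
  [/\ a <= c <= b, a <= d <= b & forall s, a <= s <= b -> dphi c <= dphi s <= dphi d].
Proof.
move=> La ab; have cd := within_halfline_segment (y := b) La dphi_cont.
have [c cin hc] := EVT_min ab cd; have [d din hd] := EVT_max ab cd.
exists c, d; split; [by rewrite in_itv/= in cin|by rewrite in_itv/= in din|].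
by move=> s hs; rewrite hc ?hd// in_itv.
Qed.

(** The functional equation of [phi] differentiated in [t]. Only forward increments [d > 0] are
    taken, because at [t = 0] the derivatives are one-sided. *)
Lemma boundary_slopes (t : R) : 0 <= t ->
  dphi (alpha t) * (1 + dell t) = dphi (beta t) * (1 - dell t).
Proof.
move=> t0; apply/eqP; rewrite -subr_eq0 -normr_le0; apply/ler_addgt0Pr => e e0; rewrite add0r.
have La : - L <= alpha t by apply: le_trans (beta_ge t0) (ltW (beta_alpha t0)).
have Lb := beta_ge t0.
pose A := dphi (alpha t); pose B := dphi (beta t).
have A0 : 0 < A by exact: dphi_gt0.
have B0 : 0 < B by exact: dphi_gt0.
(* Each of the two arguments of [phi] moves by less than [2 * d], giving errors [2 * k * d] twice;
   the error on [ell] gives [(A + B) * k * d]. The sum is [e * d]. *)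
pose k := e / (4 + A + B).
have k0 : 0 < k by rewrite divr_gt0//; lra.
have [r1 r10 h1] := has_deriv_within_estimate (phi_deriv La) k0.
have [r2 r20 h2] := has_deriv_within_estimate (phi_deriv Lb) k0.
have [r3 r30 h3] := has_deriv_within_estimate (ell_deriv t0) k0.
pose d := Num.min (r1 / 4) (Num.min (r2 / 4) (r3 / 4)).
have d0 : 0 < d by rewrite !lt_min !divr_gt0.
have d1 : d <= r1 / 4 by rewrite !ge_min lexx.
have d2 : d <= r2 / 4 by rewrite !ge_min lexx orbT.
have d3 : d <= r3 / 4 by rewrite !ge_min lexx !orbT.
have td : t < t + d by rewrite ltrDl.
have td0 : 0 <= t + d by lra.
have lip := ell_lip t0 td.
have := alpha_incr t0 td; have := beta_incr t0 td => hb ha.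
have {h1} : `|phi (alpha (t + d)) - phi (alpha t) - A * (alpha (t + d) - alpha t)| <= k * (2 *
  d).
  apply: (@le_trans _ _ (k * `|alpha (t + d) - alpha t|)).
    apply: h1; first by rewrite /= in_itv/= andbT (le_trans La)// ltW.
    by rewrite gtr0_norm ?subr_gt0//; move: lip; rewrite ltr_norml => /andP[]; lra.
  rewrite ler_pM2l// gtr0_norm ?subr_gt0//.
  by move: lip; rewrite ltr_norml => /andP[]; lra.
have {h2} : `|phi (beta (t + d)) - phi (beta t) - B * (beta (t + d) - beta t)| <= k * (2 * d).
  apply: (@le_trans _ _ (k * `|beta (t + d) - beta t|)).
    apply: h2; first by rewrite /= in_itv/= andbT (le_trans Lb)// ltW.
    by rewrite gtr0_norm ?subr_gt0//; move: lip; rewrite ltr_norml => /andP[]; lra.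
  rewrite ler_pM2l// gtr0_norm ?subr_gt0//.
  by move: lip; rewrite ltr_norml => /andP[]; lra.
have {h3} : `|ell (t + d) - ell t - dell t * d| <= k * d.
  have E : t + d - t = d by ring.
  have := h3 (t + d); rewrite E (gtr0_norm d0); apply; last by lra.
  by rewrite /= in_itv/= andbT.
have P1 := phi_ell t0; have P2 := phi_ell td0.
move: P1 P2; set p1 := phi (alpha t); set p2 := phi (beta t).
set p3 := phi (alpha (t + d)); set p4 := phi (beta (t + d)) => P1 P2.
have -> : alpha (t + d) - alpha t = d + (ell (t + d) - ell t) by ring.
have -> : beta (t + d) - beta t = d - (ell (t + d) - ell t) by ring.
set q := ell (t + d) - ell t; rewrite -/A -/B => hq hB hA.
have E : (A * (1 + dell t) - B * (1 - dell t)) * d =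
  - (p3 - p1 - A * (d + q)) + (p4 - p2 - B * (d - q)) - (A + B) * (q - dell t * d)
  + ((p3 - p4) - (p1 - p2)) by ring.
have : `|(A * (1 + dell t) - B * (1 - dell t)) * d| <= e * d.
  rewrite E P1 P2 subrr addr0.
  apply: le_trans (ler_normB _ _) _.
  have -> : e * d = (k * (2 * d) + k * (2 * d)) + (A + B) * (k * d).
    by rewrite /k; field; rewrite gt_eqF//; lra.
  apply: lerD; last by rewrite normrM gtr0_norm ?addr_gt0// ler_pM2l ?addr_gt0.
  by apply: le_trans (ler_normD _ _) _; rewrite normrN lerD.
by rewrite normrM (gtr0_norm d0) ler_pM2r.
Qed.

End moving_boundary.

(** * Energy estimates *)

Section energy_bounds.
Variables (R : realType) (ell dell : R -> R) (L : R) (phi dphi : R -> R).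
Hypothesis ell_cont : {within `[0, +oo[, continuous ell}.
Hypothesis ell_gt0 : forall t : R, 0 <= t -> 0 < ell t.
Hypothesis ell_deriv : forall t : R, 0 <= t -> has_deriv_within `[0, +oo[ ell t (dell t).
Hypothesis dell_lt1 : forall t : R, 0 <= t -> `|dell t| < 1.
Hypothesis LE : L = ell 0.
Hypothesis phi_deriv : forall s : R, - L <= s -> has_deriv_within `[- L, +oo[ phi s (dphi s).
Hypothesis dphi_cont : {within `[- L, +oo[, continuous dphi}.
Hypothesis dphi_gt0 : forall s : R, - L <= s -> 0 < dphi s.
Hypothesis phi_ell : forall t : R, 0 <= t -> phi (t + ell t) - phi (t - ell t) = 2.
Local Notation alpha t := (t + ell t).
Local Notation beta t := (t - ell t).
Let lip := ell_lip ell_cont ell_deriv dell_lt1.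
Let aincr := alpha_incr ell_cont ell_deriv dell_lt1.
Let bincr := beta_incr ell_cont ell_deriv dell_lt1.
Let ale := alpha_le ell_cont ell_deriv dell_lt1.
Let ble := beta_le ell_cont ell_deriv dell_lt1.
Let bge := beta_ge ell_cont ell_deriv dell_lt1 LE.
Let ba := beta_alpha ell_gt0.
Let pincr := phi_incr phi_deriv dphi_gt0.

Lemma ell_segment (s s' : R) : 0 <= s -> {within `[s, s'], continuous ell}.
Proof. by move=> s0; exact: within_halfline_segment ell_cont. Qed.

Lemma alpha_segment (s s' : R) : 0 <= s -> {within `[s, s'], continuous (fun t => alpha t)}.
Proof.
move=> s0 x; apply: cvgD; last exact: ell_segment.
exact: (@continuous_subspaceT _ _ _ id (fun x => cvg_id)).
Qed.

Lemma beta_segment (s s' : R) : 0 <= s -> {within `[s, s'], continuous (fun t => beta t)}.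
Proof.
move=> s0 x; apply: cvgB; last exact: ell_segment.
exact: (@continuous_subspaceT _ _ _ id (fun x => cvg_id)).
Qed.

(** The overlap condition reads [s' - s <= ell s + ell s'], and [ell] has a positive minimum on
    [[t0, t1]]. *)
Lemma overlap_step (t0 t1 : R) : 0 <= t0 -> t0 <= t1 -> exists2 c, 0 < c &
  forall s s', t0 <= s -> s <= s' -> s' <= t1 -> s' - s <= c -> beta s' <= alpha s.
Proof.
move=> t00 t01; have [c cin hc] := EVT_min t01 (ell_segment (s' := t1) t00).
have c0 : 0 <= c by move: cin; rewrite in_itv/= => /andP[/(le_trans t00)].
exists (ell c); first exact: ell_gt0.
move=> s s' ts ss st h.
have := hc s; rewrite in_itv/= ts (le_trans ss st) => /(_ isT) h1.
have := ell_gt0 (le_trans (le_trans t00 ts) ss); lra.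
Qed.

Lemma subdiv_comp (g : R -> R) (s s' : R) r n : (forall x y, s <= x -> x <= y -> y <= s' ->
  g x <= g y) ->
  subdiv s s' r n -> (forall i, s <= r i <= s') -> subdiv (g s) (g s') (fun i => g (r i)) n.
Proof.
move=> hg [hr r0 rn] rin; split; rewrite ?r0 ?rn// => i j ij.
have /andP[h1 _] := rin i; have /andP[_ h2] := rin j.
by apply: hg => //; exact: hr.
Qed.

Variables (E : R -> R) (f : R -> R).
Hypothesis f_boundary : forall t : R, 0 <= t -> f (alpha t) = - f (beta t).
Hypothesis f_energy : forall t : R, 0 <= t -> is_energy f id (beta t) (alpha t) (E t).

(** The minimum of [dphi] on the compact interval is positive, which bounds the sums in [phi] by
    [E t / dphi c]. *)
Lemma phi_energy_exists t : 0 <= t -> exists I, is_energy f phi (beta t) (alpha t) I.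
Proof.
move=> t0; have [c [d [cin _ hcd]]] := dphi_bounds dphi_cont (bge t0) (ltW (ba t0)).
have c0 : 0 < dphi c.
  by apply: dphi_gt0; move: cin => /andP[+ _]; apply: le_trans; exact: bge.
have [|I hI _] := @energy_exists _ f phi (beta t) (alpha t) (E t / dphi c) (ltW (ba t0)).
  move=> p n sp; apply: (rsum_phi_le c0 _ sp); last exact: (f_energy t0).1.
  by move=> x y ax xy yb; have /andP[] := phi_slope phi_deriv (bge t0) hcd ax xy yb.
by exists I.
Qed.

Lemma boundary_subdiv s s' p n : 0 <= s -> s <= s' -> subdiv (beta s) (beta s') p n ->
  exists r, [/\ subdiv (alpha s) (alpha s') (fun i => alpha (r i)) n,
    forall i, s <= r i <= s', forall i j, (i <= j)%N -> r i <= r j & forall i, (i <= n)%N ->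
      beta (r i) = p i].
Proof.
move=> s0 ss sp; have [||r [sr rin rp]] := @reparam _ (fun t => beta t) s s' p n ss _ _ sp.
- exact: beta_segment.
- by move=> x y sx xy _; apply: bincr => //; exact: le_trans sx.
exists r; split => //; last by case: sr.
apply: (@subdiv_comp (fun t => alpha t) s s') => // x y sx xy _.
by apply: ale => //; exact: le_trans sx.
Qed.

Lemma boundary_subdiv' s s' p n : 0 <= s -> s <= s' -> subdiv (alpha s) (alpha s') p n ->
  exists r, [/\ subdiv (beta s) (beta s') (fun i => beta (r i)) n,
    forall i, s <= r i <= s', forall i j, (i <= j)%N -> r i <= r j & forall i, (i <= n)%N ->
      alpha (r i) = p i].
Proof.
move=> s0 ss sp; have [||r [sr rin rp]] := @reparam _ (fun t => alpha t) s s' p n ss _ _ sp.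
- exact: alpha_segment.
- by move=> x y sx xy _; apply: aincr => //; exact: le_trans sx.
exists r; split => //; last by case: sr.
apply: (@subdiv_comp (fun t => beta t) s s') => // x y sx xy _.
by apply: ble => //; exact: le_trans sx.
Qed.

(** Term by term equality: the change of sign of [f] is lost in the square, the shift of [phi] by 2
    in the difference. *)
Lemma phi_energy_boundary s s' J : 0 <= s -> s <= s' ->
  is_energy f phi (beta s) (beta s') J -> is_energy f phi (alpha s) (alpha s') J.
Proof.
move=> s0 ss; have pe r : 0 <= r -> phi (alpha r) = phi (beta r) + 2.
  by move=> /phi_ell; lra.
apply: energy_transfer => p n sp.
- have [r [sr rin _ rp]] := boundary_subdiv s0 ss sp.
  exists (fun i => alpha (r i)), n; split => //; apply: eq_bigr => i _.
  have r0 j : 0 <= r j by have /andP[/(le_trans s0)] := rin j.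
  rewrite -!rp ?(ltnW (ltn_ord i)) ?(ltn_ord i)// !pe// !f_boundary// -sqrrN.
  by congr (_ ^+ 2 / _); ring.
- have [r [sr rin _ rp]] := boundary_subdiv' s0 ss sp.
  exists (fun i => beta (r i)), n; split => //; apply: eq_bigr => i _.
  have r0 j : 0 <= r j by have /andP[/(le_trans s0)] := rin j.
  rewrite -!rp ?(ltnW (ltn_ord i)) ?(ltn_ord i)// !pe// !f_boundary// -[in RHS]sqrrN.
  by congr (_ ^+ 2 / _); ring.
Qed.

(** The intervals at times [s] and [s'] share [[beta s', alpha s]]. Only the piece [J1] lost on the
    left and the piece [J3] gained on the right distinguish them, and the boundary relation matches
    these two pieces. *)
Lemma energy_pieces (psi : R -> R) s s' I I' : 0 <= s -> s <= s' -> beta s' <= alpha s ->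
  incr_on (beta s) (alpha s') psi ->
  is_energy f psi (beta s) (alpha s) I -> is_energy f psi (beta s') (alpha s') I' ->
  exists J1 J2 J3, [/\ is_energy f psi (beta s) (beta s') J1,
    is_energy f psi (alpha s) (alpha s') J3, I = J1 + J2 & I' = J2 + J3].
Proof.
move=> s0 ss ov hpsi hI hI'.
have b1 := ble s0 ss; have a1 := ale s0 ss.
have [J1 [J2 [h1 h2 E1]]] := energy_split b1 ov (incr_onS (lexx _) a1 hpsi) hI.
have [J2' [J3 [h2' h3 E2]]] := energy_split ov a1 (incr_onS b1 (lexx _) hpsi) hI'.
have E3 := energy_uniq h2 h2'.
by exists J1, J2, J3; rewrite E3; split => //; rewrite E1 E3.
Qed.

Lemma phi_energy_const t0 t1 I I' : 0 <= t0 -> t0 <= t1 ->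
  is_energy f phi (beta t0) (alpha t0) I -> is_energy f phi (beta t1) (alpha t1) I' -> I = I'.
Proof.
move=> t00 t01; have [c c0 hc] := overlap_step t00 t01.
pose Q s s' := forall I I', is_energy f phi (beta s) (alpha s) I ->
  is_energy f phi (beta s') (alpha s') I' -> 0 <= s -> 0 <= s' -> I = I'.
suff : Q t0 t1 by move=> q h1 h2; apply: q => //; exact: le_trans t01.
(* Transitivity requires an energy at the intermediate time, whose existence depends on that time
   being nonnegative; the relation is strengthened to carry this along. *)
pose Q' s s' := 0 <= s -> 0 <= s' /\ Q s s'.
suff : Q' t0 t1 by move=> /(_ t00)[].
apply: (chain_rel c0 t01) => [x y z xy yz x0|s s' ts ss st h s0].
  have [y0 q1] := xy x0; have [z0 q2] := yz y0; split => // J J' hJ hJ' _ _.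
  have [K hK] := phi_energy_exists y0.
  by rewrite (q1 _ _ hJ hK)// (q2 _ _ hK hJ').
have s'0 := le_trans s0 ss; split => // J J' hJ hJ' _ _.
have [J1 [J2 [J3 [h1 h3 -> ->]]]] := energy_pieces s0 ss (hc _ _ ts ss st h) (pincr (bge s0))
  hJ hJ'.
by rewrite (energy_uniq (phi_energy_boundary s0 ss h1) h3) addrC.
Qed.

(** The common value [I] is eliminated between the comparisons at the two times. The bounds on
    [dphi] are left arbitrary, so as to cover both [min_char], [max_char] and the end values of a
    monotone [dphi]. *)
Lemma energy_ratio (t0 t m M m0 M0 : R) : 0 <= t0 -> t0 <= t -> 0 < m -> 0 < m0 ->
  (forall s, beta t <= s <= alpha t -> m <= dphi s <= M) ->
  (forall s, beta t0 <= s <= alpha t0 -> m0 <= dphi s <= M0) ->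
  m / M0 * E t0 <= E t /\ E t <= M / m0 * E t0.
Proof.
move=> t00 t0t mp m0p hm hm0; have tp := le_trans t00 t0t.
have [I hI] := phi_energy_exists t00; have [I' hI'] := phi_energy_exists tp.
have II := phi_energy_const t00 t0t hI hI'; rewrite -{}II in hI'.
have Mp : 0 < M.
  have /hm /andP[h1 h2] : beta t <= beta t <= alpha t by rewrite lexx ltW// ba.
  exact: lt_le_trans mp (le_trans h1 h2).
have M0p : 0 < M0.
  have /hm0 /andP[h1 h2] : beta t0 <= beta t0 <= alpha t0 by rewrite lexx ltW// ba.
  exact: lt_le_trans m0p (le_trans h1 h2).
have /andP[a1 a2] := energy_compare mp Mp (phi_slope phi_deriv (bge tp) hm) (f_energy tp) hI'.
have /andP[b1 b2] := energy_compare m0p M0p (phi_slope phi_deriv (bge t00) hm0) (f_energy t00)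
  hI.
split.
- apply: le_trans a1; rewrite mulrAC ler_pdivrMr// -mulrA ler_pM2l// mulrC; exact: b2.
- apply: le_trans a2 _; rewrite mulrAC -mulrA ler_pM2l// ler_pdivlMr// mulrC.
  exact: b1.
Qed.

(** The order is abstract in order to serve as [<=] and as [>=]. Over a short step the shared piece
    cancels, so that only the lost and gained pieces are compared. *)
Lemma energy_monotone (t0 t1 : R) (le : rel R) :
  transitive le -> (forall x y z : R, le x y -> le (x + z) (z + y)) ->
  (forall s s' J1 J3, t0 <= s -> s <= s' -> s' <= t1 ->
     is_energy f id (beta s) (beta s') J1 -> is_energy f id (alpha s) (alpha s') J3 ->
       le J1 J3) ->
  0 <= t0 -> forall s s', t0 <= s -> s <= s' -> s' <= t1 -> le (E s) (E s').
Proof.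
move=> tr tadd H t00 s s' ts ss st; have s0 := le_trans t00 ts.
have [c c0 hc] := overlap_step s0 ss.
apply: (chain_rel (Q := fun x y => le (E x) (E y)) c0 ss) => [x y z|x y sx xy ys h].
  exact: tr.
have x0 := le_trans s0 sx.
have [J1 [J2 [J3 [h1 h3 -> ->]]]] := energy_pieces x0 xy (hc _ _ sx xy ys h)
  (@incr_on_id _ _ _) (f_energy x0) (f_energy (le_trans x0 xy)).
by apply: tadd; apply: (H x y) => //; [exact: le_trans sx|exact: le_trans st].
Qed.

(** The alternative [v = 0] is for repeated points, where both quotients are 0. *)
Lemma sqr_div_le (x u v : R) : 0 <= u -> u <= v -> (v = 0 \/ 0 < u) -> x ^+ 2 / v <= x ^+ 2 / u.
Proof.
move=> u0 uv [v0|up].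
  have -> : u = v by apply/le_anti; rewrite uv v0.
  by [].
by rewrite ler_wpM2l ?sqr_ge0// lef_pV2 ?posrE// (lt_le_trans up).
Qed.

(** When [ell] decreases, [alpha] grows less than [beta] between two times while the increments of
    [f] agree up to sign, so every quotient is larger on the [alpha] side. A nearly optimal
    subdivision of the [beta] side is therefore carried there. *)
Lemma energy_nondecreasing (t0 t1 : R) : 0 <= t0 ->
  (forall x y, t0 <= x -> x <= y -> y <= t1 -> ell y <= ell x) ->
  forall s s', t0 <= s -> s <= s' -> s' <= t1 -> E s <= E s'.
Proof.
move=> t00 hl; apply: energy_monotone => //; first by move=> y x z; exact: le_trans.
  by move=> x y z xy; rewrite addrC lerD2l.
move=> s s' J1 J3 ts ss st hJ1 hJ3; have s0 := le_trans t00 ts.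
apply/ler_addgt0Pr => e e0; have [p [n [sp h]]] := hJ1.2 _ e0.
have [r [sr rin rm rp]] := boundary_subdiv s0 ss sp.
suff : rsum f id p n <= rsum f id (fun i => alpha (r i)) n by have := hJ3.1 _ _ sr; lra.
apply: ler_sum => i _.
have r0 j : 0 <= r j by have /andP[/(le_trans s0)] := rin j.
rewrite -!rp ?(ltnW (ltn_ord i)) ?(ltn_ord i)// !f_boundary//.
have -> : (- f (beta (r i.+1)) - - f (beta (r i))) ^+ 2 = (f (beta (r i.+1)) - f (beta (r i)))
  ^+ 2 by ring.
have rr := rm _ _ (leqnSn i).
have lr : ell (r i.+1) <= ell (r i).
  by apply: hl => //; [have /andP[/(le_trans ts)] := rin i|have /andP[_ /le_trans] := rin i.+1;
    apply].
apply: sqr_div_le => /=.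
- by rewrite subr_ge0 ale.
- lra.
- move: rr; rewrite le_eqVlt => /predU1P[->|rr]; [by left; rewrite subrr|right].
  by rewrite subr_gt0 aincr.
Qed.

(** Now [beta] grows less than [alpha], and a nearly optimal subdivision of the [alpha] side is
    carried back to the [beta] side. *)
Lemma energy_nonincreasing (t0 t1 : R) : 0 <= t0 ->
  (forall x y, t0 <= x -> x <= y -> y <= t1 -> ell x <= ell y) ->
  forall s s', t0 <= s -> s <= s' -> s' <= t1 -> E s' <= E s.
Proof.
move=> t00 hl; apply: (@energy_monotone _ _ (fun x y => y <= x)) => //.
- by move=> y x z /= yx zy; exact: le_trans yx.
- by move=> x y z /= xy; rewrite addrC lerD2r.
move=> s s' J1 J3 ts ss st hJ1 hJ3; have s0 := le_trans t00 ts.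
apply/ler_addgt0Pr => e e0; have [p [n [sp h]]] := hJ3.2 _ e0.
have [r [sr rin rm rp]] := boundary_subdiv' s0 ss sp.
suff : rsum f id p n <= rsum f id (fun i => beta (r i)) n by have := hJ1.1 _ _ sr; lra.
apply: ler_sum => i _.
have r0 j : 0 <= r j by have /andP[/(le_trans s0)] := rin j.
rewrite -!rp ?(ltnW (ltn_ord i)) ?(ltn_ord i)// !f_boundary//.
have -> : (- f (beta (r i.+1)) - - f (beta (r i))) ^+ 2 = (f (beta (r i.+1)) - f (beta (r i)))
  ^+ 2 by ring.
have rr := rm _ _ (leqnSn i).
have lr : ell (r i) <= ell (r i.+1).
  by apply: hl => //; [have /andP[/(le_trans ts)] := rin i|have /andP[_ /le_trans] := rin i.+1;
    apply].
apply: sqr_div_le => /=.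
- by rewrite subr_ge0 ble.
- lra.
- move: rr; rewrite le_eqVlt => /predU1P[->|rr]; [by left; rewrite subrr|right].
  by rewrite subr_gt0 bincr.
Qed.

End energy_bounds.

(** * Extreme values and direction of monotonicity of [dphi] *)

Section monotone_slopes.
Variables (R : realType) (ell dell : R -> R) (L : R) (phi dphi : R -> R).
Hypothesis ell_cont : {within `[0, +oo[, continuous ell}.
Hypothesis ell_gt0 : forall t : R, 0 <= t -> 0 < ell t.
Hypothesis ell_deriv : forall t : R, 0 <= t -> has_deriv_within `[0, +oo[ ell t (dell t).
Hypothesis dell_lt1 : forall t : R, 0 <= t -> `|dell t| < 1.
Hypothesis LE : L = ell 0.
Hypothesis phi_deriv : forall s : R, - L <= s -> has_deriv_within `[- L, +oo[ phi s (dphi s).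
Hypothesis dphi_cont : {within `[- L, +oo[, continuous dphi}.
Hypothesis dphi_gt0 : forall s : R, - L <= s -> 0 < dphi s.
Hypothesis phi_ell : forall t : R, 0 <= t -> phi (t + ell t) - phi (t - ell t) = 2.
Local Notation alpha t := (t + ell t).
Local Notation beta t := (t - ell t).
Let ale := alpha_le ell_cont ell_deriv dell_lt1.
Let ble := beta_le ell_cont ell_deriv dell_lt1.
Let bge := beta_ge ell_cont ell_deriv dell_lt1 LE.
Let ba := beta_alpha ell_gt0.

(** For [x] in [[0, ell t]] the points [t - x] and [t + x] sweep exactly [[beta t, alpha t]], a
    compact interval on which [dphi] has a positive minimum. *)
Lemma char_values_bounds (t : R) : 0 <= t ->
  0 < min_char ell dphi t /\
  forall s, beta t <= s <= alpha t -> min_char ell dphi t <= dphi s <= max_char ell dphi t.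
Proof.
move=> t0; have [c [d [cin din hcd]]] := dphi_bounds dphi_cont (bge t0) (ltW (ba t0)).
have inA s : beta t <= s <= alpha t -> char_values ell dphi t (dphi s).
  move=> /andP[h1 h2]; have [st|ts] := leP s t.
    by exists (t - s); [apply/andP; split; lra|left; congr dphi; ring].
  by exists (s - t); [apply/andP; split; lra|right; congr dphi; ring].
have Ain y : char_values ell dphi t y -> dphi c <= y <= dphi d.
  by move=> [x /andP[x0 xl] [->|->]]; apply: hcd; apply/andP; split; lra.
have A0 : char_values ell dphi t !=set0 by exists (dphi c); exact: inA.
have lbA : has_lbound (char_values ell dphi t) by exists (dphi c) => y /Ain /andP[].
have ubA : has_ubound (char_values ell dphi t) by exists (dphi d) => y /Ain /andP[].
split.
  apply: (@lt_le_trans _ _ (dphi c)).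
    by apply: dphi_gt0; move: cin => /andP[+ _]; apply: le_trans; exact: bge.
  by apply: lb_le_inf => // y /Ain /andP[].
move=> s /inA sA; apply/andP; split; first exact: ge_inf.
exact: ub_le_sup.
Qed.

Lemma ell_monotone (t0 t1 : R) : 0 <= t0 ->
  ((forall t, t0 <= t <= t1 -> dell t <= 0) -> forall x y, t0 <= x -> x <= y -> y <= t1 ->
    ell y <= ell x) /\
  ((forall t, t0 <= t <= t1 -> 0 <= dell t) -> forall x y, t0 <= x -> x <= y -> y <= t1 ->
    ell x <= ell y).
Proof.
move=> t00; split => hd x y tx; rewrite le_eqVlt => /predU1P[->//|xy] yt.
  have [c /andP[c1 c2] E] := mvt_halfline ell_cont ell_deriv (le_trans t00 tx) xy.
  rewrite -subr_le0 E mulr_le0_ge0// ?subr_ge0 ?(ltW xy)// hd//.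
  by rewrite (le_trans tx (ltW c1)) (le_trans (ltW c2) yt).
have [c /andP[c1 c2] E] := mvt_halfline ell_cont ell_deriv (le_trans t00 tx) xy.
rewrite -subr_ge0 E mulr_ge0// ?subr_ge0 ?(ltW xy)// hd//.
by rewrite (le_trans tx (ltW c1)) (le_trans (ltW c2) yt).
Qed.

(* If dphi takes the same value at beta t and alpha t for every t, overlapping
   of the intervals [beta t, alpha t] propagates this value. *)
Lemma equal_ends (t0 t1 : R) : 0 <= t0 -> t0 <= t1 ->
  monotone_on (beta t0) (alpha t1) dphi ->
  (forall t, t0 <= t <= t1 -> dphi (alpha t) = dphi (beta t)) ->
  forall x y, beta t0 <= x <= alpha t1 -> beta t0 <= y <= alpha t1 -> dphi x = dphi y.
Proof.
move=> t00 t01 mono eqab; have [c c0 hc] := overlap_step ell_cont ell_gt0 t00 t01.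
have sandwich a b x : beta t0 <= a -> a <= x -> x <= b -> b <= alpha t1 -> dphi a = dphi b ->
  dphi x = dphi a.
  move=> ta ax xb bt ab.
  have I z : a <= z -> z <= b -> z \in `[beta t0, alpha t1].
    by move=> az zb; rewrite in_itv/= (le_trans ta az) (le_trans zb bt).
  have aI := I a (lexx _) (le_trans ax xb); have bI := I b (le_trans ax xb) (lexx _).
  have xI := I x ax xb; apply/le_anti; case: mono => h.
    by rewrite [X in _ <= X]ab (h _ _ xI bI xb) (h _ _ aI xI ax).
  by rewrite (h _ _ xI aI ax) [X in X <= _]ab (h _ _ bI xI xb).
(* For a short step [beta s'] lies in [[beta s, alpha s]]; [dphi] agrees at the ends of this
   interval, hence is constant on it by monotonicity. *)
have ends : dphi (beta t0) = dphi (beta t1).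
  apply: (chain_rel (Q := fun x y => dphi (beta x) = dphi (beta y)) c0 t01) => [x y z -> //|].
  move=> s s' ts ss st h; have s0 := le_trans t00 ts; apply/esym.
  apply: (sandwich _ (alpha s)).
  - exact: ble.
  - exact: ble.
  - exact: hc.
  - by apply: ale => //; exact: le_trans st.
  - by rewrite eqab// ts (le_trans ss st).
have ab : dphi (beta t0) = dphi (alpha t1) by rewrite ends eqab// t01 lexx.
have all x : beta t0 <= x <= alpha t1 -> dphi x = dphi (beta t0).
  by move=> /andP[h1 h2]; exact: (sandwich _ (alpha t1)).
by move=> x y /all -> /all ->.
Qed.

(** The assumed monotonicity has no direction. Let [A] and [B] be the values of [dphi] at [alpha t]
    and [beta t]: [A * (1 + dell t) = B * (1 - dell t)] with [dell t <= 0] gives [B <= A]. If [dphi]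
    is nonincreasing, then [A = B] for every [t] and [dphi] is constant. *)
Lemma dphi_nondecreasing (t0 t1 : R) : 0 <= t0 -> t0 <= t1 ->
  monotone_on (beta t0) (alpha t1) dphi ->
  (forall t, t0 <= t <= t1 -> dell t <= 0) -> nondecreasing_on (beta t0) (alpha t1) dphi.
Proof.
move=> t00 t01 [//|h] hd x y xI yI xy.
rewrite (equal_ends t00 t01 (or_intror h) _ (x := x) (y := y)) => // t /andP[tt0 tt1].
have tp := le_trans t00 tt0.
have bI : beta t \in `[beta t0, alpha t1].
  by rewrite in_itv/= ble//= (le_trans (ltW (ba tp)))// ale.
have aI : alpha t \in `[beta t0, alpha t1].
  by rewrite in_itv/= ale// andbT (le_trans _ (ltW (ba tp)))// ble.
apply/le_anti; rewrite (h _ _ aI bI (ltW (ba tp)))/=.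
have E := boundary_slopes ell_cont ell_gt0 ell_deriv dell_lt1 LE phi_deriv dphi_gt0 phi_ell tp.
have d0 := hd t; rewrite tt0 tt1 in d0; have {}d0 := d0 isT.
have := dell_lt1 tp; rewrite ltr_norml => /andP[d1 _].
have B0 := dphi_gt0 (bge tp); rewrite leNgt; apply/negP => AB.
have A0 : 0 < dphi (alpha t) by apply: dphi_gt0; apply: le_trans (bge tp) (ltW (ba tp)).
nra.
Qed.

(** Here [dell t >= 0] gives [A <= B] for the values at [alpha t] and [beta t], so that a
    nondecreasing [dphi] is constant. *)
Lemma dphi_nonincreasing (t0 t1 : R) : 0 <= t0 -> t0 <= t1 ->
  monotone_on (beta t0) (alpha t1) dphi ->
  (forall t, t0 <= t <= t1 -> 0 <= dell t) -> nonincreasing_on (beta t0) (alpha t1) dphi.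
Proof.
move=> t00 t01 [h|//] hd x y xI yI xy.
rewrite (equal_ends t00 t01 (or_introl h) _ (x := x) (y := y)) => // t /andP[tt0 tt1].
have tp := le_trans t00 tt0.
have bI : beta t \in `[beta t0, alpha t1].
  by rewrite in_itv/= ble//= (le_trans (ltW (ba tp)))// ale.
have aI : alpha t \in `[beta t0, alpha t1].
  by rewrite in_itv/= ale// andbT (le_trans _ (ltW (ba tp)))// ble.
apply/le_anti; rewrite (h _ _ bI aI (ltW (ba tp))) andbT.
have E := boundary_slopes ell_cont ell_gt0 ell_deriv dell_lt1 LE phi_deriv dphi_gt0 phi_ell tp.
have d0 := hd t; rewrite tt0 tt1 in d0; have {}d0 := d0 isT.
have := dell_lt1 tp; rewrite ltr_norml => /andP[_ d1].
have B0 := dphi_gt0 (bge tp); rewrite leNgt; apply/negP => AB.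
have A0 : 0 < dphi (alpha t) by apply: dphi_gt0; apply: le_trans (bge tp) (ltW (ba tp)).
nra.
Qed.

End monotone_slopes.

Theorem corollary2 (R : realType)
    (ell dell : R -> R) (L : R) (phi dphi : R -> R)
    (u0 u1 : R -> R) (u ux ut : R -> R -> R)
    (* the boundary curve, with derivative dell *)
    (ell_cont : {within `[0, +oo[, continuous ell})
    (ell_gt0 : forall t : R, 0 <= t -> 0 < ell t)
    (ell_deriv : forall t : R, 0 <= t -> has_deriv_within `[0, +oo[ ell t (dell t))
    (dell_lt1 : forall t : R, 0 <= t -> `|dell t| < 1)
    (LE : L = ell 0)
    (* the function phi, of class C^1 with derivative dphi *)
    (phi_deriv : forall s : R, - L <= s ->
       has_deriv_within `[- L, +oo[ phi s (dphi s))
    (dphi_cont : {within `[- L, +oo[, continuous dphi})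
    (dphi_gt0 : forall s : R, - L <= s -> 0 < dphi s)
    (phi_ell : forall t : R, 0 <= t -> phi (t + ell t) - phi (t - ell t) = 2)
    (u0_V0 : V0 L u0) (u1_L2 : L2 L u1)
    (u_sol : is_solution ell u0 u1 u ux ut) :
  let E := energy ell ux ut in
  let m := min_char ell dphi in
  let M := max_char ell dphi in
  (forall t0 t : R, 0 <= t0 -> t0 < t ->
     m t / M t0 * E t0 <= E t /\ E t <= M t / m t0 * E t0) /\
  (forall t0 t1 : R, 0 <= t0 -> t0 < t1 ->
     (* [t0 - ell t0, t1 + ell t1] is the set of all the t - x and t + x, for t
        in [t0, t1] and x in [0, ell t] *)
     monotone_on (t0 - ell t0) (t1 + ell t1) dphi ->
     ((forall t : R, t0 <= t <= t1 -> -1 < dell t /\ dell t <= 0) ->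
        [/\ nondecreasing_on (t0 - ell t0) (t1 + ell t1) dphi,
            nondecreasing_on t0 t1 E
          & forall t : R, t0 <= t <= t1 ->
              dphi (t - ell t) / dphi (t0 + ell t0) * E t0 <= E t /\
              E t <= dphi (t + ell t) / dphi (t0 - ell t0) * E t0]) /\
     ((forall t : R, t0 <= t <= t1 -> 0 <= dell t /\ dell t < 1) ->
        [/\ nonincreasing_on (t0 - ell t0) (t1 + ell t1) dphi,
            nonincreasing_on t0 t1 E
          & forall t : R, t0 <= t <= t1 ->
              dphi (t + ell t) / dphi (t0 - ell t0) * E t0 <= E t /\
              E t <= dphi (t - ell t) / dphi (t0 + ell t0) * E t0])).
Proof.
move=> E m M.
have lip := ell_lip ell_cont ell_deriv dell_lt1.
have [uV0 uC1 uw _ _] := u_sol.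
have ale := alpha_le ell_cont ell_deriv dell_lt1.
have ble := beta_le ell_cont ell_deriv dell_lt1.
have bge := beta_ge ell_cont ell_deriv dell_lt1 LE.
have ba := beta_alpha ell_gt0.
have fb t : 0 <= t -> _ := profile_boundary ell_gt0 lip uV0 uC1 uw (t := t).
have fE t : 0 <= t -> _ := profile_energy ell_gt0 lip uV0 uC1 uw (t := t).
have ratio := energy_ratio ell_cont ell_gt0 ell_deriv dell_lt1 LE phi_deriv dphi_cont dphi_gt0
  phi_ell fb fE.
split=> [t0 t t00 t0t|t0 t1 t00 t01 mono].
  have [mp0 hm0] := char_values_bounds ell_cont ell_gt0 ell_deriv dell_lt1 LE dphi_cont
    dphi_gt0 t00.
  have [mp hm] := char_values_bounds ell_cont ell_gt0 ell_deriv dell_lt1 LE dphi_cont dphi_gt0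
    (le_trans t00 (ltW t0t)).
  exact: (ratio _ _ _ _ _ _ t00 (ltW t0t) mp mp0 hm hm0).
have [ell_dec ell_inc] := ell_monotone ell_cont ell_deriv t1 t00.
have sub t s : t0 <= t <= t1 -> t - ell t <= s <= t + ell t ->
  s \in `[t0 - ell t0, t1 + ell t1].
  move=> /andP[h1 h2] /andP[s1 s2]; rewrite in_itv/= (le_trans (ble _ _ t00 h1) s1)/=.
  by rewrite (le_trans s2 (ale _ _ (le_trans t00 h1) h2)).
have endl t : t0 <= t <= t1 -> t - ell t <= t - ell t <= t + ell t.
  by move=> /andP[h1 _]; rewrite lexx ltW// ba// (le_trans t00).
have endr t : t0 <= t <= t1 -> t - ell t <= t + ell t <= t + ell t.
  by move=> /andP[h1 _]; rewrite lexx ltW// ba// (le_trans t00).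
have pos t s : t0 <= t <= t1 -> t - ell t <= s <= t + ell t -> 0 < dphi s.
  by move=> /andP[h1 _] /andP[s1 _]; apply: dphi_gt0; apply: le_trans s1;
    rewrite bge// (le_trans t00).
have t0in : t0 <= t0 <= t1 by rewrite lexx ltW.
split=> hd.
- have inc := dphi_nondecreasing ell_cont ell_gt0 ell_deriv dell_lt1 LE phi_deriv dphi_gt0
    phi_ell
    t00 (ltW t01) mono (fun t ht => (hd t ht).2).
  split => // [x y|t tin].
    rewrite !in_itv/= => /andP[tx _] /andP[_ yt] xy.
    exact: (energy_nondecreasing ell_cont ell_gt0 ell_deriv dell_lt1 fb fE t00
      (ell_dec (fun t ht => (hd t ht).2)) tx xy yt).
  (* The extreme values of a monotone [dphi] on a characteristic interval are its end values, which
     [ratio] accepts as bounds. *)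
  have bnd t' : t0 <= t' <= t1 -> forall s, t' - ell t' <= s <= t' + ell t' ->
      dphi (t' - ell t') <= dphi s <= dphi (t' + ell t').
    move=> ht s hs; have /andP[s1 s2] := hs.
    by rewrite !inc// ?(sub _ _ ht (endl _ ht)) ?(sub _ _ ht (endr _ ht)) ?(sub _ _ ht hs).
  have /andP[h1 _] := tin.
  exact: (ratio _ _ _ _ _ _ t00 h1 (pos _ _ tin (endl _ tin)) (pos _ _ t0in (endl _ t0in)) (bnd
    _ tin) (bnd _ t0in)).
- have dec := dphi_nonincreasing ell_cont ell_gt0 ell_deriv dell_lt1 LE phi_deriv dphi_gt0
    phi_ell
    t00 (ltW t01) mono (fun t ht => (hd t ht).1).
  split => // [x y|t tin].
    rewrite !in_itv/= => /andP[_ xt] /andP[ty _] yx.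
    exact: (energy_nonincreasing ell_cont ell_gt0 ell_deriv dell_lt1 fb fE t00
      (ell_inc (fun t ht => (hd t ht).1)) ty yx xt).
  have bnd t' : t0 <= t' <= t1 -> forall s, t' - ell t' <= s <= t' + ell t' ->
      dphi (t' + ell t') <= dphi s <= dphi (t' - ell t').
    move=> ht s hs; have /andP[s1 s2] := hs.
    by rewrite !dec// ?(sub _ _ ht (endl _ ht)) ?(sub _ _ ht (endr _ ht)) ?(sub _ _ ht hs).
  have /andP[h1 _] := tin.
  exact: (ratio _ _ _ _ _ _ t00 h1 (pos _ _ tin (endr _ tin)) (pos _ _ t0in (endr _ t0in)) (bnd
    _ tin) (bnd _ t0in)).
Qed.
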